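(* For every integer $n \ge 2$, there exists a pseudoconvex domain $\Omega \subset \mathbb{C}^n$ such that $\mathfrak{c}^0(\Omega) \subsetneq \mathfrak{c}^1(\Omega)$ and such that, moreover, there exists a bounded continuous plurisubharmonic function on $\Omega$ that is not the pointwise limit of a sequence of $\mathcal{C}^1$-smooth bounded plurisubharmonic functions on $\Omega$.
   Context: For a domain $\Omega \subset \mathbb{C}^n$, $\mathcal{PSH}(\Omega)$ denotes the set of plurisubharmonic functions on $\Omega$, and $\mathcal{PSH}^k(\Omega) := \mathcal{PSH}(\Omega) \cap \mathcal{C}^k(\Omega)$ for $k \in \{0,1\}$. A function $\varphi \colon \Omega \to [-\infty, \infty)$, $\varphi \not\equiv -\infty$, is called strictly plurisubharmonic if for every $\mathcal{C}^\infty$-smooth function $\theta \colon \Omega \to \mathbb{R}$ with compact support there exists a constant $\varepsilon_0 > 0$ such that for all $\varepsilon \in (-\varepsilon_0, \varepsilon_0)$ the function $\varphi + \varepsilon\theta$ is plurisubharmonic on $\Omega$. The same definition is applied on open subsets: $\varphi$ is strictly plurisubharmonic on an open set $U \subset \Omega$ if its restriction to $U$ satisfies this condition with $U$ in place of $\Omega$. We say that $\varphi$ is strictly plurisubharmonic near a point $z \in \Omega$ if $\varphi$ is strictly plurisubharmonic on some open neighborhood $U \subset \Omega$ of $z$. For $k \in \{0,1\}$, the core $\mathfrak{c}^k(\Omega)$ is the set of all $z \in \Omega$ such that every function $\varphi \in \mathcal{PSH}^k(\Omega)$ that is bounded from above fails to be strictly plurisubharmonic near $z$. In the approximation statement, each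 function of the approximating sequence is bounded on $\Omega$, but no bound uniform in the sequence is required. *)

(* Defs.v *)
From HB Require Import structures.
From mathcomp Require Import all_boot all_order all_algebra.
From mathcomp Require Import all_classical all_reals all_analysis.

Set Implicit Arguments.
Unset Strict Implicit.
Unset Printing Implicit Defensive.

Import Order.TTheory GRing.Theory Num.Theory.
Import numFieldNormedType.Exports.

Local Open Scope classical_set_scope.
Local Open Scope ring_scope.

(* The complex line and complex n-space are represented by their real and
   imaginary parts, (x, y) standing for x + iy.  In this form they are normed
   modules over R, so that the real-variable notions [differentiable], ['D_v]
   and [continuous] apply to functions on them; R[i] and its row vectors carry
   no such structure over R.  The product norm is a max norm: it gives the
   usual topology, but its balls are not Euclidean. *)
Definition Cplx (R : realType) : normedModType R := (R^o * R^o)%type.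

Definition Cn (R : realType) (n : nat) : normedModType R :=
  ('rV[R]_n * 'rV[R]_n)%type.

(* (a + ib)(x + iy) = (ax - by) + i(ay + bx) *)
Definition cvscale (R : realType) (n : nat) (c : Cplx R) (w : Cn R n) : Cn R n :=
  (c.1 *: w.1 - c.2 *: w.2, c.1 *: w.2 + c.2 *: w.1).

Definition closed_disc (R : realType) (a : Cplx R) (r : R) : set (Cplx R) :=
  [set c | (c.1 - a.1) ^+ 2 + (c.2 - a.2) ^+ 2 <= r ^+ 2].

Definition circle_point (R : realType) (a : Cplx R) (r t : R) : Cplx R :=
  (a.1 + r * cos t, a.2 + r * sin t).

Definition usc_on (R : realType) (X : topologicalType) (A : set X)
    (f : X -> \bar R) : Prop :=
  forall x (c : R), A x -> (f x < c%:E)%E ->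
    \forall y \near within A (nbhs x), (f y < c%:E)%E.

(* Values in [-oo, +oo[, with the function identically -oo allowed.  Upper
   semicontinuity bounds u from above on each circle, so the integral is
   well defined in [-oo, +oo[. *)
Definition subharmonic (R : realType) (D : set (Cplx R))
    (u : Cplx R -> \bar R) : Prop :=
  [/\ forall c, D c -> (u c < +oo)%E,
      usc_on D u
    & forall (a : Cplx R) (r : R), 0 < r -> closed_disc a r `<=` D ->
        (u a <= (2 * pi)^-1%:E *
           \int[lebesgue_measure]_(t in `[0%R, (2 * pi)%R])
             u (circle_point a r t))%E].

Definition psh (R : realType) (n : nat) (U : set (Cn R n))
    (phi : Cn R n -> \bar R) : Prop :=
  [/\ forall z, U z -> (phi z < +oo)%E,
      usc_on U phi
    & forall z w : Cn R n,
        subharmonic [set c | U (z + cvscale c w)]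
                    (fun c => phi (z + cvscale c w))].

(* C^k-smoothness on an open set U, in the real sense. *)
Fixpoint Ck (R : realType) (n k : nat) (U : set (Cn R n))
    (f : Cn R n -> R) : Prop :=
  match k with
  | 0 => {within U, continuous f}
  | k'.+1 => (forall z, U z -> differentiable f z) /\
             (forall v, Ck k' U ('D_v f))
  end.

Definition Cinfty (R : realType) (n : nat) (U : set (Cn R n))
    (f : Cn R n -> R) : Prop :=
  forall k, Ck k U f.

Definition PSHk (R : realType) (n k : nat) (U : set (Cn R n))
    (f : Cn R n -> R) : Prop :=
  Ck k U f /\ psh U (EFin \o f).

Definition relatively_compact_in (X : topologicalType) (A U : set X) : Prop :=
  compact (closure A) /\ closure A `<=` U.

Definition compactly_supported (R : realType) (n : nat) (U : set (Cn R n))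
    (theta : Cn R n -> R) : Prop :=
  relatively_compact_in [set z | U z /\ theta z != 0] U.

Definition strictly_psh (R : realType) (n : nat) (U : set (Cn R n))
    (phi : Cn R n -> \bar R) : Prop :=
  (exists2 z, U z & phi z != -oo%E) /\
  forall theta : Cn R n -> R, Cinfty U theta -> compactly_supported U theta ->
    exists2 eps0 : R, 0 < eps0 &
      forall eps : R, - eps0 < eps < eps0 ->
        psh U (fun z => phi z + (eps * theta z)%:E)%E.

Definition strictly_psh_near (R : realType) (n : nat) (Omega : set (Cn R n))
    (phi : Cn R n -> \bar R) (z : Cn R n) : Prop :=
  exists U : set (Cn R n),
    [/\ open U, U z, U `<=` Omega & strictly_psh U phi].

Definition core (R : realType) (n k : nat) (Omega : set (Cn R n)) :
    set (Cn R n) :=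
  [set z | Omega z /\
    forall phi : Cn R n -> R, PSHk k Omega phi -> has_ubound (phi @` Omega) ->
      ~ strictly_psh_near Omega (EFin \o phi) z].

Definition domain (R : realType) (n : nat) (Omega : set (Cn R n)) : Prop :=
  [/\ open Omega, connected Omega & Omega !=set0].

(* Existence of a continuous plurisubharmonic exhaustion function. *)
Definition pseudoconvex (R : realType) (n : nat) (Omega : set (Cn R n)) : Prop :=
  exists2 rho : Cn R n -> R, PSHk 0 Omega rho &
    forall c : R, relatively_compact_in [set z | Omega z /\ rho z < c] Omega.

(* Main.v *)
(** Let z and w be the first two coordinates.  Points w_k outside the closed
    unit disc are chosen with |w_k| = 1 + eta_k, eta_k -> 0, and with every
    rational angle occurring infinitely often.  Omega contains the line z = 3,
    the lines w = w_k and the disc z = 0, |w| <= 2, but over 1 <= |z| <= 2 it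
    reduces to thin tubes around the lines w = w_k.

    A bounded above C^1 plurisubharmonic function is constant on all these lines
    by Liouville's theorem, with the same value m, so it equals m at every
    (0, w_k) and, by density, on the circle z = 0, |w| = 1.  Its derivative in
    the direction of w at w = 1 vanishes, because w = 1 is approached radially
    by points w_k; if its value at the origin were less than m, the Hopf lemma
    would contradict this.  Hence it has a maximum over the disc at the origin,
    where it cannot be strictly plurisubharmonic, and any pointwise limit of
    such functions takes the same value at w = 0 and w = 1.

    A continuous function escapes: |w|^2 - 1 can be flattened to 0 near each
    w_k by logarithmic dips, remaining subharmonic and negative for |w| < 1.
    Its maximum with (|Z|^2 - 10) / 20 is 0 over 1 <= |z| <= 2, so it extends
    by 0, and it equals (|Z|^2 - 10) / 20 near the origin.

    Omega is a component of the union of the sets G_k < 1, where each G_k is a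
    sum of squared moduli of polynomials, G_{k+1} vanishes on the line w = w_k,
    and G_{k+1} <= G_k wherever G_k < 1; adding to |Z|^2 the locally finite sum
    of (k+1)^2 max (0, G_k - 1 + 1/(k+1)) gives an exhaustion function. *)

Require Import Defs.
From HB Require Import structures.
From mathcomp Require Import all_boot all_order all_algebra.
From mathcomp Require Import all_classical all_reals all_analysis.
From mathcomp Require Import ring lra complex.

Set Implicit Arguments.
Unset Strict Implicit.
Unset Printing Implicit Defensive.

Import Order.TTheory GRing.Theory Num.Theory.
Import numFieldNormedType.Exports.

Local Open Scope classical_set_scope.
Local Open Scope ring_scope.

Section ContinuityRules.
Variables (R : realType) (T : topologicalType) (x : T).
Implicit Types f g : T -> R.

Lemma contC (c : R) : {for x, continuous (fun _ : T => c)}.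
Proof. exact: cst_continuous. Qed.
Lemma contD f g : {for x, continuous f} -> {for x, continuous g} ->
  {for x, continuous (fun y => f y + g y)}.
Proof. exact: cvgD. Qed.
Lemma contN f : {for x, continuous f} -> {for x, continuous (fun y => - f y)}.
Proof. exact: cvgN. Qed.
Lemma contM f g : {for x, continuous f} -> {for x, continuous g} ->
  {for x, continuous (fun y => f y * g y)}.
Proof. exact: cvgM. Qed.
Lemma contX f (n : nat) : {for x, continuous f} -> {for x, continuous (fun y => f y ^+ n)}.
Proof.
move=> cf; elim: n => [|n IH].
  have -> : (fun y => f y ^+ 0) = (fun=> 1) by apply/funext => y; rewrite expr0.
  exact: contC.
have -> : (fun y => f y ^+ n.+1) = (fun y => f y * f y ^+ n).
  by apply/funext => y; rewrite exprS.
exact: contM.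
Qed.
Lemma cont_max f g : {for x, continuous f} -> {for x, continuous g} ->
  {for x, continuous (fun y => Num.max (f y) (g y))}.
Proof. exact: continuous_max. Qed.
Lemma cont_min f g : {for x, continuous f} -> {for x, continuous g} ->
  {for x, continuous (fun y => Num.min (f y) (g y))}.
Proof. exact: continuous_min. Qed.
Lemma cont_comp (g : R -> R) f : {for x, continuous f} -> {for f x, continuous g} ->
  {for x, continuous (fun y => g (f y))}.
Proof. by move=> cf cg; apply: (@continuous_comp _ _ _ f g). Qed.
Lemma cont_sum (N : nat) (G : nat -> T -> R) :
  (forall k, (k < N)%N -> {for x, continuous (G k)}) ->
  {for x, continuous (fun y => \sum_(k < N) G k y)}.
Proof.
elim: N => [_|N IH cG].
  have -> : (fun y => \sum_(k < 0) G k y) = (fun=> 0) by apply/funext => y; rewrite big_ord0.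
  exact: contC.
have -> : (fun y => \sum_(k < N.+1) G k y) = (fun y => \sum_(k < N) G k y + G N y).
  by apply/funext => y; rewrite big_ord_recr.
by apply: contD; [apply: IH => k kN; apply: cG; rewrite ltnS ltnW | exact: cG].
Qed.
End ContinuityRules.

Ltac cont1 := unfold prop_for; lazymatch goal with
  | |- continuous_at _ (fun y => (@?f y) + (@?g y)) => simple refine (@contD _ _ _ f g _ _)
  | |- continuous_at _ (fun y => (@?f y) * (@?g y)) => simple refine (@contM _ _ _ f g _ _)
  | |- continuous_at _ (fun y => - (@?f y)) => simple refine (@contN _ _ _ f _)
  | |- continuous_at _ (fun y => (@?f y) ^+ ?n) => simple refine (@contX _ _ _ f n _)
  | |- continuous_at _ (fun y => Num.max (@?f y) (@?g y)) => simple refine (@cont_max _ _ _ f g _ _)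
  | |- continuous_at _ (fun y => Num.min (@?f y) (@?g y)) => simple refine (@cont_min _ _ _ f g _ _)
  | |- continuous_at _ (fun y => ?c) => simple refine (@contC _ _ _ c)
  | |- continuous_at _ (fun y => y) => exact: cvg_id
  end; cbv beta.
Ltac cont := repeat first [ assumption | cont1 ].

(** * Means over circles *)

Section Mean.
Variable R : realType.
Implicit Types (g h : R -> R).

Definition amean g : R :=
  (2 * pi)^-1 * \int[lebesgue_measure]_(t in `[0%R, (2 * pi)%R]) g t.

Lemma twopi_gt0 : 0 < 2 * pi :> R. Proof. by rewrite mulr_gt0 // pi_gt0. Qed.

Lemma continuous_integrable_itv g (a b : R) : continuous g ->
  lebesgue_measure.-integrable `[a, b] (EFin \o g).
Proof.
move=> cg; apply: continuous_compact_integrable; first exact: segment_compact.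
exact: continuous_subspaceT.
Qed.

Lemma is_derive_continuous (F : R -> R) (t d : R) :
  is_derive t 1 F d -> {for t, continuous F}.
Proof. by case=> dF _; apply: differentiable_continuous; apply/derivable1_diffP. Qed.

Lemma amean_FTC g (F : R -> R) : continuous g ->
  (forall t : R, -1 < t -> is_derive t 1 F (g t)) ->
  amean g = (F (2 * pi) - F 0) / (2 * pi).
Proof.
move=> cg dF; rewrite /amean mulrC; congr (_ / _).
have cF (t : R) : -1 < t -> {for t, continuous F}.
  by move=> /dF; apply: is_derive_continuous.
rewrite /Rintegral (@continuous_FTC2 _ g F) //.
- exact: twopi_gt0.
- exact: continuous_subspaceT.
- split.
  + by move=> x; rewrite in_itv /= => /andP[x0 _]; case: (dF x) => //; lra.
  + by apply: cvg_at_right_filter; apply: cF; lra.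
  + by apply: cvg_at_left_filter; apply: cF; have := twopi_gt0; lra.
- by move=> x; rewrite in_itv /= => /andP[x0 _]; rewrite derive1E; case: (dF x) => //; lra.
Qed.

Lemma continuous_primitive g : continuous g ->
  exists F : R -> R, forall t : R, -1 < t -> is_derive t 1 F (g t).
Proof.
move=> cg.
pose F x := \int[lebesgue_measure]_(t in [set` Interval (BLeft (-1)) (BRight x)]) g t.
exists F => t t1.
have [|||dF DF] := @continuous_FTC1 R g (BLeft (-1)) t (t + 1) _ _ _ (cg t).
- by rewrite ltrDl.
- exact: continuous_integrable_itv.
- exact: t1.
- by apply: DeriveDef; [exact: dF | rewrite -derive1E; exact: DF].
Qed.

Lemma amean_EFin g : continuous g ->
  ((2 * pi)^-1%:E *
    \int[lebesgue_measure]_(t in `[0%R, (2 * pi)%R]) (g t)%:E)%E = (amean g)%:E.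
Proof.
move=> cg; rewrite /amean EFinM /Rintegral fineK //.
exact: integrable_fin_num (continuous_integrable_itv _ _ cg).
Qed.

Lemma amean_cst (c : R) : amean (fun=> c) = c.
Proof.
have dF (t : R) : -1 < t -> is_derive t 1 (fun x => c * x) c.
  by move=> _; apply: is_derive_eq; rewrite /GRing.scale /= mulr1.
rewrite (amean_FTC _ dF); last exact: cst_continuous.
by rewrite mulr0 subr0 mulfK // gt_eqF // twopi_gt0.
Qed.

Lemma ameanD g h : continuous g -> continuous h ->
  amean (fun t => g t + h t) = amean g + amean h.
Proof.
move=> cg ch; rewrite /amean RintegralD ?mulrDr //; exact: continuous_integrable_itv.
Qed.

Lemma ameanZ (k : R) g : continuous g -> amean (fun t => k * g t) = k * amean g.
Proof.
move=> cg; rewrite /amean RintegralZl //; last exact: continuous_integrable_itv.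
by rewrite mulrCA.
Qed.

Lemma ler_amean g h : continuous g -> continuous h ->
  (forall t, g t <= h t) -> amean g <= amean h.
Proof.
move=> cg ch gh; rewrite /amean ler_pM2l ?invr_gt0 ?twopi_gt0 //.
by apply: le_Rintegral => //; exact: continuous_integrable_itv.
Qed.

Lemma is_derive_shift (F : R -> R) (s t d : R) :
  is_derive (t + s) 1 F d -> is_derive t 1 (fun x => F (x + s)) d.
Proof.
move=> dF; rewrite -[d]mulr1 -/(d *: 1)%R.
apply: (@is_derive1_comp _ F (fun x => x + s)).
by rewrite -[X in is_derive _ _ _ X]addr0; apply: is_deriveD.
Qed.

Lemma amean_shift g (s : R) : continuous g -> (forall t, g (t + 2 * pi) = g t) ->
  0 <= s -> amean (fun t => g (t + s)) = amean g.
Proof.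
move=> cg pg s0; have [F dF] := continuous_primitive cg.
have dFs (t : R) : -1 < t -> is_derive t 1 (fun x => F (x + s)) (g (t + s)).
  by move=> t1; apply: is_derive_shift; apply: dF; lra.
rewrite (amean_FTC cg dF) (amean_FTC _ dFs).
- congr (_ / _); rewrite add0r.
  pose H x := F (x + 2 * pi) - F x.
  have dH (x : R) : -1 < x -> is_derive x 1 H 0.
    move=> x1; rewrite -(subrr (g x)); apply: is_deriveB; last exact: dF.
    apply: is_derive_shift; rewrite -pg; apply: dF; have := twopi_gt0; lra.
  have [||c _ Hs] := @MVT_segment R H (fun=> 0) 0 s s0.
  + by move=> x; rewrite in_itv /= => /andP[x0 _]; apply: dH; lra.
  + apply: continuous_in_subspaceT => x; rewrite inE /= in_itv /= => /andP[x0 _].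
    by apply: is_derive_continuous; apply: dH; lra.
  by move: Hs; rewrite mul0r /H add0r (addrC s); lra.
- move=> t; apply: (@continuous_comp _ _ _ (fun x => x + s) g); last exact: cg.
  by apply: continuousD => //; exact: cst_continuous.
Qed.

Lemma sin_natpi (k : nat) : sin (k%:R * (2 * pi)) = 0 :> R.
Proof.
have -> : k%:R * (2 * pi) = 0 + (pi *+ 2) *+ k :> R.
  by rewrite add0r -(mulr_natl pi) -[RHS]mulr_natl.
by rewrite (periodicn (@sinD2pi R)) sin0.
Qed.

Lemma cos_natpi (k : nat) : cos (k%:R * (2 * pi)) = 1 :> R.
Proof.
have -> : k%:R * (2 * pi) = 0 + (pi *+ 2) *+ k :> R.
  by rewrite add0r -(mulr_natl pi) -[RHS]mulr_natl.
by rewrite (periodicn (@cosD2pi R)) cos0.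
Qed.

Lemma continuous_cosn (k : nat) : continuous (fun t : R => cos (k%:R * t)).
Proof.
move=> t; apply: (@continuous_comp _ _ _ (fun x : R => k%:R * x) (@cos R)).
  by apply: continuousM => //; exact: cst_continuous.
exact: continuous_cos.
Qed.

Lemma continuous_sinn (k : nat) : continuous (fun t : R => sin (k%:R * t)).
Proof.
move=> t; apply: (@continuous_comp _ _ _ (fun x : R => k%:R * x) (@sin R)).
  by apply: continuousM => //; exact: cst_continuous.
exact: continuous_sin.
Qed.

Lemma amean_cosn (k : nat) : (0 < k)%N -> amean (fun t => cos (k%:R * t)) = 0.
Proof.
move=> k0; have kR : k%:R != 0 :> R by rewrite pnatr_eq0 -lt0n.
have dF (t : R) : -1 < t ->
    is_derive t 1 (fun x => k%:R^-1 * sin (k%:R * x)) (cos (k%:R * t)).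
  by move=> _; apply: is_derive_eq; rewrite /GRing.scale /= mulr1; field.
rewrite (amean_FTC _ dF); last exact: continuous_cosn.
by rewrite sin_natpi !mulr0 sin0 mulr0 subrr mul0r.
Qed.

Lemma amean_sinn (k : nat) : (0 < k)%N -> amean (fun t => sin (k%:R * t)) = 0.
Proof.
move=> k0; have kR : k%:R != 0 :> R by rewrite pnatr_eq0 -lt0n.
have dF (t : R) : -1 < t ->
    is_derive t 1 (fun x => - (k%:R^-1 * cos (k%:R * x))) (sin (k%:R * t)).
  by move=> _; apply: is_derive_eq; rewrite /GRing.scale /= mulr1; field.
rewrite (amean_FTC _ dF); last exact: continuous_sinn.
by rewrite cos_natpi mulr0 cos0 subrr mul0r.
Qed.

Lemma amean_cos : amean (fun t => cos t) = 0.
Proof. by rewrite -(@amean_cosn 1) //; congr amean; apply/funext => t; rewrite mul1r. Qed.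

Lemma amean_sin : amean (fun t => sin t) = 0.
Proof. by rewrite -(@amean_sinn 1) //; congr amean; apply/funext => t; rewrite mul1r. Qed.

End Mean.

Section Circles.
Variable R : realType.

Definition cis (t : R) : Cplx R := (cos t, sin t).
Definition nsq (c : Cplx R) : R := c.1 ^+ 2 + c.2 ^+ 2.
Definition cmul (a b : Cplx R) : Cplx R := (a.1 * b.1 - a.2 * b.2, a.1 * b.2 + a.2 * b.1).

Lemma nsq_cis t : nsq (cis t) = 1.
Proof. exact: cos2Dsin2. Qed.

Lemma nsq_ge0 c : 0 <= nsq c. Proof. by rewrite addr_ge0 ?sqr_ge0. Qed.

Lemma nsq_eq0 c : nsq c = 0 -> c = 0.
Proof.
case: c => x y; rewrite /nsq /= => /eqP; rewrite paddr_eq0 ?sqr_ge0 // !sqrf_eq0.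
by move=> /andP[/eqP -> /eqP ->].
Qed.

Lemma nsqM (a b : Cplx R) : nsq (cmul a b) = nsq a * nsq b.
Proof. by case: a b => [a1 a2] [b1 b2]; rewrite /nsq /cmul /=; ring. Qed.

Lemma continuous_at_comp (T U V : topologicalType) (g : U -> V) (f : T -> U) (x : T) :
  {for x, continuous f} -> {for f x, continuous g} ->
  {for x, continuous (fun y => g (f y))}.
Proof. by move=> cf cg; apply: (@continuous_comp _ _ _ f g). Qed.

Lemma cplx_continuous (T : topologicalType) (f : T -> Cplx R) (x : T) :
  {for x, continuous (fun y => (f y).1 : R)} -> {for x, continuous (fun y => (f y).2 : R)} ->
  {for x, continuous f}.
Proof.
move=> f1 f2.
have -> : f = (fun y => ((f y).1, (f y).2)) by apply/funext => y; case: (f y).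
exact: (cvg_pair f1 f2).
Qed.

Lemma continuous_re (c : Cplx R) : {for c, continuous (fun c : Cplx R => c.1 : R)}.
Proof. exact: cvg_fst. Qed.

Lemma continuous_im (c : Cplx R) : {for c, continuous (fun c : Cplx R => c.2 : R)}.
Proof. exact: cvg_snd. Qed.

Lemma continuous_cis : continuous cis.
Proof.
by move=> t; apply: cplx_continuous; [exact: continuous_cos | exact: continuous_sin].
Qed.

Lemma continuous_nsq : continuous nsq.
Proof.
move=> c; rewrite /nsq.
apply: (@cvgD _ _ _ (nbhs c) _ (fun c : Cplx R => c.1 ^+ 2 : R) (fun c : Cplx R => c.2 ^+ 2 : R)).
- by apply: cvgM; exact: continuous_re.
- by apply: cvgM; exact: continuous_im.
Qed.

Lemma continuous_cmull (a : Cplx R) : continuous (cmul a).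
Proof.
move=> c; apply: cplx_continuous => /=.
- apply: continuousB; apply: continuousM; try exact: cst_continuous.
  + exact: continuous_re.
  + exact: continuous_im.
- apply: continuousD; apply: continuousM; try exact: cst_continuous.
  + exact: continuous_im.
  + exact: continuous_re.
Qed.

Variable n : nat.
Implicit Types (Z W : Cn R n) (U : set (Cn R n)) (f : Cn R n -> R).

Lemma continuous_cvscale W : continuous (fun c => cvscale c W).
Proof.
move=> c.
have H1 : {for c, continuous (fun c : Cplx R => c.1 *: W.1 - c.2 *: W.2)}.
  apply: cvgB; apply: cvgZr_tmp; [exact: continuous_re|exact: continuous_im].
have H2 : {for c, continuous (fun c : Cplx R => c.1 *: W.2 + c.2 *: W.1)}.
  apply: cvgD; apply: cvgZr_tmp; [exact: continuous_re|exact: continuous_im].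
exact: (cvg_pair H1 H2).
Qed.

Definition disc Z W (c : Cplx R) : Cn R n := Z + cvscale c W.

Lemma continuous_disc Z W : continuous (disc Z W).
Proof.
by move=> c; apply: cvgD; [exact: cst_continuous | exact: continuous_cvscale].
Qed.

Lemma cvscaleA (a b : Cplx R) W : cvscale a (cvscale b W) = cvscale (cmul a b) W.
Proof.
by rewrite /cvscale /cmul; congr pair; apply/matrixP => i j; rewrite !mxE /=; ring.
Qed.

Lemma cvscaleD (a b : Cplx R) W : cvscale (a + b) W = cvscale a W + cvscale b W.
Proof.
by rewrite /cvscale; congr pair; apply/matrixP => i j; rewrite !mxE /=; ring.
Qed.

Lemma cvscaleZ (k : R) (c : Cplx R) W : cvscale c (k *: W) = cvscale (k *: c) W.
Proof.
rewrite /cvscale; congr pair; apply/matrixP => i j; rewrite !mxE /= /GRing.scale /=; ring.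
Qed.

Lemma disc_disc Z W a h c : disc (disc Z W a) (cvscale h W) c = disc Z W (a + cmul c h).
Proof. by rewrite /disc cvscaleD cvscaleA addrA. Qed.

Definition circ_in U Z W := forall c, nsq c <= 1 -> U (disc Z W c).

Lemma circle_pointE Z W a (r t : R) :
  disc Z W (circle_point a r t) = disc (disc Z W a) (r *: W) (cis t).
Proof.
rewrite /disc cvscaleZ -addrA -cvscaleD; congr (_ + cvscale _ _).
Qed.

Lemma continuous_circle U f Z W : open U -> (forall Z, U Z -> {for Z, continuous f}) ->
  (forall t, U (disc Z W (cis t))) -> continuous (fun t => f (disc Z W (cis t))).
Proof.
move=> oU cf UZW t.
have H : {for t, continuous (fun t => disc Z W (cis t))}.
  by apply: (continuous_at_comp (g := disc Z W)); [exact: continuous_cis | exact: continuous_disc].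
exact: (continuous_at_comp H (cf _ (UZW t))).
Qed.

Lemma psh_intro U f : open U -> (forall Z, U Z -> {for Z, continuous f}) ->
  (forall Z W, circ_in U Z W -> f Z <= amean (fun t => f (disc Z W (cis t)))) ->
  psh U (EFin \o f).
Proof.
move=> oU cf mf; split.
- by move=> z _; rewrite /= ltry.
- move=> z c Uz /=; rewrite lte_fin => fzc; apply: cvg_within.
  have : \forall y \near z, f y < c by exact: (cvgr_lt _ (cf _ Uz) _ fzc).
  by apply: filterS => y; rewrite lte_fin.
- move=> z w; split.
  + by move=> c _; rewrite ltry.
  + move=> c x Ux /=; rewrite lte_fin => fzc; apply: cvg_within.
    have cfd := continuous_at_comp (@continuous_disc z w c) (cf _ Ux).
    have : \forall y \near c, f (disc z w y) < x by exact: (cvgr_lt _ cfd _ fzc).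
    by apply: filterS => y; rewrite lte_fin.
  + move=> a r r0 /= sub.
    have cin : circ_in U (disc z w a) (r *: w).
      move=> c c1; rewrite /disc cvscaleZ -addrA -cvscaleD; apply: sub.
      rewrite /closed_disc /= [a.1 + _ - _]addrC [a.2 + _ - _]addrC !addKr.
      have -> : (r *: c.1) ^+ 2 + (r *: c.2) ^+ 2 = r ^+ 2 * nsq c.
        by rewrite /nsq /GRing.scale /=; ring.
      by rewrite ler_piMr ?sqr_ge0.
    have ccon : continuous (fun t => f (disc (disc z w a) (r *: w) (cis t))).
      by apply: (continuous_circle oU cf) => t; apply: cin; rewrite nsq_cis.
    have := mf _ _ cin; rewrite -lee_fin -(amean_EFin ccon) => /le_trans; apply.
    by under eq_integral do rewrite -circle_pointE.
Qed.

Lemma psh_elim U f Z W : open U -> (forall Z, U Z -> {for Z, continuous f}) ->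
  psh U (EFin \o f) -> circ_in U Z W -> f Z <= amean (fun t => f (disc Z W (cis t))).
Proof.
move=> oU cf [_ _ /(_ Z W)[_ _ /(_ 0 1 ltr01)]] H cin.
have ccon : continuous (fun t => f (disc Z W (cis t))).
  by apply: (continuous_circle oU cf) => t; apply: cin; rewrite nsq_cis.
rewrite -lee_fin -(amean_EFin ccon).
have -> : (f Z)%:E = (EFin \o f) (Z + cvscale 0 W).
  by rewrite /cvscale /= !scale0r subr0 addr0; case: (Z) => z1 z2; rewrite /GRing.add /= /add_pair /= !addr0.
apply: le_trans; first apply: H.
- move=> c; rewrite /closed_disc /= !subr0 expr1n => c1; exact: cin.
- rewrite lee_pmul2l ?lte_fin ?invr_gt0 ?twopi_gt0 //.
  rewrite le_eqVlt; apply/orP; left; apply/eqP.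
  apply: eq_integral => t _ /=; congr (EFin (f _)).
  rewrite /disc /circle_point /cis /=; congr (_ + cvscale _ _); congr pair; by rewrite add0r mul1r.
Qed.
End Circles.

Section LocalGlobal.
Variable R : realType.
Implicit Types (g : R -> R) (f : Cplx R -> R).

Lemma heine g (a b e : R) : continuous g -> 0 < e ->
  exists2 d : R, 0 < d & forall x y, a <= x <= b -> `|x - y| < d -> `|g x - g y| < e.
Proof.
move=> cg e0.
have := @segment_compact _ a b; rewrite compact_near_coveringP => cab.
have := cab R (nbhs (0:R)^'+) (fun i x => forall y, `|x - y| < i -> `|g x - g y| < e).
case.
- move=> x _; have /cvgrPdist_lt/(_ _ (divr_gt0 e0 (ltr0Sn _ 1))) := cg x.
  move=> /nbhs_ballP[d /= d0 dx].
  exists (ball x (d / 2), [set i | i < d / 2]) => /=.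
    split; first by apply: nbhsx_ballx; rewrite divr_gt0.
    by apply: nbhs_right_lt; rewrite divr_gt0.
  move=> [x' i] /= [xx' id2] y x'y.
  have h1 : `|g x - g x'| < e / 2.
    by apply: dx; rewrite /ball /= (lt_le_trans xx') // ler_pdivrMr // ler_pMr // ler1n.
  have h2 : `|g x - g y| < e / 2.
    apply: dx; rewrite /ball /= (splitr d).
    rewrite -(subrK x' x) -addrA (le_lt_trans (ler_normD _ _)) // ltrD //.
    exact: lt_trans x'y id2.
  rewrite (splitr e) -(subrK (g x) (g x')) -addrA (le_lt_trans (ler_normD _ _)) // ltrD //.
  by rewrite distrC.
- move=> d /= d0 H; exists (d / 2); first by rewrite divr_gt0.
  move=> x y xab; apply: (H (d / 2)) => //=; last by rewrite divr_gt0.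
  by rewrite sub0r normrN gtr0_norm ?divr_gt0 // ltr_pdivrMr // ltr_pMr // ltr1n.
Qed.

Lemma riemann_le g (N : nat) (s w : R) : continuous g -> (forall t, g (t + 2 * pi) = g t) ->
  0 <= s <= 2 * pi -> (0 < N)%N ->
  (forall x y, 0 <= x <= 4 * pi -> x <= y <= x + 2 * pi / N%:R -> g x <= g y + w) ->
  N%:R^-1 * (\sum_(k < N) g (s + 2 * pi / N%:R * k%:R)) <= amean g + w.
Proof.
move=> cg pg /andP[s0 s1] N0 H.
have NR : 0 < N%:R :> R by rewrite ltr0n.
set h := 2 * pi / N%:R in H *.
have h0 : 0 < h by rewrite divr_gt0 // twopi_gt0.
have [F dF] := continuous_primitive cg.
have cgs : continuous (fun t => g (t + s)).
  move=> t; apply: (continuous_at_comp (f := fun x : R => x + s)); last exact: cg.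
  by apply: continuousD => //; exact: cst_continuous.
have -> : amean g = (F (s + h * N%:R) - F s) / (2 * pi).
  rewrite -(amean_shift cg pg s0).
  have dFs (t : R) : -1 < t -> is_derive t 1 (fun x => F (x + s)) (g (t + s)).
    by move=> t1; apply: is_derive_shift; apply: dF; lra.
  by rewrite (amean_FTC cgs dFs) add0r addrC /h divfK ?gt_eqF // addrC (addrC s).
have -> : F (s + h * N%:R) - F s = \sum_(k < N) (F (s + h * k.+1%:R) - F (s + h * k%:R)).
  rewrite -(big_mkord xpredT (fun k => F (s + h * k.+1%:R) - F (s + h * k%:R))).
  by rewrite (telescope_sumr (fun k => F (s + h * k%:R))) // mulr0 addr0.
have step (k : nat) : (k < N)%N ->
   h * (g (s + h * k%:R) - w) <= F (s + h * k.+1%:R) - F (s + h * k%:R).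
  move=> kN; have hk : s + h * k%:R <= s + h * k.+1%:R.
    by rewrite lerD2l ler_pM2l // ler_nat.
  have hk0 : 0 <= h * k%:R by rewrite mulr_ge0 // ltW.
  have hkN : h * k%:R <= 2 * pi.
    by rewrite /h mulrAC ler_pdivrMr // ler_pM2l ?twopi_gt0 // ler_nat ltnW.
  have [||c] := @MVT_segment R F g _ _ hk.
  - by move=> x; rewrite in_itv /= => /andP[x0 _]; apply: dF; lra.
  - apply: continuous_in_subspaceT => x; rewrite inE /= in_itv /= => /andP[x0 _].
    by apply: is_derive_continuous; apply: dF; lra.
  rewrite in_itv /= => /andP[c0 c1] ->.
  have e : s + h * k.+1%:R - (s + h * k%:R) = h by rewrite -natr1; ring.
  rewrite e mulrC ler_pM2r // lerBlDr; apply: H; apply/andP; split => //.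
  - lra.
  - lra.
  - by rewrite (le_trans c1) // -natr1; lra.
rewrite -lerBlDr ler_pdivlMr ?twopi_gt0 //.
have -> : (N%:R^-1 * (\sum_(k < N) g (s + h * k%:R)) - w) * (2 * pi) =
   \sum_(k < N) h * (g (s + h * k%:R) - w).
  rewrite -mulr_sumr sumrB sumr_const card_ord -mulr_natr /h.
  by field; rewrite gt_eqF.
by apply: ler_sum => k _; apply: step.
Qed.

Lemma cmulA : associative (@cmul R).
Proof. by move=> [a1 a2] [b1 b2] [c1 c2]; rewrite /cmul /=; congr pair; ring. Qed.
Lemma cmulC : commutative (@cmul R).
Proof. by move=> [a1 a2] [b1 b2]; rewrite /cmul /=; congr pair; ring. Qed.
Lemma cmulDr (a b c : Cplx R) : cmul a (b + c) = cmul a b + cmul a c.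
Proof. by case: a b c => [a1 a2] [b1 b2] [c1 c2]; rewrite /cmul /=; congr pair; rewrite /=; ring. Qed.
Lemma cmulZr (k : R) (a b : Cplx R) : cmul a (k *: b) = k *: cmul a b.
Proof.
by case: a b => [a1 a2] [b1 b2]; rewrite /cmul /=; congr pair; rewrite /GRing.scale /=; ring.
Qed.
Lemma cmul0r (a : Cplx R) : cmul a 0 = 0.
Proof. by rewrite /cmul /= !mulr0 subr0 addr0. Qed.
Lemma cis_add (s t : R) : cmul (cis s) (cis t) = cis (s + t).
Proof. by rewrite /cmul /cis /= cosD sinD; congr pair; rewrite addrC mulrC (mulrC (cos t)) // addrC. Qed.
End LocalGlobal.

(** * The local sub-mean value inequality *)

Section LocalSubmean.
Variable R : realType.
Implicit Types (g : R -> R) (f : Cplx R -> R).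

Lemma continuous_amean_sum (N : nat) (G : nat -> R -> R) :
  (forall k, (k < N)%N -> continuous (G k)) ->
  amean (fun t => \sum_(k < N) G k t) = \sum_(k < N) amean (G k) /\
   continuous (fun t => \sum_(k < N) G k t).
Proof.
elim: N => [_|N IH cG].
  under [in X in amean X]eq_fun do rewrite big_ord0.
  under [in X in continuous X]eq_fun do rewrite big_ord0.
  by rewrite big_ord0 amean_cst; split => //; exact: cst_continuous.
have [|E C] := IH; first by move=> k kN; apply: cG; rewrite ltnS ltnW.
under [in X in amean X]eq_fun do rewrite big_ord_recr /=.
under [in X in continuous X]eq_fun do rewrite big_ord_recr /=.
rewrite big_ord_recr /= ameanD ?E //; last exact: cG.
by split => // t; apply contD; [exact: C | exact: cG].
Qed.

Lemma continuous_cispoly (a b c : R) : continuous (fun t : R => a + (b * cos t + c * sin t)).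
Proof.
have ccos := @continuous_cos R; have csin := @continuous_sin R.
by move=> t; cont; [exact: ccos | exact: csin].
Qed.

Lemma amean_cispoly (a b c : R) : amean (fun t => a + (b * cos t + c * sin t)) = a.
Proof.
have ccos := @continuous_cos R; have csin := @continuous_sin R.
have cb : continuous (fun t : R => b * cos t).
  by move=> t; cont; exact: ccos.
have cc : continuous (fun t : R => c * sin t).
  by move=> t; cont; exact: csin.
rewrite ameanD; last 2 first.
- exact: cst_continuous.
- by move=> t; apply contD; [exact: cb | exact: cc].
by rewrite amean_cst ameanD // !ameanZ // amean_cos amean_sin !mulr0 !addr0.
Qed.

Definition circ (p h : Cplx R) (t : R) : Cplx R := p + cmul (cis t) h.

Lemma continuous_circ p h : continuous (circ p h).
Proof.
move=> t; apply: cplx_continuous; rewrite /circ /=.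
- have -> : (fun y : R => p.1 + (cos y * h.1 - sin y * h.2)) =
     (fun y => p.1 + (h.1 * cos y + (- h.2) * sin y)) by apply/funext => y; ring.
  exact: continuous_cispoly.
- have -> : (fun y : R => p.2 + (cos y * h.2 + sin y * h.1)) =
     (fun y => p.2 + (h.2 * cos y + h.1 * sin y)) by apply/funext => y; ring.
  exact: continuous_cispoly.
Qed.

Lemma nsq_circ p h t : nsq (circ p h t) = nsq p + nsq h +
  (2 * (p.1 * h.1 + p.2 * h.2) * cos t + 2 * (p.2 * h.1 - p.1 * h.2) * sin t).
Proof.
have e : nsq h = (cos t ^+ 2 + sin t ^+ 2) * nsq h by rewrite cos2Dsin2 mul1r.
by rewrite [in RHS]e /circ /nsq /cmul /cis /=; ring.
Qed.

Lemma amean_nsq p h : amean (fun t => nsq (circ p h t)) = nsq p + nsq h.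
Proof. by under [X in amean X]eq_fun do rewrite nsq_circ; rewrite amean_cispoly. Qed.

Lemma nbhs_nsq (O : set (Cplx R)) p : nbhs p O ->
  exists2 d : R, 0 < d & forall h, nsq h < d ^+ 2 -> O (p + h).
Proof.
move=> /nbhs_ballP[d /= d0 dO]; exists d => // h hd; apply: dO.
have hle (x : R) : x ^+ 2 < d ^+ 2 -> `|x| < d.
  by rewrite -[x ^+ 2]real_normK ?num_real // ltr_pXn2r // ?nnegrE // ltW.
split; rewrite /ball /= opprD addrA subrr sub0r normrN; apply: hle; apply: le_lt_trans hd.
- by rewrite /nsq lerDl sqr_ge0.
- by rewrite /nsq lerDr sqr_ge0.
Qed.

Lemma nsq_disc_compact (r : R) : compact [set c : Cplx R | nsq c <= r].
Proof.
have [r0|r0] := ltP r 0.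
  have -> : [set c : Cplx R | nsq c <= r] = set0.
    by apply/seteqP; split => c //=; have := nsq_ge0 c; lra.
  exact: compact0.
pose s := r + 1.
have cK : compact (`[- s, s] `*` `[- s, s] : set (Cplx R)).
  by apply: compact_setX; exact: segment_compact.
apply: (subclosed_compact _ cK).
- have -> : [set c : Cplx R | nsq c <= r] = @nsq R @^-1` [set x | x <= r] by [].
  by apply: closed_comp; [move=> c _; exact: continuous_nsq | exact: closed_le].
- move=> [x y] /=; rewrite /nsq /= => H.
  have x2 : `|x| <= s.
    rewrite -(@ler_pXn2r _ 2) ?nnegrE ?normr_ge0 ?real_normK ?num_real //; rewrite /s.
    - by have := sqr_ge0 y; nra.
    - by lra.
  have y2 : `|y| <= s.
    rewrite -(@ler_pXn2r _ 2) ?nnegrE ?normr_ge0 ?real_normK ?num_real //; rewrite /s.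
    - by have := sqr_ge0 x; nra.
    - by lra.
  by split; rewrite in_itv /= -ler_norml.
Qed.

Lemma max_principle (K O : set (Cplx R)) f : compact K -> K !=set0 ->
  (forall c, K c -> {for c, continuous f}) ->
  (forall p, K p -> O p -> exists h, [/\ forall t, K (circ p h t) &
     f p < amean (fun t => f (circ p h t))]) ->
  exists q, [/\ K q, ~ O q & forall c, K c -> f c <= f q].
Proof.
move=> cK K0 cf H.
have [|q] := @compact_EVT_max _ _ f K K0 cK.
  by apply: continuous_in_subspaceT => c; rewrite inE; exact: cf.
rewrite inE => Kq qmax; exists q; split => //; last by move=> c Kc; apply: qmax; rewrite inE.
move=> Oq; have [h [Kh]] := H q Kq Oq; apply/negP; rewrite -leNgt.
rewrite -[leRHS](amean_cst); apply: ler_amean.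
- by move=> t; apply: (continuous_at_comp (@continuous_circ q h t)); exact: cf.
- exact: cst_continuous.
- by move=> t; apply: qmax; rewrite inE.
Qed.

(* The generalized Laplacian of [f] at [p] is nonnegative.  For a continuous function this
   already implies the sub-mean value inequality, so that subharmonicity becomes local. *)
Definition lgl1 f p := forall (k : Cplx R) (eta : R), 0 < eta ->
  exists2 d : R, 0 < d & forall s : R, 0 < s < d ->
    f p <= amean (fun t => f (circ p (s *: k) t)) + eta * s ^+ 2.
End LocalSubmean.

Section LocalToGlobal.
Variable R : realType.
Implicit Types (g : R -> R) (f : Cplx R -> R).

Lemma avg_const (N : nat) (x : R) : (0 < N)%N -> N%:R^-1 * (\sum_(k < N) x) = x.
Proof.
move=> N0; have NR : N%:R != 0 :> R by rewrite pnatr_eq0 -lt0n.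
by rewrite sumr_const card_ord -(mulr_natl x N) mulKf.
Qed.

Lemma nsqZ (s : R) (v : Cplx R) : nsq (s *: v) = s ^+ 2 * nsq v.
Proof. by case: v => x y; rewrite /nsq /GRing.scale /= /GRing.scale /=; ring. Qed.

Lemma finite_small (N : nat) (P : nat -> R -> Prop) :
  (forall k, (k < N)%N -> exists2 d : R, 0 < d & forall s : R, 0 < s < d -> P k s) ->
  exists2 d : R, 0 < d & forall k s, (k < N)%N -> 0 < s < d -> P k s.
Proof.
elim: N => [_|N IH H]; first by exists 1.
have [|d d0 Hd] := IH; first by move=> k kN; apply: H; rewrite ltnS ltnW.
have [d' d'0 Hd'] := H N (leqnn _).
exists (Num.min d d'); first by rewrite lt_min d0.
move=> k s; rewrite lt_min ltnS leq_eqVlt => /orP[/eqP ->|kN] /and3P[s0 s1 s2].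
- by apply: Hd'; rewrite s0.
- by apply: Hd => //; rewrite s0.
Qed.

Lemma circle_paramR (x y : R) : x ^+ 2 + y ^+ 2 = 1 ->
  exists s : R, [/\ 0 <= s <= 2 * pi, x = cos s & y = sin s].
Proof.
move=> e.
have x1 : -1 <= x <= 1.
  by have y0 := sqr_ge0 y; apply/andP; split; rewrite leNgt; apply/negP => h; nra.
have [a0 api] : 0 <= acos x /\ acos x <= pi.
  by split; [exact: acos_ge0 | exact: acos_lepi].
have sx : `|y| = sin (acos x) by rewrite sin_acos // -e addrAC subrr add0r sqrtr_sqr.
have cx : cos (acos x) = x by rewrite acosK // in_itv.
have [y0|y0] := leP 0 y.
- exists (acos x); split => //; last by rewrite -sx ger0_norm.
  by apply/andP; split => //; have := twopi_gt0 R; lra.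
- exists (2 * pi - acos x); split.
  + by apply/andP; split; lra.
  + have -> : 2 * pi - acos x = - acos x + pi *+ 2 by rewrite mulr2n; ring.
    by rewrite (@cosD2pi R) cosN.
  + have -> : 2 * pi - acos x = - acos x + pi *+ 2 by rewrite mulr2n; ring.
    by rewrite (@sinD2pi R) sinN -sx ltr0_norm // opprK.
Qed.

Lemma circle_param (p : Cplx R) : nsq p = 1 -> exists2 s : R, 0 <= s <= 2 * pi & p = cis s.
Proof.
by case: p => x y /circle_paramR [s [s01 /= xs ys]]; exists s => //; rewrite /cis -xs -ys.
Qed.

Definition rot (N : nat) (k : nat) : Cplx R := cis (2 * pi / N%:R * k%:R).
Definition rotavg (N : nat) f (c : Cplx R) := N%:R^-1 * \sum_(k < N) f (cmul (rot N k) c).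

Lemma nsq_rot N k (c : Cplx R) : nsq (cmul (rot N k) c) = nsq c.
Proof. by rewrite nsqM nsq_cis mul1r. Qed.

Lemma circ_cmul (a p h : Cplx R) t : cmul a (circ p h t) = circ (cmul a p) (cmul a h) t.
Proof. by rewrite /circ cmulDr !cmulA (cmulC a (cis t)). Qed.

Lemma continuous_rotavg N f c : (forall k, {for cmul (rot N k) c, continuous f}) ->
  {for c, continuous (rotavg N f)}.
Proof.
move=> cf; apply: contM; first exact: contC.
apply: (@cont_sum _ _ c N (fun k c => f (cmul (rot N k) c))) => k _.
by apply: (@continuous_at_comp _ _ _ f (cmul (rot N k))); [exact: continuous_cmull | exact: cf].
Qed.

Lemma lgl1_rotavg N f p r : (0 < N)%N -> nsq p < r ->
  (forall c, nsq c < r -> {for c, continuous f}) ->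
  (forall k, lgl1 f (cmul (rot N k) p)) -> lgl1 (rotavg N f) p.
Proof.
move=> N0 pr cf H v eta eta0.
have [d d0 Hd] := @finite_small N (fun k s => f (cmul (rot N k) p) <=
   amean (fun t => f (circ (cmul (rot N k) p) (s *: cmul (rot N k) v) t)) + eta * s ^+ 2)
   (fun k _ => H k _ _ eta0).
have [e e0 He] : exists2 e : R, 0 < e & forall s : R, 0 < s < e -> forall t, nsq (circ p (s *: v) t) < r.
  have op : nbhs p [set c | nsq c < r].
    by apply: (@continuous_nsq R p [set x | x < r]); exact: lt_nbhsl.
  have [e e0 He] := nbhs_nsq op.
  exists (e / (1 + nsq v)); first by rewrite divr_gt0 // ltr_pwDl // nsq_ge0.
  move=> s /andP[s0]; rewrite ltr_pdivlMr ?ltr_pwDl ?nsq_ge0 // => se t; apply: He.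
  rewrite cmulZr -cmulZr nsqM nsq_cis mul1r.
  rewrite nsqZ.
  have v0 := nsq_ge0 v; apply: (@le_lt_trans _ _ ((s * (1 + nsq v)) ^+ 2)).
    by rewrite exprMn ler_wpM2l ?sqr_ge0 //; nra.
  have q0 : 0 <= s * (1 + nsq v) by apply: mulr_ge0; [exact: ltW | exact: addr_ge0].
  by rewrite ltr_pXn2r // nnegrE // ltW.
exists (Num.min d e); first by rewrite lt_min d0.
move=> s; rewrite lt_min => /and3P[s0 sd se].
rewrite /rotavg.
have cF k : continuous (fun t => f (circ (cmul (rot N k) p) (s *: cmul (rot N k) v) t)).
  move=> t; apply: (continuous_at_comp (@continuous_circ _ _ _ t)); apply: cf.
  by rewrite -cmulZr -circ_cmul nsq_rot; apply: He; rewrite s0.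
have [E C] := @continuous_amean_sum R N
  (fun k t => f (circ (cmul (rot N k) p) (s *: cmul (rot N k) v) t)) (fun k _ => cF k).
have -> : (fun t => N%:R^-1 * \sum_(k < N) f (cmul (rot N k) (circ p (s *: v) t))) =
  (fun t => N%:R^-1 * \sum_(k < N) f (circ (cmul (rot N k) p) (s *: cmul (rot N k) v) t)).
  by apply/funext => t; congr (_ * _); apply: eq_bigr => k _; rewrite circ_cmul cmulZr.
rewrite ameanZ // E.
have NR : 0 < N%:R :> R by rewrite ltr0n.
have -> : eta * s ^+ 2 = N%:R^-1 * \sum_(k < N) (eta * s ^+ 2).
  by rewrite avg_const.
rewrite -mulrDr ler_pM2l ?invr_gt0 // -big_split /=.
by apply: ler_sum => k _; apply: Hd => //; rewrite s0.
Qed.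
Lemma amean_add_nsq f p h (k : R) : continuous (fun t => f (circ p h t)) ->
  amean (fun t => f (circ p h t) + k * nsq (circ p h t)) =
  amean (fun t => f (circ p h t)) + k * (nsq p + nsq h).
Proof.
move=> cf.
have cn : continuous (fun t => nsq (circ p h t)).
  by move=> t; apply: (continuous_at_comp (@continuous_circ _ p h t)); exact: continuous_nsq.
rewrite ameanD //; last by move=> t; cont; exact: cn.
by rewrite ameanZ // amean_nsq.
Qed.

(* If the inequality fails, a finite rotation average of [f] plus a small multiple of
   [|c|^2] has an interior maximum, which [lgl1] forbids; averaging over rotations makes the
   boundary values nearly constant. *)
Lemma local_to_global f : (forall c, nsq c <= 1 -> {for c, continuous f}) ->
  (forall c, nsq c < 1 -> lgl1 f c) -> f 0 <= amean (fun t => f (cis t)).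
Proof.
move=> cf lf; rewrite leNgt; apply/negP => fm.
pose kap := f 0 - amean (fun t => f (cis t)).
have kap0 : 0 < kap by rewrite subr_gt0.
pose g t := f (cis t).
have cg : continuous g.
  move=> t; apply: (continuous_at_comp (@continuous_cis R t)); apply: cf.
  by rewrite nsq_cis.
have pg t : g (t + 2 * pi) = g t.
  rewrite /g /cis; have -> : 2 * pi = pi *+ 2 :> R by rewrite mulr2n; ring.
  by rewrite (@cosD2pi R) (@sinD2pi R).
have k2 : 0 < kap / 2 by rewrite divr_gt0.
have [d d0 Hd] := heine 0 (4 * pi) cg k2.
have [N N0 HN] : exists2 N : nat, (0 < N)%N & 2 * pi / N%:R < d.
  exists (Num.truncn (2 * pi / d)).+1 => //.
  have H := truncnS_gt (2 * pi / d).
  rewrite ltr_pdivrMr ?ltr0n //; move: H; rewrite ltr_pdivrMr // => H.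
  by apply: (lt_le_trans H); rewrite mulrC.
have riem s : 0 <= s <= 2 * pi -> rotavg N f (cis s) <= amean g + kap / 2.
  move=> s01; have := @riemann_le R g N s (kap / 2) cg pg s01 N0.
  rewrite /rotavg.
  have -> : \sum_(k < N) f (cmul (rot N k) (cis s)) =
    \sum_(k < N) g (s + 2 * pi / N%:R * k%:R).
    by apply: eq_bigr => k _; rewrite /rot cis_add /g addrC.
  apply=> x y x01 /andP[xy yx].
  have : `|g x - g y| < kap / 2.
    apply: Hd => //; rewrite distrC ger0_norm ?subr_ge0 //.
    by apply: le_lt_trans HN; lra.
  by rewrite ltr_norml => /andP[]; lra.
pose G c := rotavg N f c + kap / 4 * nsq c.
have cU c : nsq c <= 1 -> {for c, continuous (rotavg N f)}.
  by move=> c1; apply: continuous_rotavg => k; apply: cf; rewrite nsq_rot.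
have [||c c1||q [q1 nq qmax]] := @max_principle R [set c | nsq c <= 1] [set c | nsq c < 1] G.
- exact: nsq_disc_compact.
- by exists 0 => /=; rewrite /nsq /= expr0n addr0 ler01.
- by apply: contD; [exact: cU | cont; exact: continuous_nsq].
- move=> p p1 /= p2.
  have lU : lgl1 (rotavg N f) p.
    apply: (@lgl1_rotavg N f p 1) => //; first by move=> c c1; apply: cf; exact: ltW.
    by move=> k; apply: lf; rewrite nsq_rot.
  have k8 : 0 < kap / 8 by rewrite divr_gt0.
  have [e e0 He] := lU (1, 0) _ k8.
  have [e' e'0 He'] : exists2 e : R, 0 < e & forall h, nsq h < e ^+ 2 -> nsq (p + h) <= 1.
    have op : nbhs p [set c | nsq c < 1].
      by apply: (@continuous_nsq R p [set x | x < 1]); exact: lt_nbhsl.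
    by have [e' e'0 H] := nbhs_nsq op; exists e' => // h /H /ltW.
  pose s := Num.min (e / 2) (e' / 2).
  have s0 : 0 < s by rewrite lt_min !divr_gt0.
  have se : s < e by rewrite gt_min ltr_pdivrMr // ltr_pMr // ltr1n.
  have se' : s < e'.
    have H : e' / 2 < e' by rewrite ltr_pdivrMr // ltr_pMr // ltr1n.
    by rewrite gt_min H orbT.
  have ns : nsq (s *: ((1, 0) : Cplx R)) = s ^+ 2.
    by rewrite nsqZ /nsq /= expr1n expr0n addr0 mulr1.
  have inK t : nsq (circ p (s *: ((1, 0) : Cplx R)) t) <= 1.
    by apply: He'; rewrite nsqM nsq_cis mul1r ns ltr_pXn2r // nnegrE ltW.
  exists (s *: ((1, 0) : Cplx R)); split => //.
  rewrite /G amean_add_nsq; last first.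
    by move=> t; apply: (continuous_at_comp (@continuous_circ R _ _ t)); exact: cU.
  rewrite ns; have := He s; rewrite s0 se => /(_ isT) H.
  have ss : 0 < kap * s ^+ 2 by rewrite mulr_gt0 // exprn_gt0.
  move: H ss; set A := amean _; set r := rotavg N f p; set q := nsq p; set w := s ^+ 2.
  have -> : kap / 8 * w = kap * w / 8 by ring.
  have -> : kap / 4 * (q + w) = kap / 4 * q + kap * w / 4 by ring.
  by set kw := kap * w; set kq := kap / 4 * q => H ss; lra.
- have q2 : nsq q = 1 by apply/eqP; rewrite eq_le q1 leNgt; apply/negP.
  have [s s01 qs] := circle_param q2.
  have := qmax 0; rewrite /= /G q2.
  have -> : nsq (0 : Cplx R) = 0 by rewrite /nsq /= expr0n addr0.
  have -> : rotavg N f 0 = f 0.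
    rewrite /rotavg; under eq_bigr do rewrite cmul0r.
    by rewrite avg_const.
  move=> /(_ ler01); have := riem s s01; rewrite -qs.
  have : amean g = f 0 - kap by rewrite /kap /g; ring.
  by move=> ->; lra.
Qed.
End LocalToGlobal.

Section LowerLaplacian.
Variables (R : realType) (X : topologicalType) (V : Type).
(* [ci x v s] is the circle of radius [s] around [x] in the complex direction [v] *)
Variable ci : X -> V -> R -> R -> X.
Hypothesis continuous_ci : forall x v s, continuous (ci x v s).
Hypothesis ci_near : forall x v (O : set X), nbhs x O ->
  exists2 d : R, 0 < d & forall s : R, 0 < s < d -> forall t, O (ci x v s t).
Implicit Types f g : X -> R.

Definition lgl_gen f x := forall (v : V) (eta : R), 0 < eta ->
  exists2 d : R, 0 < d & forall s : R, 0 < s < d ->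
    f x <= amean (fun t => f (ci x v s t)) + eta * s ^+ 2.

Definition near_continuous f (x : X) := \forall y \near x, {for y, continuous f}.

Lemma circle_continuous f x v : near_continuous f x ->
  exists2 d : R, 0 < d & forall s : R, 0 < s < d -> continuous (fun t => f (ci x v s t)).
Proof.
move=> /(ci_near v)[d d0 H]; exists d => // s sd t.
by apply: (continuous_at_comp (@continuous_ci _ _ _ t)); exact: H.
Qed.

Lemma lgl_support f g x : near_continuous f x -> near_continuous g x ->
  (\forall y \near x, g y <= f y) -> g x = f x -> lgl_gen g x -> lgl_gen f x.
Proof.
move=> cf cg gf e lg v eta eta0.
have [d1 d10 H1] := circle_continuous v cf.
have [d2 d20 H2] := circle_continuous v cg.
have [d3 d30 H3] := ci_near v gf.
have [d4 d40 H4] := lg v eta eta0.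
exists (Num.min (Num.min d1 d2) (Num.min d3 d4)); first by rewrite !lt_min d10 d20 d30.
move=> s; rewrite !lt_min => /and3P[s0 /andP[s1 s2] /andP[s3 s4]].
rewrite -e; apply: le_trans (H4 s _) _; first by rewrite s0.
rewrite lerD2r; apply: ler_amean; first by apply: H2; rewrite s0.
- by apply: H1; rewrite s0.
- by move=> t; apply: H3; rewrite s0.
Qed.

Lemma continuous_near_eq f g (y : X) : (\forall z \near y, f z = g z) ->
  {for y, continuous f} -> {for y, continuous g}.
Proof.
move=> fg; rewrite /prop_for /continuous_at -(nbhs_singleton fg) => cf.
exact: (cvg_trans (near_eq_cvg fg) cf).
Qed.

Lemma near_continuous_eq f g (x : X) : (\forall y \near x, f y = g y) ->
  near_continuous f x -> near_continuous g x.
Proof.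
move=> /nbhs_interior fg cf; apply: filterS2 fg cf => y fgy cfy.
exact: continuous_near_eq fgy cfy.
Qed.

Lemma lgl_eq f g x : near_continuous f x ->
  (\forall y \near x, f y = g y) -> lgl_gen f x -> lgl_gen g x.
Proof.
move=> cf fg; have e : f x = g x by exact: (nbhs_singleton fg).
apply: lgl_support => //; first exact: (near_continuous_eq fg).
by apply: filterS fg => y ->.
Qed.

Lemma lglD f g x : near_continuous f x -> near_continuous g x ->
  lgl_gen f x -> lgl_gen g x -> lgl_gen (fun y => f y + g y) x.
Proof.
move=> cf cg lf lg v eta eta0.
have eta2 : 0 < eta / 2 by rewrite divr_gt0.
have [d1 d10 H1] := circle_continuous v cf.
have [d2 d20 H2] := circle_continuous v cg.
have [d3 d30 H3] := lf v _ eta2.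
have [d4 d40 H4] := lg v _ eta2.
exists (Num.min (Num.min d1 d2) (Num.min d3 d4)); first by rewrite !lt_min d10 d20 d30.
move=> s; rewrite !lt_min => /and3P[s0 /andP[s1 s2] /andP[s3 s4]].
rewrite ameanD; [|by apply: H1; rewrite s0|by apply: H2; rewrite s0].
have := H3 s; rewrite s0 s3 => /(_ isT) h3.
have := H4 s; rewrite s0 s4 => /(_ isT) h4.
have -> : eta * s ^+ 2 = eta / 2 * s ^+ 2 + eta / 2 * s ^+ 2 by field.
lra.
Qed.

Lemma lglZ (k : R) f x : 0 <= k -> near_continuous f x ->
  lgl_gen f x -> lgl_gen (fun y => k * f y) x.
Proof.
move=> k0 cf lf v eta eta0.
have k1 : 0 < k + 1 by rewrite ltr_wpDl.
have eta2 : 0 < eta / (k + 1) by rewrite divr_gt0.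
have [d1 d10 H1] := circle_continuous v cf.
have [d3 d30 H3] := lf v _ eta2.
exists (Num.min d1 d3); first by rewrite !lt_min d10 d30.
move=> s; rewrite !lt_min => /and3P[s0 s1 s3].
rewrite ameanZ; last by apply: H1; rewrite s0.
have := H3 s; rewrite s0 s3 => /(_ isT) h3.
apply: le_trans (ler_wpM2l k0 h3) _; rewrite mulrDr lerD2l mulrA ler_wpM2r ?sqr_ge0 //.
by rewrite mulrA ler_pdivrMr // mulrC ler_pM2l // lerDl.
Qed.

Lemma lgl_submean f x : (forall v s, f x <= amean (fun t => f (ci x v s t))) -> lgl_gen f x.
Proof.
move=> H v eta eta0; exists 1 => // s /andP[s0 _].
by apply: le_trans (H v s) _; rewrite lerDl mulr_ge0 ?sqr_ge0 ?ltW.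
Qed.

Lemma lgl_cst (c : R) x : lgl_gen (fun=> c) x.
Proof. by apply: lgl_submean => v s; rewrite amean_cst. Qed.

Lemma lgl_max f g x : near_continuous f x -> near_continuous g x ->
  lgl_gen f x -> lgl_gen g x -> lgl_gen (fun y => Num.max (f y) (g y)) x.
Proof.
move=> cf cg lf lg.
have cm : near_continuous (fun y => Num.max (f y) (g y)) x.
  by apply: filterS2 cf cg => y cfy cgy; apply: cont_max.
have [gf|fg] := leP (g x) (f x).
- apply: (lgl_support cm cf) lf; last by rewrite max_l.
  by apply: nearW => y; rewrite le_max lexx.
- apply: (lgl_support cm cg) lg; last by rewrite max_r // ltW.
  by apply: nearW => y; rewrite le_max lexx orbT.
Qed.

End LowerLaplacian.

Section Instances.
Variable R : realType.

Definition ci1 (p k : Cplx R) (s : R) : R -> Cplx R := circ p (s *: k).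

Lemma continuous_ci1 p k s : continuous (ci1 p k s).
Proof. exact: continuous_circ. Qed.

Lemma ci1_near p k (O : set (Cplx R)) : nbhs p O ->
  exists2 d : R, 0 < d & forall s : R, 0 < s < d -> forall t, O (ci1 p k s t).
Proof.
move=> /nbhs_nsq[e e0 He]; have k0 := nsq_ge0 k.
exists (e / (1 + nsq k)); first by rewrite divr_gt0 // ltr_pwDl.
move=> s /andP[s0]; rewrite ltr_pdivlMr ?ltr_pwDl // => se t; apply: He.
rewrite cmulZr nsqZ nsqM nsq_cis mul1r; apply: (@le_lt_trans _ _ ((s * (1 + nsq k)) ^+ 2)).
  by rewrite exprMn ler_wpM2l ?sqr_ge0 //; nra.
have q0 : 0 <= s * (1 + nsq k) by apply: mulr_ge0; [exact: ltW | exact: addr_ge0].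
by rewrite ltr_pXn2r // nnegrE // ltW.
Qed.

Variable n : nat.
Implicit Types (Z W : Cn R n) (U : set (Cn R n)) (f : Cn R n -> R).

Definition cin Z W (s : R) (t : R) : Cn R n := disc Z (s *: W) (cis t).

Lemma continuous_cin Z W s : continuous (cin Z W s).
Proof.
move=> t.
by apply: (continuous_at_comp (g := disc Z (s *: W))); [exact: continuous_cis | exact: continuous_disc].
Qed.

Lemma disc0 Z W : disc Z W 0 = Z.
Proof.
rewrite /disc /cvscale /= !scale0r subr0 addr0; case: (Z) => z1 z2.
by rewrite /GRing.add /= /add_pair /= !addr0.
Qed.

Lemma cin_near Z W (O : set (Cn R n)) : nbhs Z O ->
  exists2 d : R, 0 < d & forall s : R, 0 < s < d -> forall t, O (cin Z W s t).
Proof.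
move=> OZ; have O0 : nbhs (0 : Cplx R) [set c | O (disc Z W c)].
  by apply: (@continuous_disc R n Z W 0); rewrite disc0.
have [d d0 Hd] := nbhs_nsq O0; exists d => // s /andP[s0 sd] t.
have /Hd : nsq (s *: cis t) < d ^+ 2.
  by rewrite nsqZ nsq_cis mulr1 ltr_pXn2r // nnegrE ltW.
by rewrite add0r /= /cin /disc cvscaleZ.
Qed.

Definition lgl f Z := lgl_gen cin f Z.

Lemma cvscaleZl (s : R) (k : Cplx R) W : cvscale (s *: k) W = s *: cvscale k W.
Proof.
by rewrite -cvscaleZ /cvscale; congr pair; rewrite /= ?scalerBr ?scalerDr !scalerA !(mulrC s).
Qed.

Lemma psh_local U f : open U -> (forall Z, U Z -> {for Z, continuous f}) ->
  (forall Z, U Z -> lgl f Z) -> psh U (EFin \o f).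
Proof.
move=> oU cf lf; apply: psh_intro => // Z W ZW.
rewrite -{1}(disc0 Z W).
apply: (@local_to_global R (fun c => f (disc Z W c))) => c c1.
  by apply: (continuous_at_comp (@continuous_disc R n Z W c)); apply: cf; exact: ZW.
move=> k eta eta0.
have [d d0 H] := lf _ (ZW c (ltW c1)) (cvscale k W) eta eta0.
exists d => // s sd; apply: le_trans (H s sd) _.
by rewrite lerD2r /circ /cin -cvscaleZl; under [X in _ <= amean X]eq_fun do rewrite -disc_disc.
Qed.

Lemma open_near_continuous U f Z : open U -> U Z ->
  (forall Z, U Z -> {for Z, continuous f}) -> near_continuous f Z.
Proof. by move=> oU UZ cf; apply: filterS (open_nbhs_nbhs (conj oU UZ)) => Z' /cf. Qed.

End Instances.

Section LogMean.
Variable R : realType.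

Lemma continuousDg (f g : R -> R) : continuous f -> continuous g ->
  continuous (fun x => f x + g x).
Proof. by move=> cf cg x; exact: (contD (cf x) (cg x)). Qed.

Lemma ln1D_le (x : R) : 0 <= x -> ln (1 + x) <= x.
Proof.
move=> x0; have x1 : 0 < 1 + x by lra.
by rewrite -ler_expR lnK // expR_ge1Dx.
Qed.

Lemma ln1B_ge (x : R) : 0 <= x <= 1 / 2 -> - (2 * x) <= ln (1 - x).
Proof.
move=> /andP[x0 x1]; have h : 0 < 1 - x by lra.
have -> : ln (1 - x) = - ln (1 + x / (1 - x)).
  have -> : 1 + x / (1 - x) = (1 - x)^-1 by field; lra.
  by rewrite lnV // opprK.
rewrite lerN2; apply: le_trans (ln1D_le _) _; first by rewrite divr_ge0 // ltW.
by rewrite ler_pdivrMr //; nra.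
Qed.

(* The squared moduli of [p + i^k h], k < 4, multiply to [|p^4 - h^4|^2]. *)
Lemma four_point_prod (P X A B c s a b q : R) :
  A ^+ 2 + B ^+ 2 = P * X -> c ^+ 2 + s ^+ 2 = 1 ->
  a = 2 * A * c + 2 * B * s -> b = - (2 * A * s) + 2 * B * c ->
  q = (P + X + a) * (P + X + b) * ((P + X - a) * (P + X - b)) ->
  (P ^+ 2 - X ^+ 2) ^+ 2 <= q <= (P ^+ 2 + X ^+ 2) ^+ 2.
Proof.
move=> AB cs ae be qe.
have ab : a ^+ 2 + b ^+ 2 = 4 * (P * X).
  rewrite -AB; transitivity (4 * (A ^+ 2 + B ^+ 2) * (c ^+ 2 + s ^+ 2)); first by rewrite ae be; ring.
  by rewrite cs mulr1.
have qE : q = (P ^+ 2 - X ^+ 2) ^+ 2 + (a * b) ^+ 2.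
  have -> : q = ((P + X) ^+ 2) ^+ 2 - (P + X) ^+ 2 * (a ^+ 2 + b ^+ 2) + (a * b) ^+ 2.
    by rewrite qe; ring.
  by rewrite ab; ring.
have h : (a * b) ^+ 2 <= (2 * (P * X)) ^+ 2.
  have := sqr_ge0 (a ^+ 2 - b ^+ 2); have := ab; clear.
  move=> ab h; have e : (2 * (P * X)) ^+ 2 = (a ^+ 2 + b ^+ 2) ^+ 2 / 4 by rewrite ab; field.
  by rewrite e; nra.
rewrite qE lerDl sqr_ge0 /=.
have -> : (P ^+ 2 + X ^+ 2) ^+ 2 = (P ^+ 2 - X ^+ 2) ^+ 2 + (2 * (P * X)) ^+ 2 by ring.
by rewrite lerD2l.
Qed.

Lemma amean_ln_bounds (p h : Cplx R) : nsq h < nsq p ->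
  ln (nsq p ^+ 2 - nsq h ^+ 2) / 2 <= amean (fun t => ln (nsq (circ p h t))) /\
  amean (fun t => ln (nsq (circ p h t))) <= ln (nsq p ^+ 2 + nsq h ^+ 2) / 2.
Proof.
move=> hp; have p0 : 0 < nsq p by apply: le_lt_trans hp; exact: nsq_ge0.
have h0 := nsq_ge0 h.
set P := nsq p in hp p0 *; set X := nsq h in hp h0 *.
pose A := p.1 * h.1 + p.2 * h.2; pose B := p.2 * h.1 - p.1 * h.2.
have AB : A ^+ 2 + B ^+ 2 = P * X by rewrite /A /B /P /X /nsq; ring.
pose rho (t : R) := nsq (circ p h t).
have rhoE t : rho t = P + X + (2 * A * cos t + 2 * B * sin t) by rewrite /rho nsq_circ.
have rho0 t : 0 < rho t.
  rewrite /rho lt_neqAle nsq_ge0 andbT; apply/eqP => e.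
  have c0 := nsq_eq0 (esym e).
  have e1 : p = - cmul (cis t) h by apply/eqP; rewrite -addr_eq0; apply/eqP.
  have : P = X.
    rewrite /P e1; have -> : nsq (- cmul (cis t) h) = nsq (cmul (cis t) h).
      by rewrite /nsq /= !sqrrN.
    by rewrite nsqM nsq_cis mul1r.
  by move=> PX; rewrite PX ltxx in hp.
have crho : continuous rho.
  by move=> t; apply: (continuous_at_comp (@continuous_circ R p h t)); exact: continuous_nsq.
pose L t := ln (rho t).
have cL : continuous L.
  by move=> t; apply: (continuous_at_comp (crho t)); exact: continuous_ln.
have pL t : L (t + 2 * pi) = L t.
  rewrite /L !rhoE; have -> : 2 * pi = pi *+ 2 :> R by rewrite mulr2n; ring.
  by rewrite (@cosD2pi R) (@sinD2pi R).
have pi0 := pi_gt0 R.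
have shift (k : R) : 0 <= k -> amean (fun t => L (t + k)) = amean L by move=> k0; apply: amean_shift.
have cLs (k : R) : continuous (fun t => L (t + k)).
  move=> t; apply: (continuous_at_comp (f := fun x : R => x + k)); last exact: cL.
  by cont.
pose S t := (L t + L (t + pi / 2)) + (L (t + pi) + L (t + pi / 2 + pi)).
have meanS : amean S = 4 * amean L.
  have c1 : continuous (fun t => L t + L (t + pi / 2)).
    exact: (continuousDg cL (cLs _)).
  have e0 : (fun t => L (t + pi / 2 + pi)) = (fun t => L (t + (pi / 2 + pi))).
    by apply/funext => t; rewrite -addrA.
  have c3 : continuous (fun t => L (t + pi / 2 + pi)) by rewrite e0; exact: cLs.
  have c2 : continuous (fun t => L (t + pi) + L (t + pi / 2 + pi)).
    exact: (continuousDg (cLs _) c3).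
  rewrite /S (ameanD c1 c2) (ameanD cL (cLs _)) (ameanD (cLs _) c3) e0.
  have q1 : 0 <= pi / 2 :> R by rewrite divr_ge0 // ltW.
  have q2 : 0 <= pi / 2 + pi :> R by rewrite addr_ge0 // ltW.
  rewrite (shift _ q1) (shift _ (ltW pi0)) (shift _ q2); set m := amean L.
  by clear; ring.
have cS : continuous S.
  have e0 : (fun t => L (t + pi / 2 + pi)) = (fun t => L (t + (pi / 2 + pi))).
    by apply/funext => t; rewrite -addrA.
  have c3 : continuous (fun t => L (t + pi / 2 + pi)) by rewrite e0; exact: cLs.
  exact: (continuousDg (continuousDg cL (cLs _)) (continuousDg (cLs _) c3)).
have PX0 : 0 < P ^+ 2 - X ^+ 2 by rewrite subr_gt0 ltr_pXn2r // nnegrE ltW.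
have Sb t : 2 * ln (P ^+ 2 - X ^+ 2) <= S t <= 2 * ln (P ^+ 2 + X ^+ 2).
  have := four_point_prod AB (cos2Dsin2 t) erefl erefl erefl; set q := (X in _ <= X <= _).
  have -> : S t = ln q.
    rewrite /S /L -!lnM ?posrE ?mulr_gt0 //; congr ln; rewrite !rhoE.
    by rewrite cosDpihalf sinDpihalf !cosDpi !sinDpi cosDpihalf sinDpihalf /q; ring.
  have sq (x : R) : 0 < x -> 2 * ln x = ln (x ^+ 2) :> R.
    by move=> x0; rewrite lnXn // mulr_natl.
  have PX1 : 0 < P ^+ 2 + X ^+ 2 by rewrite ltr_wpDr ?sqr_ge0 // exprn_gt0.
  move=> /andP[q1 q2]; rewrite !sq //.
  have q0 : 0 < q by apply: lt_le_trans q1; rewrite exprn_gt0.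
  by rewrite !ler_ln ?posrE ?exprn_gt0 // q1 q2.
have lo : 2 * ln (P ^+ 2 - X ^+ 2) <= amean S.
  rewrite -[leLHS]amean_cst; apply: ler_amean => //; first exact: cst_continuous.
  by move=> t; case/andP: (Sb t).
have up : amean S <= 2 * ln (P ^+ 2 + X ^+ 2).
  rewrite -[leRHS]amean_cst; apply: ler_amean => //; first exact: cst_continuous.
  by move=> t; case/andP: (Sb t).
by move: lo up; rewrite meanS /L /rho; split; lra.
Qed.

Lemma ln_nsq_mean (p k : Cplx R) (eta : R) : 0 < nsq p -> 0 < eta ->
  exists2 d : R, 0 < d & forall s : R, 0 < s < d ->
    `|amean (fun t => ln (nsq (ci1 p k s t))) - ln (nsq p)| <= eta * s ^+ 2.
Proof.
move=> p0 eta0; set P := nsq p in p0 *; have K0 := nsq_ge0 k; set K := nsq k in K0.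
have K1 : 0 < 1 + K by rewrite ltr_pwDl.
pose d1 := P / (2 * (1 + K)).
pose d2 := eta * P ^+ 2 / (1 + K ^+ 2).
have K2 : 0 < 1 + K ^+ 2 by rewrite ltr_pwDl // sqr_ge0.
exists (Num.min 1 (Num.min d1 d2)).
  by rewrite !lt_min ltr01 !divr_gt0 // ?mulr_gt0 // exprn_gt0.
move=> s; rewrite !lt_min => /and4P[s0 s1 sd1 sd2].
have hX : nsq (s *: k) = s ^+ 2 * K by rewrite nsqZ.
have ss : s ^+ 2 <= s by rewrite expr2 ler_piMr // ltW.
have X0 : 0 <= s ^+ 2 * K by rewrite mulr_ge0 // sqr_ge0.
have XP : s ^+ 2 * K < P / 2.
  move: sd1; rewrite /d1 ltr_pdivlMr ?mulr_gt0 // => sd1.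
  have : s ^+ 2 * K <= s * K by rewrite ler_wpM2r.
  by rewrite ltr_pdivlMr //; nra.
have [|lo up] := @amean_ln_bounds p (s *: k); first by rewrite hX -/P; lra.
rewrite hX -/P in lo up.
set x := (s ^+ 2 * K) ^+ 2 / P ^+ 2.
have P2 : 0 < P ^+ 2 by rewrite exprn_gt0.
have x0 : 0 <= x by rewrite divr_ge0 // ?sqr_ge0 // ltW.
have x1 : x <= 1 / 2.
  by rewrite /x ler_pdivrMr //; nra.
have xs : x <= eta * s ^+ 2.
  rewrite /x ler_pdivrMr //; move: sd2; rewrite /d2 ltr_pdivlMr // => sd2.
  have h : s ^+ 2 * K ^+ 2 <= eta * P ^+ 2.
    have : s ^+ 2 * K ^+ 2 <= s * K ^+ 2 by rewrite ler_wpM2r // sqr_ge0.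
    by nra.
  have -> : (s ^+ 2 * K) ^+ 2 = s ^+ 2 * (s ^+ 2 * K ^+ 2) by ring.
  have -> : eta * s ^+ 2 * P ^+ 2 = s ^+ 2 * (eta * P ^+ 2) by ring.
  by rewrite ler_wpM2l // sqr_ge0.
have e1 : P ^+ 2 - (s ^+ 2 * K) ^+ 2 = P ^+ 2 * (1 - x) by rewrite /x; field; rewrite gt_eqF.
have e2 : P ^+ 2 + (s ^+ 2 * K) ^+ 2 = P ^+ 2 * (1 + x) by rewrite /x; field; rewrite gt_eqF.
have lnP : ln (P ^+ 2) = 2 * ln P by rewrite lnXn // mulr_natl.
move: lo up; rewrite e1 e2 !lnM ?posrE ?lnP //; [|lra|lra].
have := ln1D_le x0; have := @ln1B_ge x; rewrite x0 x1 => /(_ isT).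
by rewrite ler_norml; move=> h1 h2 h3 h4; apply/andP; split; rewrite /ci1; lra.
Qed.

Lemma continuous_ln_nsq (a p : Cplx R) : 0 < nsq (p - a) ->
  {for p, continuous (fun c : Cplx R => ln (nsq (c - a)))}.
Proof.
move=> pa; apply: (cont_comp (f := fun c : Cplx R => nsq (c - a))).
  apply: (continuous_at_comp (f := fun c : Cplx R => c - a)); last exact: continuous_nsq.
  exact: (@cvgB _ _ _ (nbhs p) _ id (fun=> a) p a cvg_id (cvg_cst _)).
exact: continuous_ln.
Qed.

Lemma near_continuous_ln_nsq (a p : Cplx R) : 0 < nsq (p - a) ->
  near_continuous (fun c : Cplx R => ln (nsq (c - a))) p.
Proof.
move=> pa.
have cn : {for p, continuous (fun c : Cplx R => nsq (c - a))}.
  apply: (continuous_at_comp (f := fun c : Cplx R => c - a)); last exact: continuous_nsq.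
  exact: (@cvgB _ _ _ (nbhs p) _ id (fun=> a) p a cvg_id (cvg_cst _)).
have H : \forall c \near p, 0 < nsq (c - a) by exact: (cvgr_gt _ cn _ pa).
by apply: filterS H => c; exact: continuous_ln_nsq.
Qed.

Lemma lgl_ln_nsq (a p : Cplx R) : 0 < nsq (p - a) ->
  lgl_gen (@ci1 R) (fun c => ln (nsq (c - a))) p.
Proof.
move=> pa v eta eta0.
have [d d0 H] := ln_nsq_mean v pa eta0; exists d => // s /H.
have e t : ci1 p v s t - a = ci1 (p - a) v s t by rewrite /ci1 /circ addrAC.
under [X in _ <= amean X + _]eq_fun do rewrite e.
by rewrite ler_norml => /andP[]; lra.
Qed.

Lemma lgl_ln_nsqN (a p : Cplx R) : 0 < nsq (p - a) ->
  lgl_gen (@ci1 R) (fun c => - ln (nsq (c - a))) p.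
Proof.
move=> pa v eta eta0.
have [d d0 H] := ln_nsq_mean v pa eta0.
have [d' d'0 H'] := circle_continuous (@continuous_ci1 R) (@ci1_near R) v (near_continuous_ln_nsq pa).
exists (Num.min d d'); first by rewrite lt_min d0.
move=> s; rewrite lt_min => /and3P[s0 sd sd'].
have := H s; rewrite s0 sd => /(_ isT).
have := H' s; rewrite s0 sd' => /(_ isT) cf.
have e t : ci1 p v s t - a = ci1 (p - a) v s t by rewrite /ci1 /circ addrAC.
have -> : amean (fun t => - ln (nsq (ci1 p v s t - a))) = - amean (fun t => ln (nsq (ci1 p v s t - a))).
  rewrite -[RHS]mulN1r -(ameanZ (-1) cf).
  by congr amean; apply/funext => t; rewrite mulN1r.
under [X in _ <= - amean X + _]eq_fun do rewrite e.
by rewrite ler_norml => /andP[]; lra.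
Qed.
End LogMean.

Section LowerLaplacianRules.
Variable R : realType.
Implicit Types (f g : Cplx R -> R) (p : Cplx R).

Lemma lgl1_support f g p : near_continuous f p -> near_continuous g p ->
  (\forall y \near p, g y <= f y) -> g p = f p -> lgl1 g p -> lgl1 f p.
Proof. exact: (lgl_support (@continuous_ci1 R) (@ci1_near R)). Qed.

Lemma lgl1_eq f g p : near_continuous f p -> (\forall y \near p, f y = g y) ->
  lgl1 f p -> lgl1 g p.
Proof. exact: (lgl_eq (@continuous_ci1 R) (@ci1_near R)). Qed.

Lemma lgl1D f g p : near_continuous f p -> near_continuous g p ->
  lgl1 f p -> lgl1 g p -> lgl1 (fun y => f y + g y) p.
Proof. exact: (lglD (@continuous_ci1 R) (@ci1_near R)). Qed.

Lemma lgl1Z (k : R) f p : 0 <= k -> near_continuous f p ->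
  lgl1 f p -> lgl1 (fun y => k * f y) p.
Proof. exact: (lglZ (@continuous_ci1 R) (@ci1_near R)). Qed.

Variable n : nat.
Implicit Types (u v : Cn R n -> R) (Z : Cn R n).

Lemma lgln_eq u v Z : near_continuous u Z -> (\forall y \near Z, u y = v y) ->
  lgl u Z -> lgl v Z.
Proof. exact: (lgl_eq (@continuous_cin R n) (@cin_near R n)). Qed.

Lemma lglnD u v Z : near_continuous u Z -> near_continuous v Z ->
  lgl u Z -> lgl v Z -> lgl (fun y => u y + v y) Z.
Proof. exact: (lglD (@continuous_cin R n) (@cin_near R n)). Qed.

Lemma lgln_max u v Z : near_continuous u Z -> near_continuous v Z ->
  lgl u Z -> lgl v Z -> lgl (fun y => Num.max (u y) (v y)) Z.
Proof. exact: (lgl_max (@continuous_cin R n) (@cin_near R n)). Qed.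

Lemma lglnZ (k : R) u Z : 0 <= k -> near_continuous u Z -> lgl u Z -> lgl (fun y => k * u y) Z.
Proof. exact: (lglZ (@continuous_cin R n) (@cin_near R n)). Qed.

Lemma lgln_cst (c : R) Z : lgl (fun=> c) Z.
Proof. exact: lgl_cst. Qed.

Lemma lgln_submean u Z : (forall W, u Z <= amean (fun t => u (disc Z W (cis t)))) -> lgl u Z.
Proof. by move=> H; apply: lgl_submean => v s; exact: H. Qed.
End LowerLaplacianRules.

(** * Maximum principles, Liouville and Hopf *)

Section MaxPrinciples.
Variable R : realType.
Implicit Types (f v : Cplx R -> R) (K O : set (Cplx R)).

Lemma max_principle_lgl K O f (M B : R) : compact K -> (forall c, K c -> nsq c <= B) ->
  open O -> O `<=` K -> (forall c, K c -> {for c, continuous f}) ->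
  (forall c, O c -> lgl1 f c) -> (forall c, K c -> ~ O c -> f c <= M) ->
  forall c, K c -> f c <= M.
Proof.
move=> cK KB oO OK cf lf fM c0 Kc0; rewrite leNgt; apply/negP => fc0.
have B0 : 0 <= B by apply: le_trans (KB _ Kc0); exact: nsq_ge0.
pose del := (f c0 - M) / (2 * (1 + B)).
have B1 : 0 < 1 + B by rewrite ltr_pwDl.
have del0 : 0 < del by rewrite divr_gt0 ?subr_gt0 // mulr_gt0.
have [||p Kp Op|q [Kq nOq qmax]] := @max_principle R K O (fun c => f c + del * nsq c) cK.
- by exists c0.
- move=> c Kc; have := cf c Kc => fc; cont; exact: continuous_nsq.
- have d2 : 0 < del / 2 by rewrite divr_gt0.
  have [e e0 He] := lf _ Op (1, 0) _ d2.
  have [e' e'0 He'] := ci1_near (1, 0) (open_nbhs_nbhs (conj oO Op)).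
  pose s := Num.min (e / 2) (e' / 2).
  have s0 : 0 < s by rewrite lt_min !divr_gt0.
  have half (x : R) : 0 < x -> x / 2 < x by move=> x0; rewrite ltr_pdivrMr // ltr_pMr // ltr1n.
  have se : s < e by rewrite gt_min half.
  have se' : s < e' by rewrite gt_min (half e') // orbT.
  have inO t : O (ci1 p (1, 0) s t) by apply: He'; rewrite s0.
  exists (s *: ((1, 0) : Cplx R)); split; first by move=> t; apply: OK; exact: inO.
  rewrite amean_add_nsq; last first.
    move=> t; apply: (continuous_at_comp (@continuous_circ R _ _ t)); apply: cf.
    by apply: OK; exact: inO.
  have -> : nsq (s *: ((1, 0) : Cplx R)) = s ^+ 2.
    by rewrite nsqZ /nsq /= expr1n expr0n addr0 mulr1.
  have := He s; rewrite s0 se => /(_ isT); set A := amean _.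
  have ss : 0 < del * s ^+ 2 by rewrite mulr_gt0 // exprn_gt0.
  move: ss; set P := nsq p; set w := s ^+ 2 => ss H.
  have -> : del * (P + w) = del * P + del * w by ring.
  have e1 : del / 2 * w = del * w / 2 by field.
  by rewrite e1 in H; move: ss H; set dw := del * w; lra.
- have := qmax _ Kc0; have := fM _ Kq nOq; have := KB _ Kq.
  have := nsq_ge0 c0; have := nsq_ge0 q => q0 c00 qB fq.
  have h1 : del * nsq q <= (f c0 - M) / 2.
    rewrite /del -mulrA; have -> : (f c0 - M) / 2 = (f c0 - M) * (1 / 2) by field.
    have B2 : 0 < 2 * (1 + B) by rewrite mulr_gt0.
    by rewrite ler_pM2l ?subr_gt0 // [_^-1 * _]mulrC ler_pdivrMr //; lra.
  have h2 : 0 <= del * nsq c0 by rewrite mulr_ge0 // ltW.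
  lra.
Qed.

Lemma open_nsq_lt (r : R) : open [set c : Cplx R | nsq c < r].
Proof.
have -> : [set c : Cplx R | nsq c < r] = @nsq R @^-1` [set x | x < r] by [].
by apply: open_comp; [move=> c _; exact: continuous_nsq | exact: open_lt].
Qed.

Lemma open_nsq_gt (r : R) : open [set c : Cplx R | r < nsq c].
Proof.
have -> : [set c : Cplx R | r < nsq c] = @nsq R @^-1` [set x | r < x] by [].
by apply: open_comp; [move=> c _; exact: continuous_nsq | exact: open_gt].
Qed.

Lemma disc_max f (M : R) : (forall c, nsq c <= 1 -> {for c, continuous f}) ->
  (forall c, nsq c < 1 -> lgl1 f c) -> (forall c, nsq c = 1 -> f c <= M) ->
  forall c, nsq c <= 1 -> f c <= M.
Proof.
move=> cf lf fM c c1.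
apply: (@max_principle_lgl [set c | nsq c <= 1] [set c | nsq c < 1] f M 1) => //.
- exact: nsq_disc_compact.
- exact: open_nsq_lt.
- by move=> x /=; exact: ltW.
- move=> x /= x1 nx; apply: fM; apply/eqP; rewrite eq_le x1 leNgt; exact/negP.
Qed.

Lemma annulus_max f (r1 r2 al be : R) : 0 < r1 ->
  (forall c, r1 <= nsq c <= r2 -> {for c, continuous f}) ->
  (forall c, r1 < nsq c < r2 -> lgl1 f c) ->
  (forall c, nsq c = r1 \/ nsq c = r2 -> f c <= al + be * ln (nsq c)) ->
  forall c, r1 <= nsq c <= r2 -> f c <= al + be * ln (nsq c).
Proof.
move=> r10 cf lf fM c0 c0r.
pose g c := f c + (- be) * ln (nsq (c - 0)).
suff : g c0 <= al by rewrite /g subr0 mulNr; lra.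
have gt0r c : r1 <= nsq c -> 0 < nsq (c - 0) by rewrite subr0; exact: lt_le_trans.
apply: (@max_principle_lgl [set c | r1 <= nsq c <= r2] [set c | r1 < nsq c < r2] g al r2) => //.
- apply: (subclosed_compact _ (@nsq_disc_compact R r2)); last by move=> c /= /andP[].
  have -> : [set c : Cplx R | r1 <= nsq c <= r2] =
      @nsq R @^-1` [set x | r1 <= x] `&` @nsq R @^-1` [set x | x <= r2].
    by apply/seteqP; split => c /= => [/andP[]|[-> ->]].
  apply: closedI; apply: closed_comp; try by move=> c _; exact: continuous_nsq.
  + exact: closed_ge.
  + exact: closed_le.
- by move=> c /= /andP[].
- have -> : [set c : Cplx R | r1 < nsq c < r2] = [set c | r1 < nsq c] `&` [set c | nsq c < r2].
    by apply/seteqP; split => c /= => [/andP[]|[-> ->]].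
  by apply: openI; [exact: open_nsq_gt | exact: open_nsq_lt].
- by move=> c /= /andP[/ltW -> /ltW ->].
- move=> c /= cr; have fc := cf c cr; have /andP[/gt0r c0' _] := cr.
  have := continuous_ln_nsq c0' => lc.
  by rewrite /g; cont.
- move=> c /= cr; have /andP[cr1 cr2] := cr.
  have c0' : 0 < nsq (c - 0) by apply: gt0r; exact: ltW.
  have nf : near_continuous f c.
    have : nbhs c [set c | r1 < nsq c < r2].
      have -> : [set c : Cplx R | r1 < nsq c < r2] = [set c | r1 < nsq c] `&` [set c | nsq c < r2].
        by apply/seteqP; split => x /= => [/andP[]|[-> ->]].
      apply: open_nbhs_nbhs; split => //.
      by apply: openI; [exact: open_nsq_gt | exact: open_nsq_lt].
    by apply: filterS => x /andP[x1 x2]; apply: cf; rewrite !ltW.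
  have nl := near_continuous_ln_nsq c0'.
  have nlN : near_continuous (fun c : Cplx R => - ln (nsq (c - 0))) c.
    by apply: filterS nl => y cy; exact: contN.
  have [b0|b0] := leP 0 be.
  + have -> : g = (fun c => f c + be * - ln (nsq (c - 0))).
      by apply/funext => y; rewrite /g mulNr mulrN.
    apply: lgl1D => //.
    * by apply: filterS nlN => y cy; cont.
    * exact: lf.
    * exact: (lgl1Z b0 nlN (lgl_ln_nsqN c0')).
  + have b0' : 0 <= - be by lra.
    apply: lgl1D => //.
    * by apply: filterS nl => y cy; cont.
    * exact: lf.
    * exact: (lgl1Z b0' nl (lgl_ln_nsq c0')).
- move=> c /= /andP[c1 c2] nc; rewrite /g subr0.
  have : nsq c = r1 \/ nsq c = r2.
    have [e|ne] := eqVneq (nsq c) r1; [by left|right].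
    apply/eqP; rewrite eq_le c2 leNgt; apply/negP => lt2; apply: nc.
    by rewrite lt2 lt_neqAle eq_sym ne c1.
  by move=> /fM; rewrite mulNr; lra.
Qed.
End MaxPrinciples.

Section Liouville.
Variable R : realType.
Implicit Types (f v : Cplx R -> R).

Lemma liouville0 v (M : R) : (forall c, {for c, continuous v}) -> (forall c, lgl1 v c) ->
  (forall c, v c <= M) -> forall q, v q <= v 0.
Proof.
move=> cv lv vM q; rewrite leNgt; apply/negP => vq.
pose e := (v q - v 0) / 2.
have e0 : 0 < e by rewrite divr_gt0 // subr_gt0.
have near0 : \forall c \near (0 : Cplx R), v c < v 0 + e.
  by apply: (cvgr_lt _ (cv 0)); rewrite ltrDl.
have [s s0 Hs] := nbhs_nsq near0.
pose r1 := (s / 2) ^+ 2.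
have s2 : 0 < s / 2 by rewrite divr_gt0.
have r10 : 0 < r1 by rewrite exprn_gt0.
have in1 c : nsq c <= r1 -> v c < v 0 + e.
  move=> c1; rewrite -[c]add0r; apply: Hs; apply: le_lt_trans c1 _.
  by rewrite /r1 ltr_pXn2r ?nnegrE ?(ltW s2) ?(ltW s0) // ltr_pdivrMr // ltr_pMr // ltr1n.
have [q1|q1] := leP (nsq q) r1; first by have := in1 _ q1; rewrite /e; lra.
have q0 : 0 < nsq q by exact: lt_trans q1.
pose L := ln (nsq q) - ln r1.
have L0 : 0 < L by rewrite subr_gt0 ltr_ln.
pose eps := e / (2 * L).
have eps0 : 0 < eps by rewrite divr_gt0 // mulr_gt0.
pose T := (`|M - v 0| + 1) / eps + L.
have T0 : 0 < T by rewrite addr_gt0 // divr_gt0 // ltr_pwDr.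
pose r2 := r1 * expR T.
have r20 : 0 < r2 by rewrite mulr_gt0 // expR_gt0.
have lnr2 : ln r2 = ln r1 + T by rewrite /r2 lnM ?posrE ?expR_gt0 // expRK.
have qr2 : nsq q <= r2.
  rewrite -ler_ln ?posrE // lnr2 -lerBlDl -/L /T lerDr divr_ge0 ?addr_ge0 //.
  exact: ltW.
have := @annulus_max R v r1 r2 (v 0 + e - eps * ln r1) eps r10 (fun c _ => cv c) (fun c _ => lv c) _ q.
rewrite (ltW q1) qr2 => /(_ _ isT) H.
have : v q <= v 0 + e - eps * ln r1 + eps * ln (nsq q).
  apply: H => c [c1|c2].
  - by rewrite c1 subrK ltW // in1 // c1.
  - rewrite c2 lnr2 mulrDr; have := vM c.
    have : M - v 0 <= eps * T.
      rewrite /T mulrDr mulrCA mulfV ?gt_eqF // mulr1.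
      have := ler_norm (M - v 0); have : 0 < eps * L by rewrite mulr_gt0.
      lra.
    lra.
have -> : v 0 + e - eps * ln r1 + eps * ln (nsq q) = v 0 + e + eps * L by rewrite /L; ring.
have -> : eps * L = e / 2 by rewrite /eps; field; rewrite gt_eqF.
rewrite /e; move: vq; clear; generalize (v q) (v 0) => a b h1 h2; lra.
Qed.

Lemma circD (p q h : Cplx R) t : p + circ q h t = circ (p + q) h t.
Proof. by rewrite /circ addrA. Qed.

Lemma liouville v (M : R) : (forall c, {for c, continuous v}) -> (forall c, lgl1 v c) ->
  (forall c, v c <= M) -> forall p q, v p = v q.
Proof.
move=> cv lv vM.
suff H p q : v q <= v p by move=> p q; apply/eqP; rewrite eq_le !H.
have := @liouville0 (fun c => v (p + c)) M.
move=> /(_ _ _ _ (q - p)); rewrite addr0 [p + (q - p)]addrC subrK; apply => // c.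
- apply: (continuous_at_comp (f := fun c : Cplx R => p + c)); last exact: cv.
  exact: (@cvgD _ _ _ (nbhs c) _ (fun=> p) id p c (cvg_cst _) cvg_id).
- move=> k eta eta0; have [d d0 H] := lv (p + c) k eta eta0.
  exists d => // s /H; by under [X in _ <= amean X + _]eq_fun do rewrite -circD.
Qed.

Lemma hopf v (m : R) : (forall c, nsq c <= 1 -> {for c, continuous v}) ->
  (forall c, nsq c < 1 -> lgl1 v c) -> (forall c, nsq c = 1 -> v c <= m) ->
  v 0 < m -> exists2 k : R, 0 < k & \forall t \near (1:R)^'-, v ((t, 0) : Cplx R) <= m - k * (1 - t).
Proof.
move=> cv lv vm v0.
pose e := (m - v 0) / 2.
have e0 : 0 < e by rewrite divr_gt0 // subr_gt0.
have near0 : \forall c \near (0 : Cplx R), v c < m - e.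
  apply: (cvgr_lt _ (cv 0 _)); last by rewrite /e; lra.
  by rewrite /nsq /= expr0n addr0 ler01.
have [s s0 Hs] := nbhs_nsq near0.
pose s' := Num.min (s / 2) (1 / 2).
have s'0 : 0 < s' by rewrite lt_min !divr_gt0.
have s's : s' < s by rewrite gt_min ltr_pdivrMr // ltr_pMr // ltr1n.
have h2 : (1 / 2 : R) < 1 by lra.
have s'1 : s' < 1 by rewrite gt_min h2 orbT.
pose r1 := s' ^+ 2.
have r10 : 0 < r1 by rewrite exprn_gt0.
have r11 : r1 < 1 by rewrite exprn_ilt1 // ltW.
have lnr1 : ln r1 < 0 by rewrite ln_lt0 // r10.
pose k := - e / ln r1.
have k0 : 0 < k by rewrite /k -mulrN1 -mulrA mulr_gt0 // mulN1r oppr_gt0 invr_lt0.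
have H c : r1 <= nsq c <= 1 -> v c <= m + k * ln (nsq c).
  apply: annulus_max => //.
  - by move=> x /andP[_]; exact: cv.
  - by move=> x /andP[_]; exact: lv.
  - move=> x [x1|x1].
    + rewrite x1 /k mulrAC mulfK ?lt_eqF //.
      apply: ltW; rewrite -[x]add0r; apply: Hs; rewrite x1.
      by rewrite ltr_pXn2r // nnegrE ltW.
    + by rewrite x1 ln1 mulr0 addr0; exact: vm.
exists (2 * k); first by rewrite mulr_gt0.
have near1 : \forall t \near (1:R)^'-, s' < t < 1.
  by apply: filterS2 (nbhs_left_gt s'1) (nbhs_left_lt 1) => t -> ->.
apply: filterS near1 => t /andP[t0 t1].
have t00 : 0 < t by exact: lt_trans t0.
have nt : nsq ((t, 0) : Cplx R) = t ^+ 2 by rewrite /nsq /= expr0n addr0.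
have := H (t, 0); rewrite nt => /(_ _)/le_trans; apply.
  by rewrite /r1 ler_pXn2r ?nnegrE ?(ltW s'0) ?(ltW t00) // (ltW t0) exprn_ile1 // ltW.
rewrite lerD2l lnXn // -mulNr mulrnAr.
have lnt : ln t <= t - 1.
  by rewrite -ler_expR lnK //; have := expR_ge1Dx (t - 1); lra.
have H2 : k * ln t <= k * (t - 1) by rewrite ler_pM2l.
by rewrite mulr2n; lra.
Qed.
End Liouville.

(** * Sums of squared moduli of polynomials *)

Section SumsOfSquares.
Variable R : realType.
Local Notation C := R[i].

Definition sqmod (z : C) : R := complex.Re z ^+ 2 + complex.Im z ^+ 2.
Definition toC (c : Cplx R) : C := Complex c.1 c.2.

Lemma sqmodM (z w : C) : sqmod (z * w) = sqmod z * sqmod w.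
Proof. by case: z w => [a b] [c d]; rewrite /sqmod /=; ring. Qed.

Lemma toC_cisX (t : R) (k : nat) : toC (cis t) ^+ k = Complex (cos (k%:R * t)) (sin (k%:R * t)).
Proof.
elim: k => [|k IH]; first by rewrite expr0 mul0r cos0 sin0.
rewrite exprS IH /toC /=; have -> : k.+1%:R * t = t + k%:R * t by rewrite -natr1; ring.
by rewrite cosD sinD; congr Complex; ring.
Qed.

Lemma horner_cisE (p : {poly C}) (t : R) : p.[toC (cis t)] =
  \sum_(k < size p) Complex (complex.Re p`_k * cos (k%:R * t) - complex.Im p`_k * sin (k%:R * t))
     (complex.Re p`_k * sin (k%:R * t) + complex.Im p`_k * cos (k%:R * t)).
Proof.
rewrite horner_coef; apply: eq_bigr => k _; rewrite toC_cisX.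
by case: (p`_k) => a b.
Qed.

Lemma Re_sum (N : nat) (F : 'I_N -> C) :
  complex.Re (\sum_(k < N) F k) = \sum_(k < N) complex.Re (F k).
Proof. by apply: (big_morph (@complex.Re R) (id1 := 0) (op1 := +%R)) => // -[a b] [c d]. Qed.

Lemma Im_sum (N : nat) (F : 'I_N -> C) :
  complex.Im (\sum_(k < N) F k) = \sum_(k < N) complex.Im (F k).
Proof. by apply: (big_morph (@complex.Im R) (id1 := 0) (op1 := +%R)) => // -[a b] [c d]. Qed.

Lemma continuous_trig (k : nat) (a b : R) :
  continuous (fun t : R => a * cos (k%:R * t) + b * sin (k%:R * t)).
Proof.
have cc := @continuous_cosn R k; have cs := @continuous_sinn R k.
by move=> t; have := cc t; have := cs t => c1 c2; cont.
Qed.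

Lemma amean_trig (k : nat) (a b : R) :
  amean (fun t : R => a * cos (k%:R * t) + b * sin (k%:R * t)) = if k == 0%N then a else 0.
Proof.
have cc := @continuous_cosn R k; have cs := @continuous_sinn R k.
have ca : continuous (fun t : R => a * cos (k%:R * t)) by move=> t; have := cc t => c1; cont.
have cb : continuous (fun t : R => b * sin (k%:R * t)) by move=> t; have := cs t => c1; cont.
rewrite (ameanD ca cb) !ameanZ //; case: k cc cs ca cb => [|k] _ _ _ _ /=.
  have -> : (fun t : R => cos (0 * t)) = (fun=> 1) by apply/funext => t; rewrite mul0r cos0.
  have -> : (fun t : R => sin (0 * t)) = (fun=> 0) by apply/funext => t; rewrite mul0r sin0.
  by rewrite !amean_cst mulr1 mulr0 addr0.
by rewrite amean_cosn // amean_sinn // !mulr0 addr0.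
Qed.

Lemma amean_trig_sum (N : nat) (a b : nat -> R) :
  continuous (fun t : R => \sum_(k < N) (a k * cos (k%:R * t) + b k * sin (k%:R * t))) /\
  amean (fun t : R => \sum_(k < N) (a k * cos (k%:R * t) + b k * sin (k%:R * t))) =
    if N == 0%N then 0 else a 0%N.
Proof.
have [E Ct] := @continuous_amean_sum R N (fun k t => a k * cos (k%:R * t) + b k * sin (k%:R * t))
  (fun k _ => @continuous_trig k (a k) (b k)).
split => //; rewrite E; under eq_bigr do rewrite amean_trig.
case: N {E Ct} => [|N]; first by rewrite big_ord0.
by rewrite big_ord_recl /= big1 ?addr0.
Qed.

Lemma amean_poly (p : {poly C}) :
  [/\ continuous (fun t => complex.Re p.[toC (cis t)]),
      continuous (fun t => complex.Im p.[toC (cis t)]),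
      amean (fun t => complex.Re p.[toC (cis t)]) = complex.Re p.[0] &
      amean (fun t => complex.Im p.[toC (cis t)]) = complex.Im p.[0]].
Proof.
have eR : (fun t => complex.Re p.[toC (cis t)]) = (fun t => \sum_(k < size p)
   (complex.Re p`_k * cos (k%:R * t) + (- complex.Im p`_k) * sin (k%:R * t))).
  by apply/funext => t; rewrite horner_cisE Re_sum; apply: eq_bigr => k _; rewrite /= mulNr.
have eI : (fun t => complex.Im p.[toC (cis t)]) = (fun t => \sum_(k < size p)
   (complex.Im p`_k * cos (k%:R * t) + complex.Re p`_k * sin (k%:R * t))).
  by apply/funext => t; rewrite horner_cisE Im_sum; apply: eq_bigr => k _; rewrite /= addrC.
have [c1 m1] := amean_trig_sum (size p) (fun k => complex.Re p`_k) (fun k => - complex.Im p`_k).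
have [c2 m2] := amean_trig_sum (size p) (fun k => complex.Im p`_k) (fun k => complex.Re p`_k).
rewrite eR eI m1 m2 horner_coef0.
by split => //; case: eqP => // /eqP; rewrite size_poly_eq0 => /eqP ->; rewrite coef0.
Qed.

Lemma sqr_amean_le (g : R -> R) : continuous g -> amean g ^+ 2 <= amean (fun t => g t ^+ 2).
Proof.
move=> cg; set m := amean g.
have c2 : continuous (fun t => (2 * m) * g t + - m ^+ 2) by move=> t; have := cg t => c1; cont.
have cm : continuous (fun t => (2 * m) * g t) by move=> t; have := cg t => c1; cont.
have -> : m ^+ 2 = amean (fun t => (2 * m) * g t + - m ^+ 2).
  rewrite ameanD //; last exact: cst_continuous.
  by rewrite ameanZ // amean_cst -/m; ring.
apply: ler_amean => //; first by move=> t; have := cg t => c1; cont.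
by move=> t; have := sqr_ge0 (g t - m); nra.
Qed.

Lemma sqmod_poly_submean (p : {poly C}) :
  continuous (fun t => sqmod p.[toC (cis t)]) /\
  sqmod p.[0] <= amean (fun t => sqmod p.[toC (cis t)]).
Proof.
have [cr ci mr mi] := amean_poly p.
have cr2 : continuous (fun t => complex.Re p.[toC (cis t)] ^+ 2) by move=> t; have := cr t => c1; cont.
have ci2 : continuous (fun t => complex.Im p.[toC (cis t)] ^+ 2) by move=> t; have := ci t => c1; cont.
rewrite /sqmod; split; first exact: continuousDg.
by rewrite ameanD // -mr -mi lerD // sqr_amean_le.
Qed.

Definition sos1 (G : Cplx R -> R) := exists P : seq {poly C},
  forall c, G c = \sum_(p <- P) sqmod p.[toC c].

Lemma sos1_submean G : sos1 G -> continuous (fun t => G (cis t)) /\ G 0 <= amean (fun t => G (cis t)).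
Proof.
move=> [P HP].
have -> : (fun t => G (cis t)) = (fun t => \sum_(p <- P) sqmod p.[toC (cis t)]).
  by apply/funext => t; rewrite HP.
rewrite HP; elim: P {HP} => [|p P [IH1 IH2]].
  have -> : (fun t : R => \sum_(p <- [::]) sqmod p.[toC (cis t)]) = (fun=> 0).
    by apply/funext => t; rewrite big_nil.
  by rewrite big_nil amean_cst; split => //; exact: cst_continuous.
have -> : (fun t : R => \sum_(p <- p :: P) sqmod p.[toC (cis t)]) =
  (fun t => sqmod p.[toC (cis t)] + \sum_(p <- P) sqmod p.[toC (cis t)]).
  by apply/funext => t; rewrite big_cons.
have [cp mp] := sqmod_poly_submean p.
split; first exact: continuousDg.
by rewrite big_cons (ameanD cp IH1) lerD.
Qed.

Lemma sos1D G H : sos1 G -> sos1 H -> sos1 (fun c => G c + H c).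
Proof. by move=> [P HP] [Q HQ]; exists (P ++ Q) => c; rewrite big_cat HP HQ. Qed.

Lemma sos1M G H : sos1 G -> sos1 H -> sos1 (fun c => G c * H c).
Proof.
move=> [P HP] [Q HQ]; exists [seq p * q | p <- P, q <- Q] => c.
rewrite HP HQ big_allpairs_dep mulr_suml; apply: eq_bigr => p _.
by rewrite mulr_sumr; apply: eq_bigr => q _; rewrite hornerM sqmodM.
Qed.

Lemma sos1_affine (a b : Cplx R) : sos1 (fun c => nsq (a + cmul c b)).
Proof.
exists [:: (toC a)%:P + 'X * (toC b)%:P] => c; rewrite big_seq1.
have -> : ((toC a)%:P + 'X * (toC b)%:P).[toC c] = toC (a + cmul c b).
  by rewrite !hornerE; case: a b c => [a1 a2] [b1 b2] [c1 c2]; congr Complex => /=; ring.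
by [].
Qed.

Lemma sos1_cst (k : R) : 0 <= k -> sos1 (fun=> k).
Proof.
move=> k0; exists [:: (Complex (Num.sqrt k) 0)%:P] => c.
by rewrite big_seq1 hornerC /sqmod /= expr0n addr0 sqr_sqrtr.
Qed.

Variable n : nat.
Implicit Types (F G : Cn R n -> R).

Definition sos F := forall Z W, sos1 (fun c => F (disc Z W c)).

Lemma sosD F G : sos F -> sos G -> sos (fun Z => F Z + G Z).
Proof. by move=> sF sG Z W; exact: sos1D. Qed.

Lemma sosM F G : sos F -> sos G -> sos (fun Z => F Z * G Z).
Proof. by move=> sF sG Z W; exact: sos1M. Qed.

Lemma sos_cst (k : R) : 0 <= k -> sos (fun=> k).
Proof. by move=> k0 Z W; exact: sos1_cst. Qed.

Lemma sosX F (k : nat) : sos F -> sos (fun Z => F Z ^+ k).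
Proof.
move=> sF; elim: k => [|k IH].
  have -> : (fun Z => F Z ^+ 0) = (fun=> 1) by apply/funext => Z; rewrite expr0.
  exact: sos_cst.
have -> : (fun Z => F Z ^+ k.+1) = (fun Z => F Z * F Z ^+ k) by apply/funext => Z; rewrite exprS.
exact: sosM.
Qed.

Lemma sos_sum (N : nat) (F : 'I_N -> Cn R n -> R) : (forall i, sos (F i)) ->
  sos (fun Z => \sum_i F i Z).
Proof.
move=> sF; elim: N F sF => [|N IH] F sF.
  have -> : (fun Z => \sum_i F i Z) = (fun=> 0) by apply/funext => Z; rewrite big_ord0.
  exact: sos_cst.
have -> : (fun Z => \sum_i F i Z) = (fun Z => F ord0 Z + \sum_i F (lift ord0 i) Z).
  by apply/funext => Z; rewrite big_ord_recl.
by apply: sosD => //; apply: IH.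
Qed.

Lemma sos_submean F Z W : sos F -> F Z <= amean (fun t => F (disc Z W (cis t))).
Proof. by move=> /(_ Z W)/sos1_submean [_]; rewrite disc0. Qed.

End SumsOfSquares.

(** * Dips in [|w|^2 - 1] *)

Section Dips.
Variable R : realType.

Definition eta (n : nat) : R := 4^-1 * 2^-1 ^+ n.
Definition srad (n : nat) : R := eta n / 32.
(* The angle is coded by the 2-adic valuation of [n], so each rational occurs infinitely often. *)
Definition ang (n : nat) : R := if (unpickle (logn 2 n) : option rat) is Some q then ratr q else 0.
Definition wpt (n : nat) : Cplx R := (1 + eta n) *: cis (ang n).
Definition bs (w : Cplx R) : R := nsq w - 1.
Definition rho (n : nat) (w : Cplx R) : R := nsq (w - wpt n).
Definition s2 (n : nat) : R := srad n ^+ 2.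
(* The factor makes the dip [s2 * ln (rho / s2)] reach - 8 at [rho = e2]. *)
Definition e2 (n : nat) : R := s2 n * expR (- 8 / s2 n).

Lemma eta_gt0 n : 0 < eta n. Proof. by rewrite mulr_gt0 ?exprn_gt0 ?invr_gt0. Qed.
Lemma eta_half n : eta n.+1 = eta n / 2. Proof. by rewrite /eta exprS; field. Qed.
Lemma eta_le n m : (n <= m)%N -> eta m <= eta n.
Proof.
by move=> nm; rewrite ler_pM2l ?invr_gt0 // ler_wiXn2l // ?invr_ge0 // invf_le1 ?ler1n.
Qed.
Lemma eta_le4 n : eta n <= 1 / 4.
Proof. by apply: le_trans (@eta_le 0 n _) _ => //; rewrite /eta expr0 mulr1 mul1r. Qed.
Lemma eta_lt n m : (n < m)%N -> eta m <= eta n / 2.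
Proof. by move=> nm; rewrite -eta_half eta_le. Qed.
Lemma eta_small (e : R) : 0 < e -> exists N, forall n, (N <= n)%N -> eta n < e.
Proof.
move=> e0.
have h : `|2^-1 : R| < 1 by rewrite ger0_norm ?invr_ge0 // invf_lt1 // ltr1n.
have /cvgrPdist_lt/(_ _ e0) [N _ HN] := cvg_geometric (4^-1 : R) h.
by exists N => n /HN /=; rewrite sub0r normrN ger0_norm.
Qed.

Lemma s2_gt0 n : 0 < s2 n. Proof. by rewrite exprn_gt0 // divr_gt0 // eta_gt0. Qed.
Lemma s2_le n : s2 n <= eta n / 1024.
Proof. by have := eta_gt0 n; have := eta_le4 n; rewrite /s2 /srad; nra. Qed.
Lemma e2_gt0 n : 0 < e2 n. Proof. by rewrite mulr_gt0 ?expR_gt0 ?s2_gt0. Qed.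
Lemma e2_lt n : e2 n < s2 n.
Proof.
have s0 := s2_gt0 n; rewrite /e2 -[ltRHS]mulr1 ltr_pM2l // -expR0 ltr_expR.
by rewrite mulNr oppr_lt0 divr_gt0.
Qed.
Lemma ln_e2 n : s2 n * (ln (e2 n) - ln (s2 n)) = - 8.
Proof.
have s0 := s2_gt0 n.
by rewrite /e2 lnM ?posrE ?expR_gt0 // expRK addrAC subrr add0r mulrCA mulfV ?mulr1 // gt_eqF.
Qed.

Lemma nsq_wpt n : nsq (wpt n) = (1 + eta n) ^+ 2.
Proof. by rewrite nsqZ nsq_cis mulr1. Qed.

Lemma bs_range n w : rho n w < 4 * s2 n -> 7 / 4 * eta n < bs w < 5 / 2 * eta n.
Proof.
move=> rw; set p := wpt n in rw *; set h := w - p.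
pose ip := p.1 * h.1 + p.2 * h.2.
have e1 : nsq w = nsq p + 2 * ip + nsq h.
  by rewrite -(subrK p w) -/h addrC /nsq /ip /=; ring.
have h0 : 0 <= nsq h by exact: nsq_ge0.
have np : nsq p = (1 + eta n) ^+ 2 := nsq_wpt n.
have ip2 : ip ^+ 2 <= nsq p * nsq h.
  have -> : nsq p * nsq h = ip ^+ 2 + (p.1 * h.2 - p.2 * h.1) ^+ 2 by rewrite /nsq /ip; ring.
  by rewrite lerDl sqr_ge0.
have et0 := eta_gt0 n; have et4 := eta_le4 n.
have rw' : nsq h < 4 * (eta n / 32) ^+ 2 by [].
have ipb : ip ^+ 2 < (5 / 64 * eta n) ^+ 2.
  apply: le_lt_trans ip2 _; rewrite np.
  apply: (@lt_le_trans _ _ ((1 + eta n) ^+ 2 * (4 * (eta n / 32) ^+ 2))).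
    by rewrite ltr_pM2l // exprn_gt0 //; lra.
  have -> : (1 + eta n) ^+ 2 * (4 * (eta n / 32) ^+ 2) = ((1 + eta n) * (eta n / 16)) ^+ 2 by field.
  by rewrite ler_pXn2r ?nnegrE //; [nra|nra|lra].
have ipa : `|ip| < 5 / 64 * eta n.
  by rewrite -(@ltr_pXn2r _ 2) ?nnegrE ?real_normK ?num_real //; lra.
move: ipa; rewrite ltr_norml => /andP[i1 i2].
by rewrite /bs e1 np; apply/andP; split; nra.
Qed.

Lemma rho_disjoint n m w : rho n w < 4 * s2 n -> rho m w < 4 * s2 m -> n = m.
Proof.
have H a b : (a < b)%N -> rho a w < 4 * s2 a -> rho b w < 4 * s2 b -> False.
  move=> /eta_lt ab /bs_range/andP[h1 _] /bs_range/andP[_ h2].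
  by have := eta_gt0 a; lra.
by move=> h1 h2; case: (ltngtP n m) => // nm; [case: (H _ _ nm h1 h2)|case: (H _ _ nm h2 h1)].
Qed.

(* For [e2 <= x <= s2] this is the tangent of [x] at [s2] in the variable [ln x], which lies
   below [x]; replacing [rho] by [jf rho] in [bs = (bs - rho) + rho] keeps subharmonicity. *)
Definition jf (n : nat) (x : R) : R :=
  s2 n * (1 + (ln (Num.max (Num.min x (s2 n)) (e2 n)) - ln (s2 n))) + Num.max (x - s2 n) 0.

Definition dip (n : nat) (w : Cplx R) : R := Num.max 0 (bs w - rho n w + jf n (rho n w)).

Lemma jf_ge n x : s2 n <= x -> jf n x = x.
Proof.
move=> sx; rewrite /jf min_r // max_l ?(ltW (e2_lt n)) // subrr addr0 mulr1.
by rewrite max_l ?subr_ge0 // addrC subrK.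
Qed.

Lemma jf_lt n x : x < s2 n -> jf n x = s2 n * (1 + (ln (Num.max x (e2 n)) - ln (s2 n))).
Proof.
by move=> sx; rewrite /jf min_l ?(ltW sx) // (max_r (x := x - _)) ?addr0 // subr_le0 ltW.
Qed.

Lemma jf_le_s2 n x : x < s2 n -> jf n x <= s2 n.
Proof.
move=> xs; rewrite jf_lt // ger_pMr ?s2_gt0 // gerDl subr_le0 ler_ln ?posrE ?s2_gt0 //.
- by rewrite ge_max (ltW xs) (ltW (e2_lt n)).
- by rewrite lt_max e2_gt0 orbT.
Qed.

Lemma jf_ge_ln n x : e2 n < x -> s2 n * (1 + (ln x - ln (s2 n))) <= jf n x.
Proof.
move=> ex; have x0 : 0 < x by exact: lt_trans (e2_gt0 n) ex.
have s0 := s2_gt0 n.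
have [sx|xs] := leP (s2 n) x; last by rewrite jf_lt // max_l // ltW.
rewrite jf_ge //.
have : ln (x / s2 n) <= x / s2 n - 1.
  have xs0 : 0 < x / s2 n by rewrite divr_gt0.
  by rewrite -ler_expR lnK //; have := expR_ge1Dx (x / s2 n - 1); lra.
rewrite ln_div ?posrE // => H.
by rewrite mulrC -ler_pdivlMr //; lra.
Qed.

Lemma bs_ge n w : rho n w < 4 * s2 n -> 0 < bs w.
Proof. by move=> /bs_range/andP[h _]; apply: lt_trans h; rewrite mulr_gt0 // eta_gt0. Qed.

Lemma dip_ge0 n w : 0 <= dip n w. Proof. by rewrite /dip le_max lexx. Qed.

Lemma dip_outer n w : s2 n <= rho n w -> rho n w < 4 * s2 n -> dip n w = bs w.
Proof.
move=> h1 h2; rewrite /dip jf_ge // subrK max_r // ltW //.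
exact: bs_ge h2.
Qed.

Lemma dip_le n w : rho n w < s2 n -> dip n w <= bs w + s2 n.
Proof.
move=> h; have s0 := s2_gt0 n.
have h4 : rho n w < 4 * s2 n by lra.
have b0 := bs_ge h4; have r0 : 0 <= rho n w by exact: nsq_ge0.
by rewrite /dip ge_max; apply/andP; split; [lra|have := jf_le_s2 h; lra].
Qed.

Lemma dip0 n w : rho n w <= e2 n -> dip n w = 0.
Proof.
move=> h; have s0 := s2_gt0 n; have el := e2_lt n.
have hs : rho n w < s2 n by lra.
have h4 : rho n w < 4 * s2 n by lra.
have /andP[_ b1] := bs_range h4; have r0 : 0 <= rho n w by exact: nsq_ge0.
have et := eta_le4 n; have sl := s2_le n.
rewrite /dip max_l // jf_lt // max_r // mulrDr ln_e2 mulr1; lra.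
Qed.
End Dips.

Section SubharmonicDips.
Variable R : realType.
Local Notation bs := (@bs R). Local Notation rho := (@rho R).
Local Notation s2 := (@s2 R). Local Notation e2 := (@e2 R). Local Notation dip := (@dip R).

Definition uI (I : set nat) (w : Cplx R) : R :=
  match pselect (exists n, I n /\ rho n w < s2 n) with
  | left h => dip (projT1 (cid h)) w
  | right _ => bs w
  end.

Lemma uI_in I n w : I n -> rho n w < s2 n -> uI I w = dip n w.
Proof.
move=> In rn; rewrite /uI; case: pselect => [h|h]; last by case: h; exists n.
case: (cid h) => m [Im rm] /=; have -> // : m = n.
by have := s2_gt0 R n; have := s2_gt0 R m => a b; apply: (@rho_disjoint R _ _ w); lra.
Qed.

Lemma uI_out I w : (forall n, I n -> s2 n <= rho n w) -> uI I w = bs w.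
Proof.
move=> H; rewrite /uI; case: pselect => // h; exfalso; case: h => n [In].
by rewrite ltNge H.
Qed.

Lemma uI_near I n w : rho n w < 4 * s2 n -> uI I w = if `[< I n >] then dip n w else bs w.
Proof.
move=> rn; have out m : m <> n -> s2 m <= rho m w.
  move=> mn; rewrite leNgt; apply/negP => rm; apply: mn.
  by apply: (@rho_disjoint R _ _ w) => //; have := s2_gt0 R m; lra.
case: asboolP => In; last first.
  by apply: uI_out => m Im; apply: out => mn; rewrite mn in Im.
have [rs|sr] := ltP (rho n w) (s2 n); first by rewrite (uI_in In).
rewrite dip_outer //; apply: uI_out => m Im.
by case: (pselect (m = n)) => [->|/out].
Qed.

Lemma continuous_bs w : {for w, continuous bs}.
Proof. by rewrite /bs; cont; exact: continuous_nsq. Qed.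

Lemma continuous_rho n w : {for w, continuous (rho n)}.
Proof.
apply: (continuous_at_comp (f := fun c : Cplx R => c - wpt R n)); last exact: continuous_nsq.
exact: (@cvgB _ _ _ (nbhs w) _ id (fun=> wpt R n) w _ cvg_id (cvg_cst _)).
Qed.

Lemma continuous_dip n w : {for w, continuous (dip n)}.
Proof.
have cb := @continuous_bs w; have cr := @continuous_rho n w.
have cl : {for w, continuous (fun w => ln (Num.max (Num.min (rho n w) (s2 n)) (e2 n)))}.
  apply: (cont_comp (f := fun w => Num.max (Num.min (rho n w) (s2 n)) (e2 n))); first by cont.
  by apply: continuous_ln; rewrite lt_max e2_gt0 orbT.
by rewrite /dip /jf; cont.
Qed.

Lemma near_rho_lt n (w : Cplx R) x : rho n w < x -> \forall y \near w, rho n y < x.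
Proof. by move=> h; exact: (cvgr_lt _ (@continuous_rho n w) _ h). Qed.

Lemma near_rho_gt n (w : Cplx R) x : x < rho n w -> \forall y \near w, x < rho n y.
Proof. by move=> h; exact: (cvgr_gt _ (@continuous_rho n w) _ h). Qed.

Lemma cont_near (f : Cplx R -> R) p : (forall w, {for w, continuous f}) -> near_continuous f p.
Proof. by move=> H; apply: (@filterE _ (nbhs p)) => y; exact: H. Qed.

Lemma continuous_bs_circ p h : continuous (fun t => bs (circ p h t)).
Proof.
by move=> t; apply: (continuous_at_comp (@continuous_circ R p h t)); exact: continuous_bs.
Qed.

Lemma continuous_nsq_circ (p h : Cplx R) : continuous (fun t => nsq (circ p h t)).
Proof.
by move=> t; apply: (continuous_at_comp (@continuous_circ R p h t)); exact: continuous_nsq.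
Qed.

Lemma amean_bs p h : amean (fun t => bs (circ p h t)) = bs p + nsq h.
Proof.
rewrite /bs ameanD; last exact: cst_continuous.
- by rewrite amean_nsq amean_cst addrAC.
- by move=> t; apply: (continuous_at_comp (@continuous_circ R p h t)); exact: continuous_nsq.
Qed.

Lemma lgl1_cst (c : R) (p : Cplx R) : lgl1 (fun=> c) p.
Proof. exact: (@lgl_cst R (Cplx R) (Cplx R) (@ci1 R)). Qed.

Lemma lgl1_bs p : lgl1 bs p.
Proof.
apply: (@lgl_submean R (Cplx R) (Cplx R) (@ci1 R)) => v s; rewrite /ci1 amean_bs lerDl; exact: nsq_ge0.
Qed.

Lemma lgl1_k0 n p : 0 < rho n p ->
  lgl1 (fun w => (bs w - rho n w) + s2 n * (1 + (ln (rho n w) - ln (s2 n)))) p.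
Proof.
move=> rp; have s0 := s2_gt0 R n.
have nl := near_continuous_ln_nsq rp.
have c1 : near_continuous (fun w => bs w - rho n w) p.
  by apply: cont_near => w; have := @continuous_bs w; have := @continuous_rho n w => a b; cont.
have cc (c : R) : near_continuous (fun=> c) p by apply: cont_near => w; exact: contC.
have -> : (fun w => (bs w - rho n w) + s2 n * (1 + (ln (rho n w) - ln (s2 n)))) =
  (fun w => (bs w - rho n w) + (s2 n * ln (rho n w) + s2 n * (1 - ln (s2 n)))).
  by apply/funext => w; ring.
apply: lgl1D => //.
- by apply: filterS nl => y cy; rewrite /rho; cont.
- move=> v eta eta0; exists 1 => // s _.
  have -> : (fun t => bs (circ p (s *: v) t) - rho n (circ p (s *: v) t)) =
     (fun t => bs (circ p (s *: v) t) + (-1) * nsq (circ (p - wpt R n) (s *: v) t)).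
    by apply/funext => t; rewrite mulN1r /rho /circ (addrAC p).
  rewrite ameanD; last 2 first.
  + exact: continuous_bs_circ.
  + by move=> t; have := @continuous_nsq_circ (p - wpt R n) (s *: v) t => c; cont.
  rewrite amean_bs ameanZ; last exact: continuous_nsq_circ.
  rewrite amean_nsq /rho; have : 0 <= eta * s ^+ 2 by rewrite mulr_ge0 ?sqr_ge0 // ltW.
  lra.
- apply: lgl1D => //.
  + by apply: filterS nl => y cy; rewrite /rho; cont.
  + apply: lgl1Z => //; first exact: ltW.
    exact: lgl_ln_nsq.
  + exact: lgl1_cst.
Qed.

Lemma lgl1_dip n p : rho n p < 4 * s2 n -> lgl1 (dip n) p.
Proof.
move=> rp; have s0 := s2_gt0 R n; have el := e2_lt R n; have e0 := e2_gt0 R n.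
have cd : near_continuous (dip n) p by apply: cont_near => w; exact: continuous_dip.
have cc (c : R) : near_continuous (fun=> c) p by apply: cont_near => w; exact: contC.
have [d0|dn0] := eqVneq (dip n p) 0.
  apply: (lgl1_support cd (cc 0)) => //; last exact: lgl1_cst.
  by apply: (@filterE _ (nbhs p)) => y; exact: dip_ge0.
have ep : e2 n < rho n p by rewrite ltNge; apply/negP => /dip0 /eqP; rewrite (negbTE dn0).
have [ps|sp] := leP (rho n p) (s2 n).
- have rp0 : 0 < rho n p by exact: lt_trans ep.
  apply: (lgl1_support cd _ _ _ (lgl1_k0 rp0)).
  + have nl := near_continuous_ln_nsq rp0; apply: filterS nl => y cy.
    have := @continuous_bs y; have := @continuous_rho n y; rewrite /rho => a b; cont.
  + apply: filterS (near_rho_gt ep) => y ey.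
    by rewrite /dip le_max; apply/orP; right; rewrite lerD2l; exact: jf_ge_ln.
  + rewrite /dip max_r; last first.
      by apply: ltW; rewrite ltNge; apply/negP => /max_l; rewrite -/(dip n p) => /eqP; rewrite (negbTE dn0).
    congr (_ + _); move: ps; rewrite le_eqVlt => /orP[/eqP e|ps].
    * by rewrite jf_ge ?e // subrr addr0 mulr1.
    * by rewrite jf_lt // max_l // ltW.
- apply: (lgl1_eq (f := bs)); [exact: (cont_near _ (@continuous_bs))| |exact: lgl1_bs].
  by apply: filterS2 (near_rho_gt sp) (near_rho_lt rp) => y y1 y2; rewrite dip_outer // ltW.
Qed.

Definition uN (N : nat) := uI [set n | (n < N)%N].
Definition uA := uI setT.

Lemma uN_local N p : (\forall w \near p, uN N w = bs w) \/
  exists n, rho n p < 4 * s2 n /\ \forall w \near p, uN N w = dip n w.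
Proof.
case: (pselect (exists n, (n < N)%N /\ rho n p < 4 * s2 n)) => [[n [nN rn]]|H].
  right; exists n; split => //; apply: filterS (near_rho_lt rn) => w rw.
  by rewrite /uN (uI_near _ rw) asboolT.
left.
have out n : (n < N)%N -> s2 n < rho n p.
  move=> nN; rewrite ltNge; apply/negP => h; apply: H; exists n; split => //.
  by have := s2_gt0 R n; lra.
have : \forall w \near p, forall n, (n < N)%N -> s2 n < rho n w.
  elim: N {H} out => [_|N IH out]; first by apply: (@filterE _ (nbhs p)).
  have h1 := IH (fun n nN => out n (ltnW nN)).
  have h2 := near_rho_gt (out N (leqnn _)).
  apply: filterS2 h1 h2 => w a b n; rewrite ltnS leq_eqVlt => /orP[/eqP ->//|]; exact: a.
by apply: filterS => w h; apply: uI_out => n /h /ltW.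
Qed.

Lemma continuous_uN N p : {for p, continuous (uN N)}.
Proof.
have [h|[n [_ h]]] := uN_local N p.
- apply: (@continuous_near_eq R _ bs); last exact: continuous_bs.
  by apply: filterS h => w ->.
- apply: (@continuous_near_eq R _ (dip n)); last exact: continuous_dip.
  by apply: filterS h => w ->.
Qed.

Lemma lgl1_uN N p : lgl1 (uN N) p.
Proof.
have [h|[n [rp h]]] := uN_local N p.
- apply: (lgl1_eq (f := bs)); [exact: (cont_near _ (@continuous_bs))| |exact: lgl1_bs].
  by apply: filterS h => w ->.
- apply: (lgl1_eq (f := dip n)); [exact: (cont_near _ (@continuous_dip n))| |exact: lgl1_dip].
  by apply: filterS h => w ->.
Qed.

Lemma cmul_scaled (c k h e : Cplx R) (s : R) :
  cmul c h + cmul e (s *: cmul k h) = cmul (c + cmul e (s *: k)) h.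
Proof.
by rewrite !cmulZr (cmulC (c + _) h) cmulDr cmulZr (cmulC h c) (cmulC h (cmul e k)) cmulA.
Qed.

Lemma uN_submean N p h : uN N p <= amean (fun t => uN N (circ p h t)).
Proof.
have e c : circ p h c = p + cmul (cis c) h by [].
have := @local_to_global R (fun c => uN N (p + cmul c h)).
rewrite (_ : p + cmul 0 h = p); last by rewrite cmulC cmul0r addr0.
apply => c _.
- apply: (continuous_at_comp (f := fun c : Cplx R => p + cmul c h)); last exact: continuous_uN.
  have -> : (fun c : Cplx R => p + cmul c h) = (fun c => p + cmul h c).
    by apply/funext => x; rewrite cmulC.
  exact: (@cvgD _ _ _ (nbhs c) _ (fun=> p) (cmul h) p _ (cvg_cst _) (@continuous_cmull R h c)).
- move=> k eta eta0; have [d d0 H] := @lgl1_uN N (p + cmul c h) (cmul k h) eta eta0.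
  exists d; first exact: d0.
  move=> s sd; apply: le_trans (H s sd) _; rewrite lerD2r.
  rewrite le_eqVlt; apply/orP; left; apply/eqP; congr amean; apply/funext => t; congr uN.
  rewrite /circ -addrA; congr (_ + _).
  exact: cmul_scaled.
Qed.

Lemma uA_uN N w : `|uA w - uN N w| <= 4 * eta R N.
Proof.
have eN := eta_gt0 R N.
case: (pselect (exists n, rho n w < s2 n)) => [[n rn]|H]; last first.
  have out I : uI I w = bs w.
    by apply: uI_out => n _; rewrite leNgt; apply/negP => h; apply: H; exists n.
  by rewrite /uA /uN !out subrr normr0; lra.
rewrite /uA (uI_in _ rn) //.
have s0 := s2_gt0 R n; have r4 : rho n w < 4 * s2 n by lra.
rewrite /uN (uI_near _ r4); case: asboolP => [_|/= /negP]; first by rewrite subrr normr0; lra.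
rewrite -leqNgt => Nn.
have /andP[b1 b2] := bs_range r4; have d1 := dip_le rn; have d0 := dip_ge0 n w.
have et := eta_le R Nn; have sl := s2_le R n; have en := eta_gt0 R n.
by rewrite ler_norml; apply/andP; split; lra.
Qed.

Lemma continuous_uA p : {for p, continuous uA}.
Proof.
apply/cvgrPdist_lt => e e0.
have e16 : 0 < e / 16 by rewrite divr_gt0.
have [N HN] := eta_small e16; have {HN} := HN N (leqnn _) => eN.
have e4 : 0 < e / 4 by rewrite divr_gt0.
have /cvgrPdist_lt/(_ _ e4) := @continuous_uN N p.
apply: filterS => w hw.
have h1 := uA_uN N p; have h2 := uA_uN N w.
move: h1 h2 hw; rewrite !ler_norml !ltr_norml => /andP[? ?] /andP[? ?] /andP[? ?].
by apply/andP; split; lra.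
Qed.

Lemma uA_submean p h : uA p <= amean (fun t => uA (circ p h t)).
Proof.
apply/ler_addgt0Pr => e e0.
have e8 : 0 < e / 8 by rewrite divr_gt0.
have [N HN] := eta_small e8; have {HN} := HN N (leqnn _) => eN.
have cA : continuous (fun t => uA (circ p h t)).
  by move=> t; apply: (continuous_at_comp (@continuous_circ R p h t)); exact: continuous_uA.
have cN : continuous (fun t => uN N (circ p h t)).
  by move=> t; apply: (continuous_at_comp (@continuous_circ R p h t)); exact: continuous_uN.
have H : amean (fun t => uN N (circ p h t)) <= amean (fun t => uA (circ p h t) + e / 2).
  apply: ler_amean => //; first by move=> t; have := cA t => c; cont.
  by move=> t; have := uA_uN N (circ p h t); rewrite ler_norml => /andP[]; lra.
rewrite (ameanD cA (@cst_continuous _ _ (e / 2))) amean_cst in H.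
have := uN_submean N p h; have := uA_uN N p; rewrite ler_norml => /andP[]; lra.
Qed.

Lemma uA_neg w : bs w <= 0 -> uA w = bs w.
Proof.
move=> b0; apply: uI_out => n _; rewrite leNgt; apply/negP => h.
have s0 := s2_gt0 R n; have r4 : rho n w < 4 * s2 n by lra.
by have := bs_ge r4; lra.
Qed.

Lemma uA_zero n w : rho n w <= e2 n -> uA w = 0.
Proof.
by move=> h; rewrite /uA (uI_in (n := n)) ?dip0 //; exact: le_lt_trans h (e2_lt R n).
Qed.

Lemma uA_le w : uA w <= nsq w.
Proof.
case: (pselect (exists n, rho n w < s2 n)) => [[n rn]|H].
  rewrite /uA (uI_in _ rn) //; have := dip_le rn; rewrite /bs.
  by have := s2_le R n; have := eta_le4 R n; lra.
rewrite /uA uI_out /bs; first by lra.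
by move=> n _; rewrite leNgt; apply/negP => h; apply: H; exists n.
Qed.

Lemma uA_ge w : - 1 <= uA w.
Proof.
case: (pselect (exists n, rho n w < s2 n)) => [[n rn]|H].
  by rewrite /uA (uI_in _ rn) //; have := dip_ge0 n w; lra.
rewrite /uA uI_out /bs; first by have := nsq_ge0 w; lra.
by move=> n _; rewrite leNgt; apply/negP => h; apply: H; exists n.
Qed.

End SubharmonicDips.

(** * The domain *)

Section Coordinates.
Variables (R : realType) (m : nat).
Local Notation n := m.+2.
Implicit Types (Z W : Cn R n).

Definition zc (i : 'I_n) Z : Cplx R := (Z.1 ord0 i, Z.2 ord0 i).
Definition i0 : 'I_n := ord0.
Definition i1 : 'I_n := lift ord0 ord0.
Definition zz := zc i0.
Definition ww := zc i1.
Definition N2 Z : R := \sum_(i < n) nsq (zc i Z).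
Definition BB Z : R := \sum_(i < m) nsq (zc (lift ord0 (lift ord0 i)) Z).

Lemma N2E Z : N2 Z = nsq (zz Z) + (nsq (ww Z) + BB Z).
Proof. by rewrite /N2 !big_ord_recl. Qed.

Lemma zc_disc i Z W c : zc i (disc Z W c) = zc i Z + cmul c (zc i W).
Proof. by rewrite /zc /disc /cvscale /cmul /=; congr pair; rewrite !mxE. Qed.

Lemma continuous_zc i Z : {for Z, continuous (zc i)}.
Proof.
apply: cplx_continuous.
- apply: (continuous_at_comp (g := fun v : 'rV[R]_n => v ord0 i) (f := fst)); first exact: cvg_fst.
  exact: coord_continuous.
- apply: (continuous_at_comp (g := fun v : 'rV[R]_n => v ord0 i) (f := snd)); first exact: cvg_snd.
  exact: coord_continuous.
Qed.

Lemma continuous_nsq_zc i (a : Cplx R) Z : {for Z, continuous (fun Z => nsq (zc i Z - a))}.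
Proof.
apply: (continuous_at_comp (g := fun c : Cplx R => nsq (c - a)) (@continuous_zc i Z)).
apply: (continuous_at_comp (f := fun c : Cplx R => c - a)); last exact: continuous_nsq.
exact: (@cvgB _ _ _ (nbhs (zc i Z)) _ id (fun=> a) _ a cvg_id (cvg_cst _)).
Qed.

Lemma continuous_nsq_zc0 i Z : {for Z, continuous (fun Z => nsq (zc i Z))}.
Proof. exact: (continuous_at_comp (@continuous_zc i Z) (@continuous_nsq R _)). Qed.

Lemma sos_nsq_zc i (a : Cplx R) : sos (fun Z => nsq (zc i Z - a)).
Proof.
move=> Z W; have [P HP] := sos1_affine (zc i Z - a) (zc i W).
by exists P => c; rewrite -HP zc_disc addrAC.
Qed.

Lemma sos_nsq_zc0 i : sos (fun Z => nsq (zc i Z)).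
Proof.
have -> : (fun Z => nsq (zc i Z)) = (fun Z => nsq (zc i Z - 0)).
  by apply/funext => Z; rewrite subr0.
exact: sos_nsq_zc.
Qed.

Lemma sos_N2 : sos N2.
Proof. by apply: (@sos_sum _ _ _ (fun i Z => nsq (zc i Z))) => i; exact: sos_nsq_zc0. Qed.

Lemma sos_BB : sos BB.
Proof.
by apply: (@sos_sum _ _ _ (fun i Z => nsq (zc (lift ord0 (lift ord0 i)) Z))) => i; exact: sos_nsq_zc0.
Qed.

Lemma continuous_sum_ord (N : nat) (F : 'I_N -> Cn R n -> R) Z :
  (forall i, {for Z, continuous (F i)}) -> {for Z, continuous (fun Z => \sum_i F i Z)}.
Proof.
elim: N F => [|N IH] F cF.
  have -> : (fun Z => \sum_i F i Z) = (fun=> 0) by apply/funext => x; rewrite big_ord0.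
  exact: contC.
have -> : (fun Z => \sum_i F i Z) = (fun Z => F ord0 Z + \sum_i F (lift ord0 i) Z).
  by apply/funext => x; rewrite big_ord_recl.
by apply: contD; [exact: cF | apply: IH => i; exact: cF].
Qed.

Lemma continuous_N2 Z : {for Z, continuous N2}.
Proof. by apply: continuous_sum_ord => i; exact: continuous_nsq_zc0. Qed.

Lemma continuous_BB Z : {for Z, continuous BB}.
Proof. by apply: continuous_sum_ord => i; exact: continuous_nsq_zc0. Qed.

Lemma N2_ge0 Z : 0 <= N2 Z. Proof. by apply: sumr_ge0 => i _; exact: nsq_ge0. Qed.
Lemma BB_ge0 Z : 0 <= BB Z. Proof. by apply: sumr_ge0 => i _; exact: nsq_ge0. Qed.

Lemma nsq_le_N2 i Z : nsq (zc i Z) <= N2 Z.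
Proof. by rewrite /N2 (bigD1 i) //= lerDl sumr_ge0 // => j _; exact: nsq_ge0. Qed.

Lemma N2_compact (c : R) : compact [set Z | N2 Z <= c].
Proof.
pose s := `|c| + 1.
pose K : set 'rV[R]_n := [set v | forall i, `[- s, s]%classic (v ord0 i)].
have cK : compact K by apply: (@rV_compact _ _ (fun=> `[- s, s]%classic)) => i; exact: segment_compact.
apply: (subclosed_compact _ (compact_setX cK cK)).
- have -> : [set Z | N2 Z <= c] = N2 @^-1` [set x | x <= c] by [].
  by apply: closed_comp; [move=> Z _; exact: continuous_N2 | exact: closed_le].
- move=> Z /= Zc.
  have H i : nsq (zc i Z) <= c by apply: le_trans Zc; exact: nsq_le_N2.
  have sb (x y : R) : x ^+ 2 + y ^+ 2 <= c -> `|x| <= s.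
    move=> h; rewrite -(@ler_pXn2r _ 2) ?nnegrE ?normr_ge0 ?real_normK ?num_real //; rewrite /s.
    - by have := sqr_ge0 y; have := ler_norm c; have := normr_ge0 c; nra.
    - by rewrite addr_ge0.
  split => i /=; rewrite in_itv /= -ler_norml.
  + exact: (sb _ _ (H i)).
  + by apply: (sb _ (Z.1 ord0 i)); rewrite addrC; exact: H.
Qed.
End Coordinates.

Section DomainFunctions.
Variables (R : realType) (m : nat).
Local Notation n := m.+2.
Implicit Types (Z W : Cn R n).
Local Notation zz := (@zz R m). Local Notation ww := (@ww R m).
Local Notation N2 := (@N2 R m). Local Notation BB := (@BB R m).
Local Notation rho := (@rho R). Local Notation e2 := (@e2 R).

Definition three : Cplx R := (3, 0).
(* Large enough for [2 <= FF k] and [e2 k <= rho k] to give [2 <= FF k.+1]. *)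
Definition Kexp (k : nat) : nat := (Num.truncn (56 / e2 k)).+2.

(* [FF k.+1 = FF k ^ K * rho k / (4 (1 + |w|^2))]; keeping the factor [1 + |w|^2] outside of
   [SS] makes every [SS k] a sum of squared moduli of polynomials. *)
Fixpoint SS (k : nat) Z : R := match k with
  | 0 => nsq (zz Z - three) * (2 * nsq (zz Z) + 200^-1 * nsq (ww Z))
  | k'.+1 => (1 + nsq (ww Z)) ^+ (Kexp k').-2 * SS k' Z ^+ (Kexp k') *
      (4^-1 * rho k' (ww Z))
  end.

Definition FF k Z := (1 + nsq (ww Z)) * SS k Z.
Definition GG k Z := FF k Z + BB Z.

Lemma Kexp_ge k : 56 / e2 k <= 2 ^+ (Kexp k).
Proof.
have h := truncnS_gt (56 / e2 k).
apply: (@le_trans _ _ (Num.truncn (56 / e2 k)).+1%:R); first exact: ltW.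
rewrite -natrX ler_nat /Kexp; apply: ltnW; apply: ltn_trans (ltn_expl _ (ltnSn 1)).
by [].
Qed.

Lemma SS_S k Z : SS k.+1 Z = (1 + nsq (ww Z)) ^+ (Kexp k).-2 * SS k Z ^+ (Kexp k) *
      (4^-1 * rho k (ww Z)).
Proof. by []. Qed.

Lemma SS_ge0 k Z : 0 <= SS k Z.
Proof.
have w0 := nsq_ge0 (ww Z); have z0 := nsq_ge0 (zz Z).
elim: k => [|k IH].
  apply: mulr_ge0; first exact: nsq_ge0.
  by apply: addr_ge0; apply: mulr_ge0 => //; rewrite invr_ge0.
apply: mulr_ge0; first by apply: mulr_ge0; apply: exprn_ge0 => //; exact: addr_ge0.
by apply: mulr_ge0; [rewrite invr_ge0 | exact: nsq_ge0].
Qed.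

Lemma FF_ge0 k Z : 0 <= FF k Z.
Proof. by rewrite mulr_ge0 ?SS_ge0 // addr_ge0 ?nsq_ge0. Qed.

Lemma sos_1w : sos (fun Z => 1 + nsq (ww Z)).
Proof. by apply: sosD; [exact: sos_cst | exact: sos_nsq_zc0]. Qed.

Lemma sos_SS k : sos (SS k).
Proof.
elim: k => [|k IH].
  apply: (sosM (F := fun Z => nsq (zz Z - three))); first exact: sos_nsq_zc.
  apply: sosD; apply: (sosM (F := fun=> _)); rewrite ?invr_ge0 //.
  - exact: sos_cst.
  - exact: sos_nsq_zc0.
  - by apply: sos_cst; rewrite invr_ge0.
  - exact: sos_nsq_zc0.
apply: (sosM (F := fun Z => (1 + nsq (ww Z)) ^+ (Kexp k).-2 * SS k Z ^+ (Kexp k))).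
  by apply: sosM; apply: sosX => //; exact: sos_1w.
apply: (sosM (F := fun=> _)); first by apply: sos_cst; rewrite invr_ge0.
exact: sos_nsq_zc.
Qed.

Lemma sos_GG k : sos (GG k).
Proof. by apply: sosD; [apply: sosM; [exact: sos_1w | exact: sos_SS] | exact: sos_BB]. Qed.

Lemma continuous_SS k Z : {for Z, continuous (SS k)}.
Proof.
elim: k => [|k IH].
  have c1 := @continuous_nsq_zc R m (i0 m) three Z.
  have c2 := @continuous_nsq_zc0 R m (i0 m) Z.
  have c3 := @continuous_nsq_zc0 R m (i1 m) Z.
  by rewrite /prop_for /=; cont.
have c1 := @continuous_nsq_zc0 R m (i1 m) Z.
have c2 := @continuous_nsq_zc R m (i1 m) (wpt R k) Z.
have -> : SS k.+1 = (fun Z => (1 + nsq (ww Z)) ^+ (Kexp k).-2 * SS k Z ^+ (Kexp k) *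
      (4^-1 * rho k (ww Z))) by [].
by cont.
Qed.

Lemma continuous_FF k Z : {for Z, continuous (FF k)}.
Proof.
have c1 := @continuous_nsq_zc0 R m (i1 m) Z; have c2 := @continuous_SS k Z.
by rewrite /FF; cont.
Qed.

Lemma continuous_GG k Z : {for Z, continuous (GG k)}.
Proof.
have c1 := @continuous_FF k Z; have c2 := @continuous_BB R m Z.
by rewrite /GG; cont.
Qed.

Lemma FF_rec k Z : FF k.+1 Z * (4 * (1 + nsq (ww Z))) = FF k Z ^+ Kexp k * rho k (ww Z).
Proof.
rewrite /FF SS_S exprMn; set a := 1 + _; set b := SS k Z ^+ _; set r := rho _ _.
have -> : a ^+ Kexp k = a ^+ (Kexp k).-2 * a ^+ 2 by rewrite -exprD addn2.
by move: (a ^+ (Kexp k).-2) => x; move: a b r => a b r; field.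
Qed.

Lemma nsqD_le (a b : Cplx R) : nsq (a + b) <= 2 * nsq a + 2 * nsq b.
Proof.
have e : 2 * nsq a + 2 * nsq b = nsq (a + b) + nsq (a - b) by rewrite /nsq /=; ring.
by rewrite e lerDl nsq_ge0.
Qed.

Lemma nsqN (a : Cplx R) : nsq (- a) = nsq a.
Proof. by rewrite /nsq /= !sqrrN. Qed.

Lemma nsq_wpt_le k : nsq (wpt R k) <= 2.
Proof.
by rewrite nsq_wpt; have := eta_le4 R k; have := eta_gt0 R k; nra.
Qed.

Lemma rho_le k (w : Cplx R) : rho k w <= 4 * (1 + nsq w).
Proof.
have := nsqD_le w (- wpt R k); rewrite nsqN; have := nsq_wpt_le k; have := nsq_ge0 w.
by rewrite /rho; lra.
Qed.

Lemma FF_le k Z : FF k.+1 Z <= FF k Z ^+ Kexp k.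
Proof.
have a0 : 0 < 4 * (1 + nsq (ww Z)) by rewrite mulr_gt0 // ltr_pwDl // nsq_ge0.
rewrite -(ler_pM2r a0) FF_rec; apply: ler_wpM2l; last exact: rho_le.
by rewrite exprn_ge0 // FF_ge0.
Qed.

Lemma FF_decr k Z : FF k Z <= 1 -> FF k.+1 Z <= FF k Z.
Proof.
move=> f1; apply: le_trans (FF_le k Z) _; rewrite /Kexp exprS ler_piMr ?FF_ge0 //.
by rewrite exprn_ile1 // FF_ge0.
Qed.

Lemma GG_decr k Z : GG k Z < 1 -> GG k.+1 Z <= GG k Z.
Proof.
move=> g1; rewrite lerD2r FF_decr //; have := BB_ge0 Z; move: g1; rewrite /GG; lra.
Qed.

Lemma GG_decr_le k j Z : GG k Z < 1 -> (k <= j)%N -> GG j Z <= GG k Z.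
Proof.
move=> g1; elim: j => [|j IH]; first by rewrite leqn0 => /eqP ->.
rewrite leq_eqVlt => /orP[/eqP <- //|]; rewrite ltnS => /IH gj.
by apply: (le_trans _ gj); apply: GG_decr; exact: le_lt_trans gj g1.
Qed.

Lemma FF_ge2 k Z : 2 <= FF 0 Z -> (forall j, (j < k)%N -> e2 j <= rho j (ww Z)) -> 2 <= FF k Z.
Proof.
move=> f0; elim: k => // k IH H.
have fk : 2 <= FF k Z by apply: IH => j jk; apply: H; rewrite ltnS ltnW.
have w0 := nsq_ge0 (ww Z).
have a0 : 0 < 4 * (1 + nsq (ww Z)) by rewrite mulr_gt0 // ltr_pwDl.
rewrite -(ler_pM2r a0) FF_rec.
have ek := e2_gt0 R k; have er := H k (leqnn _).
have el : e2 k <= 1.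
  have := e2_lt R k; have := s2_le R k; have := eta_le4 R k; lra.
have h1 : 56 / e2 k <= FF k Z ^+ Kexp k.
  apply: le_trans (Kexp_ge k) _; rewrite ler_pXn2r ?nnegrE //; exact: FF_ge0.
have h2 : 2 * (4 * (1 + nsq (ww Z))) <= 56 / e2 k * rho k (ww Z).
  have hw : nsq (ww Z) <= 2 * rho k (ww Z) + 4.
    have := nsqD_le (ww Z - wpt R k) (wpt R k); rewrite subrK -/(rho k (ww Z)).
    by have := nsq_wpt_le k; lra.
  have r1 : 1 <= rho k (ww Z) / e2 k by rewrite ler_pdivlMr // mul1r.
  have r2 : rho k (ww Z) <= rho k (ww Z) / e2 k.
    rewrite ler_pdivlMr // ler_piMr //; exact: nsq_ge0.
  have -> : 56 / e2 k * rho k (ww Z) = 56 * (rho k (ww Z) / e2 k) by field; rewrite gt_eqF.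
  lra.
apply: le_trans h2 _; apply: ler_wpM2r => //; exact: nsq_ge0.
Qed.

Definition Omega0 : set (Cn R n) := [set Z | exists k, GG k Z < 1].

Lemma open_Omega0 : open Omega0.
Proof.
have -> : Omega0 = \bigcup_k [set Z | GG k Z < 1].
  by apply/seteqP; split => Z /= [k]; [exists k | move=> _; exists k].
apply: bigcup_open => k _.
have -> : [set Z | GG k Z < 1] = GG k @^-1` [set x | x < 1] by [].
by apply: open_comp; [move=> Z _; exact: continuous_GG | exact: open_lt].
Qed.

Lemma Omega0_tube Z : Omega0 Z -> 2 <= FF 0 Z -> exists k, rho k (ww Z) < e2 k.
Proof.
move=> [k gk] f0; apply: contrapT => H.
have : 2 <= FF k Z.
  apply: FF_ge2 => // j _; rewrite leNgt; apply/negP => h; apply: H; by exists j.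
by have := BB_ge0 Z; move: gk; rewrite /GG; lra.
Qed.

Lemma tube_w k (w : Cplx R) : rho k w < e2 k -> nsq w < 4.
Proof.
move=> h; have := nsqD_le (w - wpt R k) (wpt R k); rewrite subrK -/(rho k w).
have np : nsq (wpt R k) <= 25 / 16.
  by rewrite nsq_wpt; have := eta_le4 R k; have := eta_gt0 R k; nra.
by have := e2_lt R k; have := s2_le R k; have := eta_le4 R k; lra.
Qed.

Definition term (k : nat) Z : R := k.+1%:R ^+ 2 * Num.max 0 (GG k Z + (k.+1%:R^-1 - 1)).
Definition rhoex Z : R := N2 Z + limn (fun N => \sum_(k < N) term k Z).

Lemma term_ge0 k Z : 0 <= term k Z.
Proof. by rewrite mulr_ge0 ?sqr_ge0 // le_max lexx. Qed.

Lemma term_locally0 Z : Omega0 Z ->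
  exists N, \forall Z' \near Z, forall k, (N <= k)%N -> term k Z' = 0.
Proof.
move=> [k0 gk]; pose del : R := (1 - GG k0 Z) / 2.
have del0 : 0 < del by rewrite divr_gt0 // subr_gt0.
pose N1 := (Num.truncn (del^-1)).+1.
exists (maxn k0 N1).
have near_lt : \forall Z' \near Z, GG k0 Z' < 1 - del.
  by apply: (cvgr_lt _ (@continuous_GG k0 Z)); rewrite /del; lra.
apply: filterS near_lt => Z' gZ' k; rewrite geq_max => /andP[kk0 kN1].
rewrite /term max_l ?mulr0 //.
have g1 : GG k Z' <= 1 - del.
  by apply: le_trans (GG_decr_le _ kk0) _; [lra | exact: ltW].
have : k.+1%:R^-1 <= del.
  rewrite -(invrK del) lef_pV2 ?posrE ?invr_gt0 ?ltr0n //.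
  apply: le_trans (ltW (truncnS_gt _)) _; rewrite ler_nat; exact: leqW.
by move=> h; rewrite addrA subr_le0; have := lerD g1 h; rewrite subrK.
Qed.

Lemma rhoex_eq Z : Omega0 Z ->
  exists N, \forall Z' \near Z, forall M, (N <= M)%N -> rhoex Z' = N2 Z' + \sum_(k < M) term k Z'.
Proof.
move=> /term_locally0[N HN]; exists N; apply: filterS HN => Z' H M NM.
rewrite /rhoex; congr (_ + _).
have e M' : (N <= M')%N -> \sum_(k < M') term k Z' = \sum_(k < N) term k Z'.
  move=> NM'; rewrite -!(big_mkord xpredT (fun k => term k Z')) (big_cat_nat _ NM') //=.
  rewrite [X in _ + X]big_nat_cond [X in _ + X]big1 ?addr0 //.
  by move=> k /andP[/andP[k1 _] _]; exact: H.
rewrite e //; apply: lim_near_cst; first exact: norm_hausdorff.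
by exists N => // M' /= NM'; exact: e.
Qed.

Lemma rhoex_ge Z M : Omega0 Z -> N2 Z + \sum_(k < M) term k Z <= rhoex Z.
Proof.
move=> /rhoex_eq[N /nbhs_singleton H]; rewrite (H (maxn N M)) ?leq_maxl // lerD2l.
rewrite -!(big_mkord xpredT (fun k => term k Z)) [leRHS](big_cat_nat _ (leq_maxr N M)) //=.
by rewrite lerDl sumr_ge0 // => k _; exact: term_ge0.
Qed.

Lemma continuous_term k Z : {for Z, continuous (term k)}.
Proof. by have := @continuous_GG k Z => c; rewrite /term; cont. Qed.

Lemma lgl_term k Z : lgl (term k) Z.
Proof.
have cg (c : R) : near_continuous (fun Z => GG k Z + c) Z.
  by apply: (@filterE _ (nbhs Z)) => Z'; have := @continuous_GG k Z' => ?; cont.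
have cc (c : R) : near_continuous (fun _ : Cn R n => c) Z.
  by apply: (@filterE _ (nbhs Z)) => Z'; cont.
have cG : near_continuous (GG k) Z by apply: (@filterE _ (nbhs Z)) => Z'; exact: continuous_GG.
apply: lglnZ; first exact: sqr_ge0.
  apply: (@filterE _ (nbhs Z)) => Z'; have := @continuous_GG k Z' => ?; by cont.
apply: lgln_max => //; first exact: lgln_cst.
apply: lglnD => //; last exact: lgln_cst.
by apply: lgln_submean => W; apply: sos_submean; exact: sos_GG.
Qed.

Lemma near_continuous_all (f : Cn R n -> R) Z : (forall Z, {for Z, continuous f}) ->
  near_continuous f Z.
Proof. by move=> H; apply: (@filterE _ (nbhs Z)) => Z'; exact: H. Qed.

Lemma rhoex_local Z : Omega0 Z -> {for Z, continuous rhoex} /\ lgl rhoex Z.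
Proof.
move=> /rhoex_eq[N HN].
pose f Z' := N2 Z' + \sum_(k < N) term k Z'.
have cs N' Z' : {for Z', continuous (fun Z => \sum_(k < N') term k Z)}.
  by apply: (@cont_sum _ _ Z' N' term) => k _; exact: continuous_term.
have cf Z' : {for Z', continuous f}.
  by apply: contD; [exact: continuous_N2 | exact: cs].
have ef : \forall Z' \near Z, f Z' = rhoex Z' by apply: filterS HN => Z' /(_ N (leqnn _)) ->.
split; first exact: (continuous_near_eq ef (cf Z)).
apply: (lgln_eq (near_continuous_all _ cf) ef).
apply: lglnD.
- exact: (near_continuous_all _ (@continuous_N2 R m)).
- exact: (near_continuous_all _ (cs N)).
- by apply: lgln_submean => W; apply: sos_submean; exact: sos_N2.
- elim: N {HN f cf ef} => [|N IH].
    have -> : (fun Z' => \sum_(k < 0) term k Z') = (fun=> 0).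
      by apply/funext => Z'; rewrite big_ord0.
    exact: lgln_cst.
  have -> : (fun Z' => \sum_(k < N.+1) term k Z') = (fun Z' => \sum_(k < N) term k Z' + term N Z').
    by apply/funext => Z'; rewrite big_ord_recr.
  apply: lglnD => //; last exact: lgl_term.
  + exact: (near_continuous_all _ (cs N)).
  + exact: (near_continuous_all _ (@continuous_term N)).
Qed.

End DomainFunctions.

Section ConnectedComponents.
Variables (R : realType) (V : normedModType R).
Implicit Types (A : set V) (p q : V).

Lemma connected_component_path A p (g : R -> V) : (forall t, {for t, continuous g}) ->
  (forall t, 0 <= t <= 1 -> A (g t)) -> connected_component A p (g 0) ->
  connected_component A p (g 1).
Proof.
move=> cg Ag pg0; apply: (connected_component_trans pg0).
have I0 : `[0, 1]%classic (0 : R) by rewrite /= in_itv /= lexx ler01.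
have I1 : `[0, 1]%classic (1 : R) by rewrite /= in_itv /= lexx ler01.
apply: (@connected_component_max _ A [set g t | t in `[0, 1]%classic]).
- by exists 0.
- by move=> _ [t /= tI <-]; apply: Ag; move: tI; rewrite in_itv.
- apply: connected_continuous_connected; first exact: segment_connected.
  exact: continuous_subspaceT.
- by exists 1.
Qed.

Lemma open_connected_component A p : open A -> open (connected_component A p).
Proof.
move=> oA; rewrite openE => q pq; rewrite /interior.
have Aq : A q := connected_component_sub pq.
have /nbhs_ballP[e /= e0 He] := open_nbhs_nbhs (conj oA Aq).
apply/nbhs_ballP; exists e => // y; rewrite -ball_normE /= => yq.
pose g (t : R) : V := q + t *: (y - q).
have -> : y = g 1 by rewrite /g scale1r addrC subrK.
apply: connected_component_path => [t|t /andP[t0 t1]|].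
- apply: cvgD; first exact: cvg_cst.
  by apply: cvgZr_tmp; exact: cvg_id.
- apply: He; rewrite -ball_normE /= /g opprD addNKr normrN normrZ ger0_norm //.
  apply: le_lt_trans yq; rewrite -normrN opprB; apply: ler_piMl => //.
- by rewrite /g scale0r addr0.
Qed.
End ConnectedComponents.

Section Domain.
Variables (R : realType) (m : nat).
Local Notation n := m.+2.
Implicit Types (Z W : Cn R n).
Local Notation zz := (@zz R m). Local Notation ww := (@ww R m).
Local Notation N2 := (@N2 R m). Local Notation BB := (@BB R m).
Local Notation rho := (@rho R). Local Notation e2 := (@e2 R).
Local Notation zc := (@zc R m). Local Notation three := (three R).
Local Notation FF := (@FF R m). Local Notation GG := (@GG R m).
Local Notation Omega0 := (@Omega0 R m). Local Notation rhoex := (@rhoex R m).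

Lemma Cn_eq Z W : (forall i, zc i Z = zc i W) -> Z = W.
Proof.
case: Z W => [z1 z2] [w1 w2] H; congr pair; apply/rowP => i; by case: (H i).
Qed.

Definition pt (z w : Cplx R) : Cn R n :=
  (\row_i (if i == i0 m then z.1 else if i == i1 m then w.1 else 0),
   \row_i (if i == i0 m then z.2 else if i == i1 m then w.2 else 0)).

Lemma zz_pt z w : zz (pt z w) = z.
Proof. by rewrite /zz /zc /pt /= !mxE eqxx; case: z. Qed.
Lemma ww_pt z w : ww (pt z w) = w.
Proof. by rewrite /ww /zc /pt /= !mxE /=; case: w. Qed.
Lemma zc_pt i z w : zc (lift ord0 (lift ord0 i)) (pt z w) = 0.
Proof. by rewrite /zc /pt /= !mxE. Qed.
Lemma BB_pt z w : BB (pt z w) = 0.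
Proof. by apply: big1 => i _; rewrite zc_pt /nsq /= expr0n addr0. Qed.

Lemma pt00 : pt 0 0 = 0.
Proof. by congr pair; apply/rowP => i; rewrite !mxE /=; case: ifP => // _; case: ifP. Qed.

Lemma pt_disc z w z' w' c : disc (pt z w) (pt z' w') c = pt (z + cmul c z') (w + cmul c w').
Proof.
apply: Cn_eq => i; rewrite zc_disc.
have zE Z : zc ord0 Z = zz Z by []; have wE Z : zc (lift ord0 ord0) Z = ww Z by [].
case: (unliftP ord0 i) => [j ->|->]; last by rewrite !zE !zz_pt.
case: (unliftP ord0 j) => [k ->|->]; last by rewrite !wE !ww_pt.
by rewrite !zc_pt cmul0r addr0.
Qed.

Definition Omega : set (Cn R n) := connected_component Omega0 0.

Lemma Omega_sub : Omega `<=` Omega0. Proof. exact: connected_component_sub. Qed.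
Lemma open_Omega : open Omega.
Proof. by apply: open_connected_component; exact: open_Omega0. Qed.

Lemma FF0_pt z w : FF 0 (pt z w) =
  (1 + nsq w) * (nsq (z - three) * (2 * nsq z + 200^-1 * nsq w)).
Proof. by rewrite /FF /= zz_pt ww_pt. Qed.

Lemma nsq0 : nsq (0 : Cplx R) = 0. Proof. by rewrite /nsq /= expr0n addr0. Qed.

Lemma Omega0_disc w : nsq w <= 4 -> Omega0 (pt 0 w).
Proof.
move=> w4; exists 0; rewrite /GG FF0_pt BB_pt nsq0 sub0r nsqN mulr0 add0r addr0.
have w0 := nsq_ge0 w.
have -> : nsq three = 9 by rewrite /nsq /= expr0n addr0; ring.
nra.
Qed.

Lemma Omega_0 : Omega 0.
Proof. by apply: connected_component_refl; rewrite -pt00; apply: Omega0_disc; rewrite nsq0. Qed.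

Lemma Omega_disc_path Z W (c : Cplx R) : Omega Z ->
  (forall t : R, 0 <= t <= 1 -> Omega0 (disc Z W (t *: c))) -> Omega (disc Z W c).
Proof.
move=> oZ H; rewrite -[c]scale1r.
apply: (@connected_component_path R (Cn R n) Omega0 0 (fun t => disc Z W (t *: c))) => //.
- move=> t; apply: (continuous_at_comp (f := fun t : R => t *: c)); last exact: continuous_disc.
  by apply: cvgZr_tmp; exact: cvg_id.
- by rewrite scale0r disc0.
Qed.

Lemma Omega_disc w : nsq w <= 4 -> Omega (pt 0 w).
Proof.
move=> w4; have e c : disc 0 (pt 0 w) c = pt 0 (cmul c w).
  by rewrite -pt00 pt_disc cmul0r !add0r.
pose o : Cplx R := (1, 0).
have -> : w = cmul o w by rewrite /o /cmul /=; case: w {w4 e} => a b /=; congr pair; ring.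
rewrite -e; apply: Omega_disc_path; first exact: Omega_0.
move=> t /andP[t0 t1]; rewrite e; apply: Omega0_disc; rewrite nsqM nsqZ.
have -> : nsq o = 1 by rewrite /nsq /= expr0n addr0 expr1n.
have := nsq_ge0 w; nra.
Qed.

Lemma rho_wpt k : rho k (wpt R k) = 0.
Proof. by rewrite /rho subrr nsq0. Qed.

Lemma Omega0_line k z : Omega0 (pt z (wpt R k)).
Proof. by exists k.+1; rewrite /GG BB_pt /FF SS_S ww_pt rho_wpt !mulr0 add0r. Qed.

Lemma Omega0_line3 w : Omega0 (pt three w).
Proof. by exists 0; rewrite /GG FF0_pt BB_pt subrr nsq0 mul0r mulr0 add0r. Qed.

Lemma Omega_line k z : Omega (pt z (wpt R k)).
Proof.
pose o : Cplx R := (1, 0).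
have e c : disc (pt 0 (wpt R k)) (pt o 0) c = pt c (wpt R k).
  rewrite pt_disc cmul0r addr0 add0r; congr pt.
  by rewrite /o /cmul /=; case: c => a b /=; congr pair; ring.
rewrite -e; apply: Omega_disc_path; last by move=> t _; rewrite e; exact: Omega0_line.
by apply: Omega_disc; apply: le_trans (nsq_wpt_le R k) _; rewrite ler_nat.
Qed.

Lemma Omega_line3 w : Omega (pt three w).
Proof.
have e c : disc (pt three (wpt R 0)) (pt 0 (w - wpt R 0)) c = pt three (wpt R 0 + cmul c (w - wpt R 0)).
  by rewrite pt_disc cmul0r addr0.
pose o : Cplx R := (1, 0).
have -> : w = wpt R 0 + cmul o (w - wpt R 0).
  have -> : cmul o (w - wpt R 0) = w - wpt R 0.
    by rewrite /o /cmul; case: (w - _) => a b /=; congr pair; ring.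
  by rewrite addrC subrK.
rewrite -e; apply: Omega_disc_path; first exact: Omega_line.
by move=> t _; rewrite e; exact: Omega0_line3.
Qed.

Lemma domain_Omega : domain Omega.
Proof.
split; [exact: open_Omega | exact: component_connected | by exists 0; exact: Omega_0].
Qed.

Lemma PSHk0_intro (U : set (Cn R n)) (f : Cn R n -> R) : open U ->
  (forall Z, U Z -> {for Z, continuous f} /\ lgl f Z) -> PSHk 0 U f.
Proof.
move=> oU H; split.
- by apply: continuous_in_subspaceT => Z /set_mem /H[].
- by apply: psh_local => // Z /H[].
Qed.

Lemma PSHk0_rhoex : PSHk 0 Omega rhoex.
Proof. by apply: PSHk0_intro => [|Z /Omega_sub]; [exact: open_Omega | exact: rhoex_local]. Qed.

Lemma Omega_closure_in Z : closure Omega Z -> Omega0 Z -> Omega Z.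
Proof.
move=> cZ oZ.
have oc : open (connected_component Omega0 Z) by apply: open_connected_component; exact: open_Omega0.
have /cZ[Y [oY ZY]] : nbhs Z (connected_component Omega0 Z).
  by apply: open_nbhs_nbhs; split => //; exact: connected_component_refl.
by apply: (connected_component_trans oY); exact: connected_component_sym.
Qed.

Lemma pseudoconvex_Omega : pseudoconvex Omega.
Proof.
exists rhoex; first exact: PSHk0_rhoex.
move=> c; set A := [set Z | _].
have NA (M : nat) : closure A `<=` [set Z | N2 Z + \sum_(k < M) term k Z <= c].
  have cl : closed [set Z | N2 Z + \sum_(k < M) term k Z <= c].
    have -> : [set Z | N2 Z + \sum_(k < M) term k Z <= c] =
      (fun Z => N2 Z + \sum_(k < M) term k Z) @^-1` [set x | x <= c] by [].
    apply: closed_comp; last exact: closed_le.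
    move=> Z _; apply: contD; first exact: continuous_N2.
    by apply: (@cont_sum _ _ Z M (@term R m)) => k _; exact: continuous_term.
  rewrite [X in _ `<=` X]((closure_id _).1 cl); apply: closure_subset => Z [/Omega_sub oZ Zc].
  exact: le_trans (rhoex_ge M oZ) (ltW Zc).
split.
- apply: (subclosed_compact (@closed_closure _ _) (@N2_compact R m c)) => Z /(NA 0) /=.
  by rewrite big_ord0 addr0.
- move=> Z cZ; apply: Omega_closure_in.
    by apply: closure_subset cZ => Y [].
  apply: contrapT => nZ.
  pose M := (Num.truncn c).+1.
  have := NA M Z cZ; apply/negP; rewrite -ltNge.
  apply: (@lt_le_trans _ _ M%:R); first exact: truncnS_gt.
  rewrite -[leLHS]add0r lerD ?N2_ge0 //.
  have -> : M%:R = \sum_(k < M) (1 : R) by rewrite sumr_const card_ord.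
  apply: ler_sum => k _.
  have gk : 1 <= GG k Z by rewrite leNgt; apply/negP => h; apply: nZ; exists k.
  have k0 : (0 : R) < k.+1%:R by rewrite ltr0n.
  have h1 : k.+1%:R^-1 <= GG k Z + (k.+1%:R^-1 - 1) :> R.
    by rewrite addrA addrAC -[leLHS]add0r lerD2r subr_ge0.
  apply: (@le_trans _ _ (k.+1%:R ^+ 2 * k.+1%:R^-1 : R)).
    by rewrite expr2 -mulrA mulfV ?gt_eqF // mulr1 ler1n.
  by rewrite ler_pM2l ?exprn_gt0 // le_max h1 orbT.
Qed.

End Domain.

(** * The bounded continuous function *)

Section BoundedFunction.
Variables (R : realType) (m : nat).
Local Notation n := m.+2.
Implicit Types (Z W : Cn R n).
Local Notation zz := (@zz R m). Local Notation ww := (@ww R m).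
Local Notation N2 := (@N2 R m). Local Notation BB := (@BB R m).
Local Notation rho := (@rho R). Local Notation e2 := (@e2 R). Local Notation uA := (@uA R).
Local Notation zc := (@zc R m). Local Notation three := (three R).
Local Notation FF := (@FF R m). Local Notation GG := (@GG R m).
Local Notation Omega0 := (@Omega0 R m). Local Notation Omega := (@Omega R m).

Definition uin Z : R := Num.max (uA (ww Z)) (20^-1 * (N2 Z - 10)).
Definition uu Z : R := if nsq (zz Z) < 4 then uin Z else 0.

Lemma Omega0_BB Z : Omega0 Z -> BB Z < 1.
Proof. by move=> [k]; apply: le_lt_trans; rewrite lerDr FF_ge0. Qed.

Lemma nsq_sub_three (a : R) (z : Cplx R) : 0 <= a <= 3 -> nsq z <= a ^+ 2 ->
  (3 - a) ^+ 2 <= nsq (z - three).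
Proof.
move=> /andP[a0 a3] za; have z1 : z.1 <= a.
  have h : `|z.1| <= a.
    rewrite -(@ler_pXn2r _ 2) ?nnegrE // real_normK ?num_real //.
    by apply: le_trans za; rewrite lerDl sqr_ge0.
  exact: le_trans (ler_norm _) h.
have -> : nsq (z - three) = (3 - z.1) ^+ 2 + z.2 ^+ 2 by rewrite /nsq /=; ring.
apply: ler_wpDr; first exact: sqr_ge0.
have z3 := le_trans z1 a3.
by rewrite ler_pXn2r ?nnegrE ?subr_ge0 // lerD2l lerN2.
Qed.

Lemma FF0_ge2 Z : 1 <= nsq (zz Z) <= 4 -> 2 <= FF 0 Z.
Proof.
move=> /andP[z1 z4]; have w0 := nsq_ge0 (ww Z).
have h : (3 - 2) ^+ 2 <= nsq (zz Z - three).
  apply: nsq_sub_three; first by rewrite ler0n ler_nat.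
  by rewrite -natrX.
rewrite /FF /=; move: (nsq (zz Z - three)) (nsq (zz Z)) (nsq (ww Z)) h z1 z4 w0 => a b c h z1 z4 w0.
have h1 : 2 <= a * (2 * b + 200^-1 * c) by nra.
nra.
Qed.

Lemma FF0_ge2w Z : nsq (zz Z) <= 1 -> 20 <= nsq (ww Z) -> 2 <= FF 0 Z.
Proof.
move=> z1 w20; have z0 := nsq_ge0 (zz Z).
have h : (3 - 1) ^+ 2 <= nsq (zz Z - three).
  by apply: nsq_sub_three; rewrite ?expr1n // ler01 ler1n.
rewrite /FF /=; move: (nsq (zz Z - three)) (nsq (zz Z)) (nsq (ww Z)) h z1 z0 w20 => a b c h z1 z0 w20.
have h1 : 4 * 10^-1 <= a * (2 * b + 200^-1 * c) by nra.
nra.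
Qed.

Lemma uu_outer Z : Omega0 Z -> 1 <= nsq (zz Z) -> uu Z = 0.
Proof.
move=> oZ z1; rewrite /uu; case: ltP => // z4.
have [k rk] : exists k, rho k (ww Z) < e2 k.
  by apply: Omega0_tube => //; apply: FF0_ge2; rewrite z1 ltW.
rewrite /uin (uA_zero (ltW rk)) max_l //.
have := tube_w rk; have := Omega0_BB oZ; rewrite N2E.
move: (nsq _) (nsq _) (BB Z) z4 => a b c; lra.
Qed.

Lemma uu_bounds Z : Omega0 Z -> -20 <= uu Z <= 20.
Proof.
move=> oZ; have [z1|z1] := leP 1 (nsq (zz Z)).
  by rewrite uu_outer // oppr_le0 !ler0n.
have w20 : nsq (ww Z) < 20.
  rewrite ltNge; apply/negP => w20.
  have [k /tube_w] := Omega0_tube oZ (FF0_ge2w (ltW z1) w20); lra.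
have b1 := Omega0_BB oZ.
rewrite /uu ifT; last by apply: lt_le_trans z1 _; rewrite ler1n.
have := uA_ge (ww Z); have := uA_le (ww Z).
rewrite /uin le_max ge_max N2E.
move: (uA _) z1 w20 b1; move: (nsq (zz Z)) (nsq _) (BB Z) => a b c d a1 b20 c1 h1 h2.
apply/andP; split; first by apply/orP; left; lra.
by apply/andP; split; lra.
Qed.

Lemma bounded_uu : [bounded uu Z | Z in Omega].
Proof.
exists 20; split; first exact: num_real.
move=> M M20 Z /Omega_sub /uu_bounds uZ /=.
by apply: le_trans (ltW M20); rewrite ler_norml.
Qed.

Lemma continuous_uAw Z : {for Z, continuous (fun Z => uA (ww Z))}.
Proof. exact: (continuous_at_comp (@continuous_zc R m (i1 m) Z) (@continuous_uA R _)). Qed.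

Lemma continuous_uin Z : {for Z, continuous uin}.
Proof. by rewrite /uin; have := @continuous_uAw Z; have := @continuous_N2 R m Z => a b; cont. Qed.

Lemma continuous_quad Z : {for Z, continuous (fun Z => 20^-1 * (N2 Z - 10))}.
Proof. by have := @continuous_N2 R m Z => a; cont. Qed.

Lemma lgl_quad Z : lgl (fun Z => 20^-1 * (N2 Z - 10)) Z.
Proof.
have -> : (fun Z => 20^-1 * (N2 Z - 10)) = (fun Z => 20^-1 * N2 Z + (20^-1 * - 10)).
  by apply/funext => Y; rewrite mulrDr.
have c1 : near_continuous (fun Z => 20^-1 * N2 Z) Z.
  by apply: near_continuous_all => Y; have := @continuous_N2 R m Y => a; cont.
apply: lglnD => //; last exact: lgln_cst.
- by apply: near_continuous_all => Y; cont.
- apply: lglnZ; [by rewrite invr_ge0 | exact: (near_continuous_all _ (@continuous_N2 R m)) |].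
  by apply: lgln_submean => W; apply: sos_submean; exact: sos_N2.
Qed.

Lemma lgl_uin Z : lgl uin Z.
Proof.
apply: lgln_max.
- exact: (near_continuous_all _ continuous_uAw).
- exact: (near_continuous_all _ continuous_quad).
- apply: lgln_submean => W; apply: le_trans (uA_submean _ (ww W)) _.
  rewrite le_eqVlt; apply/orP; left; apply/eqP; congr amean; apply/funext => t; congr uA.
  by rewrite /circ /ww zc_disc.
- exact: lgl_quad.
Qed.

Lemma PSHk0_uu : PSHk 0 Omega uu.
Proof.
apply: PSHk0_intro => [|Z oZ]; first exact: open_Omega.
have cz := @continuous_nsq_zc0 R m (i0 m) Z.
have [z1|z1] := ltP 1 (nsq (zz Z)).
- have e0 : \forall Y \near Z, 0 = uu Y.
    apply: filterS2 (cvgr_gt _ cz _ z1) (open_nbhs_nbhs (conj (@open_Omega R m) oZ)) => Y y1 oY.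
    by rewrite uu_outer //; [exact: Omega_sub | exact: ltW].
  split; first exact: (continuous_near_eq e0 (@contC _ _ _ 0)).
  apply: (lgln_eq _ e0); last exact: lgln_cst.
  by apply: near_continuous_all => Y; cont.
- have z4 : nsq (zz Z) < 4 by apply: le_lt_trans z1 _; rewrite ltr1n.
  have e0 : \forall Y \near Z, uin Y = uu Y.
    by apply: filterS (cvgr_lt _ cz _ z4) => Y y4; rewrite /uu y4.
  split; first exact: (continuous_near_eq e0 (@continuous_uin Z)).
  apply: (lgln_eq _ e0); last exact: lgl_uin.
  exact: (near_continuous_all _ continuous_uin).
Qed.

Lemma uu_near0 Z : N2 Z < 10^-1 -> uu Z = 20^-1 * (N2 Z - 10).
Proof.
move=> h; have zl := nsq_le_N2 (i0 m) Z; have wl := nsq_le_N2 (i1 m) Z; have N0 := N2_ge0 Z.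
have b0 : bs (ww Z) <= 0 by rewrite /bs /ww; lra.
rewrite /uu ifT; last by rewrite /zz; lra.
by rewrite /uin max_r // uA_neg // /bs /ww; lra.
Qed.

Lemma N2_0 : N2 0 = 0.
Proof. by apply: big1 => i _; rewrite /nsq /zc /= !mxE expr0n addr0. Qed.

Lemma uu_0 : uu 0 = - 2^-1.
Proof. by rewrite uu_near0 N2_0 ?invr_gt0 //; field. Qed.

Lemma uu_pt01 : uu (pt m 0 ((1, 0) : Cplx R)) = 0.
Proof.
have n1 : nsq ((1, 0) : Cplx R) = 1 by rewrite /nsq /= expr0n expr1n addr0.
rewrite /uu zz_pt nsq0 ltr0n /= /uin ww_pt.
have b0 : bs ((1, 0) : Cplx R) = 0 by rewrite /bs n1 subrr.
rewrite uA_neg b0 // max_l // N2E zz_pt ww_pt BB_pt n1 nsq0.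
by rewrite add0r addr0; lra.
Qed.
End BoundedFunction.

(** * Strict plurisubharmonicity of a quadratic function *)

Section SecondDifference.
Variable R : realType.

Lemma second_difference_le (g g1 g2 : R -> R) (B : R) :
  (forall t : R, -1 <= t <= 1 -> is_derive t 1 g (g1 t)) ->
  (forall t : R, -1 <= t <= 1 -> is_derive t 1 g1 (g2 t)) ->
  (forall t : R, -1 <= t <= 1 -> g2 t <= B) -> g 1 + g (-1) <= 2 * g 0 + B.
Proof.
move=> dg dg1 g2B.
pose h (t : R) : R := B * t ^+ 2 - (g t + g (- t)).
pose h1 (t : R) : R := 2 * B * t - (g1 t - g1 (- t)).
have dh (t : R) : 0 <= t <= 1 -> is_derive t 1 h (h1 t).
  move=> /andP[t0 t1].
  have d1 : is_derive t 1 g (g1 t) by apply: dg; apply/andP; split; lra.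
  have d2 : is_derive (- t) 1 g (g1 (- t)) by apply: dg; apply/andP; split; lra.
  have d3 : is_derive t 1 (fun x => g (- x)) (g1 (- t) * - 1).
    by apply: (@is_derive1_comp _ g (fun x => - x)).
  rewrite /h /h1; apply: is_derive_eq; rewrite /GRing.scale /= !mulr1; ring.
have cont_d (f f1 : R -> R) (a b : R) : (forall t : R, a <= t <= b -> is_derive t 1 f (f1 t)) ->
    {within `[a, b], continuous f}.
  move=> H; apply: continuous_in_subspaceT => t /set_mem /=; rewrite in_itv /= => /H.
  exact: is_derive_continuous.
have [c] := MVT ltr01 (fun t ti => dh t (ltac:(by move: ti; rewrite in_itv /= => /andP[/ltW -> /ltW ->])))
  (cont_d _ _ _ _ dh).
rewrite in_itv /= => /andP[c0 c1] hc.
have cc : - c < c by lra.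
have dg1' (t : R) : - c <= t <= c -> is_derive t 1 g1 (g2 t).
  by move=> /andP[t1 t2]; apply: dg1; apply/andP; split; lra.
have [d] := MVT cc (fun t ti => dg1' t (ltac:(by move: ti; rewrite in_itv /= => /andP[/ltW -> /ltW ->])))
  (cont_d _ _ _ _ dg1').
rewrite in_itv /= => /andP[d0 d1] gd.
have Bd : g2 d <= B by apply: g2B; apply/andP; split; lra.
move: hc; rewrite /h /h1 gd oppr0 => hc.
have : g2 d * (c - - c) <= 2 * B * c by nra.
move: hc; rewrite expr1n expr0n /=; lra.
Qed.

Variable V : normedModType R.

Lemma is_derive_line (f : V -> R) (p v : V) (t : R) : differentiable f (p + t *: v) ->
  is_derive t 1 (fun s : R => f (p + s *: v)) ('D_v f (p + t *: v)).
Proof.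
move=> /diff_derivable => /(_ v) df.
have e : (fun h : R => h^-1 *: (f (p + (h *: 1 + t) *: v) - f (p + t *: v))) =
  (fun h : R => h^-1 *: ((f \o shift (p + t *: v)) (h *: v) - f (p + t *: v))).
  apply/funext => h; congr (_ *: (f _ - _)) => /=.
  by rewrite -[h%:A]/(h * 1) mulr1 scalerDl addrCA.
split; first by rewrite /derivable /= e.
by rewrite /derive /= e.
Qed.

Lemma derive_sum_dir (f : V -> R) (p : V) (I : finType) (x : I -> R) (E : I -> V) :
  differentiable f p -> 'D_(\sum_i x i *: E i) f p = \sum_i x i * 'D_(E i) f p.
Proof.
move=> df; rewrite deriveE // linear_sum; apply: eq_bigr => i _.
by rewrite linearZ deriveE.
Qed.

Lemma derive_lin_comb (p v : V) (I : finType) (x : I -> R) (F : I -> V -> R) :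
  (forall i, differentiable (F i) p) ->
  'D_v (fun y => \sum_i x i * F i y) p = \sum_i x i * 'D_v (F i) p.
Proof.
move=> dF; apply: (@derive_val _ _ _ p v (fun y => \sum_i x i * F i y)).
elim: (index_enum I) => [|i r IH].
  have -> : (fun y => \sum_(j <- [::]) x j * F j y) = (fun=> 0) by apply/funext => y; rewrite big_nil.
  by rewrite big_nil; exact: is_derive_cst.
have -> : (fun y => \sum_(j <- i :: r) x j * F j y) =
  (x i *: F i) \+ (fun y => \sum_(j <- r) x j * F j y) by apply/funext => y; rewrite big_cons.
rewrite big_cons; apply: is_deriveD; apply: is_deriveZ.
by apply/derivableP; apply: diff_derivable; exact: dF.
Qed.

Lemma compact_support_bound (U K : set V) (f : V -> R) : compact K -> K `<=` U ->
  {within U, continuous f} -> (forall p, U p -> ~ K p -> f p = 0) ->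
  exists M : R, forall p, U p -> `|f p| <= M.
Proof.
move=> cK KU cf f0.
have /compact_bounded[M [_ HM]] := continuous_compact (continuous_subspaceW KU cf) cK.
exists (`|M| + 1) => p Up; case: (pselect (K p)) => Kp.
  apply: (HM (`|M| + 1)); last by exists p.
  by apply: le_lt_trans (ler_norm M) _; rewrite ltrDl.
by rewrite f0 // normr0 addr_ge0.
Qed.
End SecondDifference.

Section StrictPsh.
Variables (R : realType) (m : nat).
Local Notation n := m.+2.
Implicit Types (Z W X : Cn R n).
Local Notation N2 := (@N2 R m). Local Notation zc := (@zc R m).

Let I : finType := ('I_n + 'I_n)%type.
Let E (a : I) : Cn R n := match a with
  | inl i => (delta_mx 0 i, 0)
  | inr i => (0, delta_mx 0 i)
  end.
Let x X (a : I) : R := match a with inl i => X.1 0 i | inr i => X.2 0 i end.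

Lemma fst_sum (J : finType) (F : J -> Cn R n) : (\sum_j F j).1 = \sum_j (F j).1.
Proof. by apply: (big_morph (fun z : Cn R n => z.1)). Qed.
Lemma snd_sum (J : finType) (F : J -> Cn R n) : (\sum_j F j).2 = \sum_j (F j).2.
Proof. by apply: (big_morph (fun z : Cn R n => z.2)). Qed.

Lemma Cn_basis X : X = \sum_a x X a *: E a.
Proof.
rewrite [LHS]surjective_pairing [RHS]surjective_pairing fst_sum snd_sum; congr pair.
- rewrite big_sumType /= [X in _ = _ + X]big1 ?addr0; first exact: row_sum_delta.
  by move=> i _; rewrite scaler0.
- rewrite big_sumType /= [X in _ = X + _]big1 ?add0r; first exact: row_sum_delta.
  by move=> i _; rewrite scaler0.
Qed.

Lemma N2_basis X : N2 X = \sum_a x X a ^+ 2.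
Proof. by rewrite big_sumType /= -big_split. Qed.

Lemma sum_mean_sq (J : finType) (C : R) (y : J -> R) :
  \sum_b \sum_a (C * (2^-1 * (y b ^+ 2 + y a ^+ 2))) = C * #|J|%:R * \sum_a y a ^+ 2.
Proof.
set S : R := \sum_a y a ^+ 2.
have e b : \sum_a (C * (2^-1 * (y b ^+ 2 + y a ^+ 2))) =
    C * (2^-1 * (y b ^+ 2 * #|J|%:R + S)).
  by rewrite -!mulr_sumr big_split /= sumr_const mulr_natr.
rewrite (eq_bigr _ (fun b _ => e b)) -!mulr_sumr big_split /= -mulr_suml -/S sumr_const -[S *+ _]mulr_natr.
by field.
Qed.

Lemma second_derivative_bound (U : set (Cn R n)) (theta : Cn R n -> R) : open U ->
  Cinfty U theta -> compactly_supported U theta ->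
  exists2 C : R, 0 <= C & forall Z, U Z -> forall X, `|'D_X ('D_X theta) Z| <= C * N2 X.
Proof.
move=> oU cth [cK KU]; set K := closure _ in cK KU.
have [dth dth1] := cth 2.
have th0 Z : U Z -> ~ K Z -> \forall Y \near Z, theta Y = 0.
  move=> UZ KZ; have : nbhs Z (~` K).
    by apply: open_nbhs_nbhs; split => //; apply: closed_openC; exact: closed_closure.
  move=> nK; apply: filterS2 nK (open_nbhs_nbhs (conj oU UZ)) => Y KY UY.
  by apply: contrapT => tY; apply: KY; apply: subset_closure; split => //; apply/eqP.
have bnd (a : I * I) : exists M : R, forall Z, U Z -> `|'D_(E a.2) ('D_(E a.1) theta) Z| <= M.
  apply: (compact_support_bound cK KU); first exact: (dth1 (E a.1)).2.
  move=> Z UZ KZ; have /nbhs_interior th := th0 Z UZ KZ.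
  have e1 : \forall Y \near Z, 'D_(E a.1) theta Y = (fun=> 0 : R) Y.
    apply: filterS th => Y tY.
    by rewrite (near_eq_derive (g := fun=> 0 : R) _ tY) derive_cst.
  by rewrite (near_eq_derive _ e1) derive_cst.
have [M HM] := choice bnd.
pose C0 : R := \sum_a `|M a|.
exists (C0 * (#|I|%:R)); first by rewrite mulr_ge0 // sumr_ge0.
move=> Z UZ X.
have e1 : \forall Y \near Z, 'D_X theta Y = \sum_a x X a * 'D_(E a) theta Y.
  apply: filterS (open_nbhs_nbhs (conj oU UZ)) => Y UY.
  by rewrite {1}(Cn_basis X) derive_sum_dir //; exact: dth.
have d2 : 'D_X ('D_X theta) Z = \sum_b x X b * (\sum_a x X a * 'D_(E b) ('D_(E a) theta) Z).
  rewrite {2}(Cn_basis X) derive_sum_dir; last exact: (dth1 X).1.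
  apply: eq_bigr => b _; congr (_ * _); rewrite (near_eq_derive _ e1).
  by rewrite derive_lin_comb // => a; exact: (dth1 (E a)).1.
rewrite d2; apply: le_trans (ler_norm_sum _ _ _) _.
apply: (@le_trans _ _ (\sum_b \sum_a (C0 * (2^-1 * (x X b ^+ 2 + x X a ^+ 2))))).
  apply: ler_sum => b _; rewrite normrM mulrC; apply: (@le_trans _ _ ((\sum_a `|x X a| * C0) * `|x X b|)).
    apply: ler_wpM2r => //; apply: le_trans (ler_norm_sum _ _ _) _.
    apply: ler_sum => a _; rewrite normrM ler_wpM2l //.
    apply: le_trans (HM (a, b) Z UZ) _; apply: le_trans (ler_norm _) _.
    by rewrite /C0 (bigD1 (a, b)) //= lerDl sumr_ge0.
  rewrite mulr_suml; apply: ler_sum => a _.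
  have C00 : 0 <= C0 by rewrite sumr_ge0.
  rewrite -(real_normK (num_real (x X b))) -(real_normK (num_real (x X a))).
  rewrite mulrAC mulrC; apply: ler_wpM2l => //.
  have := sqr_ge0 (`|x X a| - `|x X b|); nra.
by rewrite sum_mean_sq -N2_basis.
Qed.

Lemma lgl_midpoint (f : Cn R n -> R) Z : near_continuous f Z ->
  (\forall X \near (0 : Cn R n), 2 * f Z <= f (Z + X) + f (Z - X)) -> lgl f Z.
Proof.
move=> cf mf W eta eta0.
have [d1 d10 H1] := circle_continuous (@continuous_cin R n) (@cin_near R n) W cf.
have nZ : nbhs Z [set Y | 2 * f Z <= f (Z + (Y - Z)) + f (Z - (Y - Z))].
  have c : {for Z, continuous (fun Y : Cn R n => Y - Z)}.
    by apply: cvgB; [exact: cvg_id | exact: cvg_cst].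
  move: mf; rewrite -{1}(subrr Z) => mf'; exact: (c _ mf').
have [d2 d20 H2] := @cin_near R n Z W _ nZ.
exists (Num.min d1 d2); first by rewrite lt_min d10.
move=> s /andP[s0]; rewrite lt_min => /andP[sd1 sd2].
have cg : continuous (fun t => f (cin Z W s t)) by apply: H1; rewrite s0.
have cgs : continuous (fun t => f (cin Z W s (t + pi))).
  move=> t; apply: (continuous_at_comp (g := fun t => f (cin Z W s t)) (f := fun t : R => t + pi)); last exact: cg.
  by apply: cvgD; [exact: cvg_id | exact: cvg_cst].
have ms : amean (fun t => f (cin Z W s (t + pi))) = amean (fun t => f (cin Z W s t)).
  apply: (amean_shift cg); last exact: pi_ge0.
  by move=> t; rewrite /cin /cis mulr_natl cosD2pi sinD2pi.
have : 2 * f Z <= amean (fun t => f (cin Z W s t) + f (cin Z W s (t + pi))).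
  rewrite -[leLHS]amean_cst; apply: ler_amean; first exact: cst_continuous.
    by move=> t; have := cg t; have := cgs t => a b; cont.
  move=> t; have /= := H2 s (ltac:(by rewrite s0)) t.
  have -> : Z + (cin Z W s t - Z) = cin Z W s t by rewrite addrC subrK.
  have -> // : Z - (cin Z W s t - Z) = cin Z W s (t + pi).
  rewrite /cin /disc; congr (_ + _); rewrite (addrC Z) addrK.
  rewrite /cis /cvscale cosDpi sinDpi /= !scaleNr !opprK.
  by congr pair; rewrite /= ?opprB ?opprD // addrC.
rewrite ameanD // ms => h.
have : 0 <= eta * s ^+ 2 by rewrite mulr_ge0 ?sqr_ge0 // ltW.
lra.
Qed.
End StrictPsh.

Section StrictPshQuadratic.
Variables (R : realType) (m : nat).
Local Notation n := m.+2.
Implicit Types (Z W X : Cn R n).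
Local Notation N2 := (@N2 R m).

Lemma N2_parallelogram Z X : N2 (Z + X) + N2 (Z - X) = 2 * N2 Z + 2 * N2 X.
Proof.
rewrite /N2 !mulr_sumr -!big_split; apply: eq_bigr => i _ /=.
by rewrite /nsq /zc /= !mxE; ring.
Qed.

Lemma perturbed_midpoint (U : set (Cn R n)) (theta : Cn R n -> R) (C k : R) Z : open U -> U Z ->
  Cinfty U theta -> (forall Z, U Z -> forall X, `|'D_X ('D_X theta) Z| <= C * N2 X) ->
  \forall X \near (0 : Cn R n),
    k * theta (Z + X) + k * theta (Z - X) <= 2 * (k * theta Z) + `|k| * (C * N2 X).
Proof.
move=> oU UZ cth HC; have [dth dth1] := cth 2.
have /nbhs_ballP[e /= e0 He] := open_nbhs_nbhs (conj oU UZ).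
apply/nbhs_ballP; exists e => // X; rewrite -ball_normE /= sub0r normrN => Xe.
have UX (t : R) : -1 <= t <= 1 -> U (Z + t *: X).
  move=> t1; apply: He; rewrite -ball_normE /= opprD addNKr normrN normrZ.
  by apply: le_lt_trans Xe; apply: ler_piMl => //; rewrite ler_norml.
have := @second_difference_le R (fun t => k * theta (Z + t *: X))
  (fun t => k * 'D_X theta (Z + t *: X)) (fun t => k * 'D_X ('D_X theta) (Z + t *: X))
  (`|k| * (C * N2 X)).
rewrite scale1r scale0r addr0 scaleN1r; apply.
- move=> t /UX Ut; have := is_derive_line (dth _ Ut) => d.
  by apply: (@is_deriveZ _ _ _ _ k).
- move=> t /UX Ut; have := is_derive_line ((dth1 X).1 _ Ut) => d.
  by apply: (@is_deriveZ _ _ _ _ k).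
- move=> t /UX Ut; apply: le_trans (ler_norm _) _; rewrite normrM.
  by apply: ler_wpM2l => //; exact: HC.
Qed.

Lemma strictly_psh_quad (U : set (Cn R n)) (u : Cn R n -> R) : open U -> U !=set0 ->
  (forall Z, U Z -> u Z = 20^-1 * (N2 Z - 10)) -> strictly_psh U (EFin \o u).
Proof.
move=> oU [Z0 UZ0] uE; split; first by exists Z0.
move=> theta cth sth; have [C C0 HC] := second_derivative_bound oU cth sth.
exists (10^-1 / (C + 1)); first by rewrite divr_gt0 ?invr_gt0 // ltr_wpDl.
move=> eps epsC.
pose f Z := u Z + eps * theta Z.
have -> : (fun Z => (EFin \o u) Z + (eps * theta Z)%:E)%E = EFin \o f by [].
pose g Z := 20^-1 * (N2 Z - 10) + eps * theta Z.
have gf Z : U Z -> \forall Y \near Z, g Y = f Y.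
  by move=> UZ; apply: filterS (open_nbhs_nbhs (conj oU UZ)) => Y UY; rewrite /g -uE.
have cg Z : U Z -> {for Z, continuous g}.
  move=> UZ; have cq := @continuous_quad R m Z.
  have ct : {for Z, continuous theta} by apply: differentiable_continuous; exact: (cth 1).1.
  by rewrite /g; cont.
have epsC' : `|eps| * C <= 10^-1.
  have : `|eps| < 10^-1 / (C + 1) by rewrite ltr_norml.
  rewrite ltr_pdivlMr ?ltr_wpDl // => h.
  by have := normr_ge0 eps; nra.
apply: psh_local => // Z UZ.
  exact: (continuous_near_eq (gf Z UZ) (cg Z UZ)).
have ncg := open_near_continuous oU UZ cg.
apply: (lgln_eq ncg (gf Z UZ)); apply: lgl_midpoint => //.
apply: filterS (perturbed_midpoint (- eps) oU UZ cth HC) => X.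
rewrite normrN /g; have := N2_parallelogram Z X; have := N2_ge0 X.
have : `|eps| * C * N2 X <= 10^-1 * N2 X by rewrite ler_wpM2r // N2_ge0.
move: (N2 (Z + X)) (N2 (Z - X)) (N2 X) (N2 Z) (theta (Z + X)) (theta (Z - X)) (theta Z) => a b x z p q r.
by rewrite -mulrA !mulNr; move: (`|eps| * (C * x)) (eps * p) (eps * q) (eps * r) => l p' q' r'; lra.
Qed.

Lemma strictly_psh_near_uu : strictly_psh_near (@Omega R m) (EFin \o @uu R m) 0.
Proof.
have oN : open [set Z : Cn R n | N2 Z < 10^-1].
  have -> : [set Z | N2 Z < 10^-1] = N2 @^-1` [set x | x < 10^-1] by [].
  by apply: open_comp; [move=> Z _; exact: continuous_N2 | exact: open_lt].
have N0 : N2 0 < 10^-1 by rewrite N2_0 invr_gt0.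
exists (@Omega R m `&` [set Z | N2 Z < 10^-1]); split.
- by apply: openI => //; exact: open_Omega.
- by split => //; exact: Omega_0.
- by move=> Z [].
- apply: strictly_psh_quad.
  + by apply: openI => //; exact: open_Omega.
  + by exists 0; split => //; exact: Omega_0.
  + by move=> Z [_]; exact: uu_near0.
Qed.
End StrictPshQuadratic.

(** * Bump functions *)

Section FlatFunctions.
Variable R : realType.

(* The derivatives of these functions are linear combinations of them. *)
Definition flat (k : nat) (s : R) : R := if 0 < s then expR (- s^-1) * s^-1 ^+ k else 0.

Lemma flat_ge0 k s : 0 <= flat k s.
Proof.
by rewrite /flat; case: ifP => // /ltW s0; rewrite mulr_ge0 ?exprn_ge0 ?invr_ge0 // expR_ge0.
Qed.

Lemma flat_le k (s : R) : flat k s <= k.+2%:R ^+ k.+2 * s ^+ 2.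
Proof.
have C0 : 0 <= k.+2%:R ^+ k.+2 * s ^+ 2 :> R.
  by apply: mulr_ge0; [exact: exprn_ge0 | exact: sqr_ge0].
rewrite /flat; case: ifP => s0 //.
have N0 : 0 < k.+2%:R :> R by rewrite ltr0n.
have h : (s^-1 / k.+2%:R) ^+ k.+2 <= expR s^-1.
  have -> : expR s^-1 = expR (s^-1 / k.+2%:R) ^+ k.+2.
    by rewrite -expRM_natl -mulr_natl mulrCA mulfV ?mulr1 // gt_eqF.
  rewrite ler_pXn2r ?nnegrE ?expR_ge0 ?divr_ge0 ?invr_ge0 ?(ltW s0) //.
  by apply: le_trans (expR_ge1Dx _); rewrite lerDr.
rewrite expRN mulrC ler_pdivrMr ?expR_gt0 //.
apply: le_trans (ler_wpM2l _ h); last exact: C0.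
rewrite mulrAC -exprMn (mulrCA k.+2%:R) mulfV ?(gt_eqF N0) // mulr1 -(addn2 k) exprD -mulrA -exprMn.
by rewrite mulVf ?(gt_eqF s0) // expr1n mulr1.
Qed.

Lemma is_derive_flat k (s : R) : is_derive s 1 (flat k) (flat k.+2 s - k%:R * flat k.+1 s).
Proof.
have [s0|s0|->] := ltgtP s 0.
- have e : \forall y \near s, (fun=> 0 : R) y = flat k y.
    by apply: filterS (lt_nbhsl s0) => y y0; rewrite /flat ltNge (ltW y0).
  apply: (near_eq_is_derive e); rewrite /flat !ltNge (ltW s0) /= mulr0 subr0.
  exact: is_derive_cst.
- have e : \forall y \near s, (fun y => expR (- y^-1) * y^-1 ^+ k) y = flat k y.
    by apply: filterS (lt_nbhsr s0) => y y0; rewrite /flat y0.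
  apply: (near_eq_is_derive e).
  have di : is_derive s 1 (fun y : R => y^-1) (- s ^- 2).
    have := @is_deriveV R id s 1 1 (lt0r_neq0 s0) (is_derive_id _ _).
    by rewrite /GRing.scale /= mulr1.
  have dX : is_derive s 1 (fun y : R => y^-1 ^+ k) (k%:R * s^-1 ^+ k.-1 * (- s ^- 2)).
    by have := @is_deriveX _ _ (fun y : R => y^-1) k s 1 _ di; rewrite exprfctE.
  have dE : is_derive s 1 (fun y : R => expR (- y^-1)) (expR (- s^-1) * s ^- 2).
    apply: (@is_derive1_comp _ expR (fun y : R => - y^-1)).
    by apply: is_derive_eq; rewrite opprK.
  apply: is_derive_eq; rewrite /flat s0 /GRing.scale /=.
  have -> : s^-1 ^+ k.+2 = s^-1 ^+ k * s ^- 2 by rewrite -(addn2 k) exprD (exprVn s 2).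
  have -> : k%:R * (expR (- s^-1) * s^-1 ^+ k.+1) = expR (- s^-1) * (k%:R * s^-1 ^+ k.-1 * s ^- 2).
    case: (k) => [|j]; first by rewrite !mul0r mulr0.
    by rewrite -(exprVn s 2) /= -(addn2 j) exprD; ring.
  ring.
- have f0 j : flat j 0 = 0 by rewrite /flat ltxx.
  rewrite !f0 mulr0 subr0.
  have cv : (fun h : R => h^-1 *: (flat k (h *: 1 + 0) - flat k 0)) @ (0 : R)^' --> (0 : R).
    apply/cvgrPdist_lt => e e0.
    pose C : R := k.+2%:R ^+ k.+2.
    have C0 : 0 < C by rewrite exprn_gt0.
    have H : \forall h \near (0 : R)^', `|h| < e / C by apply: dnbhs0_lt; rewrite divr_gt0.
    apply: filterS2 H (nbhs_dnbhs_neq (0 : R)) => h hC h0.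
    rewrite sub0r normrN f0 subr0 addr0 -[h%:A]/(h * 1) mulr1 normrZ (ger0_norm (flat_ge0 _ _)) normfV.
    rewrite mulrC ltr_pdivrMr ?normr_gt0 //.
    apply: le_lt_trans (flat_le _ _) _; rewrite -/C -(real_normK (num_real h)) expr2 mulrA.
    by rewrite ltr_pM2r ?normr_gt0 // mulrC -ltr_pdivlMr.
  split; first by apply/cvg_ex; exists 0; exact: cv.
  exact: (cvg_lim (@norm_hausdorff _ _) cv).
Qed.

Variable V : normedModType R.

Inductive smooth : (V -> R) -> Prop :=
| smooth_cst c : smooth (fun=> c)
| smooth_lin L : (forall p, differentiable L p) -> (forall v, exists c, 'D_v L = (fun=> c)) -> smooth L
| smooth_add f g : smooth f -> smooth g -> smooth (fun p => f p + g p)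
| smooth_mul f g : smooth f -> smooth g -> smooth (fun p => f p * g p)
| smooth_flat k f : smooth f -> smooth (fun p => flat k (f p)).

Lemma smooth_diff f : smooth f -> forall p, differentiable f p.
Proof.
elim => {f} [c p|L dL _ p|f g _ df _ dg p|f g _ df _ dg p|k f _ df p].
- exact: differentiable_cst.
- exact: dL.
- exact: differentiableD.
- exact: differentiableM.
- apply: (differentiable_comp (df p)); apply/derivable1_diffP.
  exact: (@ex_derive _ _ _ _ _ _ _ (is_derive_flat k (f p))).
Qed.

Lemma smooth_derive f v : smooth f -> smooth ('D_v f).
Proof.
elim => {f} [c|L _ /(_ v)[c ->]|f g sf df sg dg|f g sf df sg dg|k f sf df].
- have -> : 'D_v (fun=> c : R) = (fun=> 0 : R) by apply/funext => p; rewrite derive_cst.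
  exact: smooth_cst.
- exact: smooth_cst.
- have -> : 'D_v (fun p => f p + g p) = (fun p => 'D_v f p + 'D_v g p).
    by apply/funext => p; apply: deriveD; apply: diff_derivable; apply: smooth_diff.
  exact: smooth_add.
- have -> : 'D_v (fun p => f p * g p) = (fun p => f p * 'D_v g p + g p * 'D_v f p).
    by apply/funext => p; apply: deriveM; apply: diff_derivable; apply: smooth_diff.
  by apply: smooth_add; exact: smooth_mul.
- have -> : 'D_v (fun p => flat k (f p)) =
      (fun p => (flat k.+2 (f p) + (- k%:R) * flat k.+1 (f p)) * 'D_v f p).
    apply/funext => p; have dfp := smooth_diff sf p.
    have [d1 d2] := is_derive_flat k (f p).
    have dh : differentiable (flat k) (f p) by apply/derivable1_diffP.
    rewrite deriveE; last exact: (differentiable_comp dfp dh).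
    have -> : 'd (fun p => flat k (f p)) p = 'd (flat k) (f p) \o 'd f p :> (_ -> _) by exact: diff_comp.
    rewrite /= diff1E // derive1E d2 -deriveE // /GRing.scale /= mulrC; ring.
  apply: smooth_mul => //; apply: smooth_add; first exact: smooth_flat.
  by apply: smooth_mul; [exact: smooth_cst | exact: smooth_flat].
Qed.
End FlatFunctions.

Definition cre (R : realType) (n : nat) (i : 'I_n) (Z : Cn R n) : R^o := Z.1 ord0 i.
Definition cim (R : realType) (n : nat) (i : 'I_n) (Z : Cn R n) : R^o := Z.2 ord0 i.
Lemma cre_lin (R : realType) (n : nat) (i : 'I_n) : linear (@cre R n i).
Proof. by move=> k Z W; rewrite /cre /= !mxE. Qed.
Lemma cim_lin (R : realType) (n : nat) (i : 'I_n) : linear (@cim R n i).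
Proof. by move=> k Z W; rewrite /cim /= !mxE. Qed.
HB.instance Definition _ (R : realType) (n : nat) (i : 'I_n) :=
  GRing.isLinear.Build R (Cn R n) R^o *:%R (@cre R n i) (@cre_lin R n i).
HB.instance Definition _ (R : realType) (n : nat) (i : 'I_n) :=
  GRing.isLinear.Build R (Cn R n) R^o *:%R (@cim R n i) (@cim_lin R n i).

Section Bump.
Variables (R : realType) (m : nat).
Local Notation n := m.+2.
Implicit Types (Z W X : Cn R n).
Local Notation N2 := (@N2 R m).

Lemma smooth_linear (L : {linear Cn R n -> R^o}) : continuous L -> @smooth R (Cn R n) L.
Proof.
move=> cL; apply: smooth_lin => [p|v]; first exact: linear_differentiable.
exists (L v); apply/funext => p; rewrite deriveE; last exact: linear_differentiable.
by rewrite diff_lin.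
Qed.

Lemma smooth_sum (J : finType) (F : J -> Cn R n -> R) : (forall j, smooth (F j)) ->
  smooth (fun Z => \sum_j F j Z).
Proof.
move=> sF; elim: (index_enum J) => [|j r IH].
  have -> : (fun Z => \sum_(j <- [::]) F j Z) = (fun=> 0) by apply/funext => Z; rewrite big_nil.
  exact: smooth_cst.
have -> : (fun Z => \sum_(i <- j :: r) F i Z) = (fun Z => F j Z + \sum_(i <- r) F i Z).
  by apply/funext => Z; rewrite big_cons.
exact: smooth_add.
Qed.

Lemma smooth_N2 : smooth N2.
Proof.
apply: (smooth_sum (F := fun i Z => nsq (zc i Z))) => i.
have sq (f : Cn R n -> R) : smooth f -> smooth (fun Z => f Z ^+ 2).
  by move=> sf; apply: (smooth_mul sf sf).
apply: smooth_add; apply: sq.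
- apply: (@smooth_linear (@cre R n i)) => Z.
  exact: (continuous_at_comp (@continuous_zc R m i Z) (@continuous_re R _)).
- apply: (@smooth_linear (@cim R n i)) => Z.
  exact: (continuous_at_comp (@continuous_zc R m i Z) (@continuous_im R _)).
Qed.

Lemma Cinfty_smooth (U : set (Cn R n)) f : smooth f -> Cinfty U f.
Proof.
move=> sf k; elim: k f sf => [|k IH] f sf /=.
  apply: continuous_subspaceT => Z; apply: differentiable_continuous; exact: smooth_diff.
split=> [Z _|v]; first exact: smooth_diff.
by apply: IH; exact: smooth_derive.
Qed.

Definition bump (r : R) Z : R := flat 0 (r + (-1) * N2 Z).

Lemma Cinfty_bump (r : R) U : Cinfty U (bump r).
Proof.
apply: Cinfty_smooth; apply: smooth_flat; apply: smooth_add; first exact: smooth_cst.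
by apply: smooth_mul; [exact: smooth_cst | exact: smooth_N2].
Qed.

Lemma bump_out r Z : r <= N2 Z -> bump r Z = 0.
Proof. by move=> h; rewrite /bump /flat ltNge mulN1r subr_le0 h. Qed.

Lemma bump0 r : 0 < r -> 0 < bump r 0.
Proof. by move=> r0; rewrite /bump /flat N2_0 mulr0 addr0 r0 mulr1 expR_gt0. Qed.

Lemma bump_supported r (U : set (Cn R n)) : [set Z | N2 Z <= r] `<=` U ->
  compactly_supported U (bump r).
Proof.
move=> rU.
have cl : closed [set Z | N2 Z <= r].
  have -> : [set Z | N2 Z <= r] = N2 @^-1` [set x | x <= r] by [].
  by apply: closed_comp; [move=> Z _; exact: continuous_N2 | exact: closed_le].
have sub : closure [set Z | U Z /\ bump r Z != 0] `<=` [set Z | N2 Z <= r].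
  rewrite [X in _ `<=` X]((closure_id _).1 cl); apply: closure_subset => Z [_ /eqP bZ] /=.
  by rewrite leNgt; apply/negP => /ltW /bump_out.
split; last exact: subset_trans sub rU.
exact: (subclosed_compact (@closed_closure _ _) (@N2_compact R m r)).
Qed.

Lemma nbhs_N2 (U : set (Cn R n)) : nbhs 0 U -> exists2 r : R, 0 < r & [set Z | N2 Z <= r] `<=` U.
Proof.
move=> /nbhs_ballP[e /= e0 He]; exists (e ^+ 2 / 2); first by rewrite divr_gt0 ?exprn_gt0.
move=> Z /= Zr; apply: He.
have c (x y : R) i : nsq (zc i Z) = x ^+ 2 + y ^+ 2 -> `|x| < e.
  move=> h; rewrite -(@ltr_pXn2r _ 2) ?nnegrE ?(ltW e0) // real_normK ?num_real //.
  apply: le_lt_trans (_ : e ^+ 2 / 2 < _); last by have := exprn_gt0 2 e0; lra.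
  apply: le_trans Zr; apply: le_trans (nsq_le_N2 i Z); rewrite h lerDl; exact: sqr_ge0.
split => /=.
- split=> // a b; rewrite (ord1 a) /ball /= !mxE sub0r normrN.
  exact: (c _ (Z.2 ord0 b) b).
- split=> // a b; rewrite (ord1 a) /ball /= !mxE sub0r normrN.
  apply: (c _ (Z.1 ord0 b) b); by rewrite addrC.
Qed.
End Bump.

(** * [C^1] functions on the domain *)

Section C1Functions.
Variables (R : realType) (m : nat).
Local Notation n := m.+2.
Implicit Types (Z W X : Cn R n) (phi : Cn R n -> R).
Local Notation N2 := (@N2 R m). Local Notation pt := (@pt R m).
Local Notation Omega := (@Omega R m). Local Notation three := (three R).
Let one : Cplx R := (1, 0).

Lemma PSHk_continuous k (U : set (Cn R n)) phi : open U -> PSHk k U phi ->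
  forall Z, U Z -> {for Z, continuous phi}.
Proof.
move=> oU [c _] Z UZ; case: k c => [c|k []].
  by move: c; rewrite /= continuous_open_subspace // => c; apply: c; exact/mem_set.
by move=> d _; apply: differentiable_continuous; exact: d.
Qed.

Lemma PSHk10 (U : set (Cn R n)) phi : open U -> PSHk 1 U phi -> PSHk 0 U phi.
Proof.
move=> oU h; split; last by case: h.
by apply: continuous_in_subspaceT => Z /set_mem; exact: (PSHk_continuous oU h).
Qed.

Lemma N2_pt0 w : N2 (pt 0 w) = nsq w.
Proof. by rewrite N2E zz_pt ww_pt BB_pt nsq0 add0r addr0. Qed.

Lemma not_strictly_psh_near0 k phi : PSHk k Omega phi ->
  (forall w, nsq w <= 1 -> phi (pt 0 w) <= phi 0) ->
  ~ strictly_psh_near Omega (EFin \o phi) 0.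
Proof.
move=> hphi phi1 [U [oU U0 UO [_ sU]]].
have [r0 r00 Hr] := nbhs_N2 (open_nbhs_nbhs (conj oU U0)).
pose r : R := Num.min r0 1.
have rp : 0 < r by rewrite lt_min r00 ltr01.
have rU : [set Z | N2 Z <= r] `<=` U.
  by move=> Z /= h; apply: Hr => /=; apply: le_trans h _; rewrite ge_min lexx.
have [e0 e00 He] := sU _ (@Cinfty_bump R m r U) (bump_supported rU).
pose e : R := e0 / 2.
have ep : 0 < e by rewrite divr_gt0.
have {}He : psh U (EFin \o (fun Z => phi Z + e * bump r Z)).
  by apply: (He e); rewrite /e; apply/andP; split; lra.
have cphi Z : U Z -> {for Z, continuous phi}.
  by move=> /UO; exact: (PSHk_continuous (@open_Omega R m) hphi).
have cf Z : U Z -> {for Z, continuous (fun Z => phi Z + e * bump r Z)}.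
  move=> UZ; have c1 := cphi Z UZ.
  have c2 : {for Z, continuous (bump r)}.
    by apply: differentiable_continuous; apply: (@Cinfty_bump R m r setT 1).1.
  by cont.
pose s : Cplx R := (Num.sqrt r, 0).
have ns : nsq s = r by rewrite /nsq /s /= expr0n addr0 sqr_sqrtr // ltW.
have dE c : disc 0 (pt 0 s) c = pt 0 (cmul c s) by rewrite -pt00 pt_disc cmul0r !add0r.
have cin : circ_in U 0 (pt 0 s).
  by move=> c c1; apply: rU => /=; rewrite dE N2_pt0 nsqM ns ler_piMl // (ltW rp).
have := psh_elim oU cf He cin; apply/negP; rewrite -ltNge.
apply: (@le_lt_trans _ _ (amean (fun=> phi 0))); last first.
  by rewrite amean_cst ltrDl mulr_gt0 // bump0.
have cis1 t : nsq (cis t : Cplx R) <= 1 by rewrite nsq_cis.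
apply: ler_amean.
- by apply: (continuous_circle oU cf) => t; exact: cin.
- exact: cst_continuous.
- move=> t; rewrite dE bump_out ?mulr0 ?addr0.
    by apply: phi1; rewrite nsqM ns nsq_cis mul1r ge_min lexx orbT.
  by rewrite N2_pt0 nsqM ns nsq_cis mul1r.
Qed.

Lemma slice_lgl1 (U : set (Cn R n)) phi Z W c : open U -> (forall Z, U Z -> {for Z, continuous phi}) ->
  psh U (EFin \o phi) -> U (disc Z W c) -> lgl1 (fun c => phi (disc Z W c)) c.
Proof.
move=> oU cphi pphi Uc k eta eta0.
have nU : nbhs c [set c | U (disc Z W c)].
  by apply: (@continuous_disc R n Z W c); exact: open_nbhs_nbhs.
have [d d0 Hd] := nbhs_nsq nU.
have k1 : 0 < 1 + nsq k by rewrite ltr_pwDl // nsq_ge0.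
exists (d / (1 + nsq k)); first by rewrite divr_gt0.
move=> s /andP[s0]; rewrite ltr_pdivlMr // => sd.
have cin : circ_in U (disc Z W c) (cvscale (s *: k) W).
  move=> c' c1; rewrite disc_disc; apply: Hd; rewrite nsqM nsqZ.
  apply: (@le_lt_trans _ _ ((s * (1 + nsq k)) ^+ 2)).
    rewrite exprMn; apply: (@le_trans _ _ (1 * (s ^+ 2 * nsq k))).
      by apply: ler_wpM2r => //; rewrite mulr_ge0 ?sqr_ge0 ?nsq_ge0.
    by rewrite mul1r; apply: ler_wpM2l; [exact: sqr_ge0 | have := nsq_ge0 k; nra].
  by rewrite ltr_pXn2r // nnegrE; apply: ltW => //; exact: mulr_gt0.
have := psh_elim oU cphi pphi cin; under [X in _ <= amean X -> _]eq_fun do rewrite disc_disc.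
by move=> h; apply: le_trans h _; rewrite lerDl mulr_ge0 ?sqr_ge0 // ltW.
Qed.

Lemma exists_ang (q : rat) N : exists2 k, (N <= k)%N & ang R k = ratr q.
Proof.
exists (2 ^ pickle q * (2 * N).+1)%N.
  apply: leq_trans (leq_pmull _ _); last by rewrite expn_gt0.
  by rewrite mul2n -addnn -addnS leq_addr.
rewrite /ang lognM ?expn_gt0 // pfactorK // logn_coprime ?addn0 ?pickleK //.
by rewrite prime_coprime // dvdn2 /= mul2n odd_double.
Qed.

Lemma wpt_dense (w : Cplx R) O : nsq w = 1 -> nbhs w O -> exists k, O (wpt R k).
Proof.
move=> w1 /nbhs_nsq[d d0 Hd].
have [t0 _ wE] := circle_param w1.
have nt : nbhs t0 [set t : R | nsq (cis t - w) < d ^+ 2 / 4].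
  have c : {for t0, continuous (fun t : R => nsq (cis t - w))}.
    apply: (continuous_at_comp (f := fun t : R => cis t - w)); last exact: continuous_nsq.
    by apply: cvgB; [exact: continuous_cis | exact: cvg_cst].
  by apply: (cvgr_lt _ c); rewrite -wE subrr nsq0 divr_gt0 ?exprn_gt0.
have [del /= del0 Hdel] := nt.
have : t0 - del < t0 + del by lra.
move=> /rat_in_itvoo[q]; rewrite in_itv /= => /andP[q1 q2].
have qn : nsq (cis (ratr q) - w) < d ^+ 2 / 4.
  by apply: Hdel; rewrite /= ltr_distlC q1 q2.
have [N HN] := @eta_small R (d / 2) (divr_gt0 d0 (ltr0Sn _ 1)).
have [k Nk kq] := exists_ang q N.
exists k; have -> : wpt R k = w + (wpt R k - w) by rewrite addrC subrK.
apply: Hd; have -> : wpt R k - w = eta R k *: cis (ratr q) + (cis (ratr q) - w).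
  by rewrite /wpt kq scalerDl scale1r [_ + eta R k *: _]addrC addrA.
apply: le_lt_trans (nsqD_le _ _) _; rewrite nsqZ nsq_cis mulr1.
have := HN k Nk; have := eta_gt0 R k; move: (eta R k) (nsq _) qn => x y qn x0 xd; nra.
Qed.

Variables (phi : Cn R n -> R) (M : R).
Hypothesis C1phi : PSHk 1 Omega phi.
Hypothesis phiM : forall Z, Omega Z -> phi Z <= M.

Let oO : open Omega := @open_Omega R m.
Let cphi : forall Z, Omega Z -> {for Z, continuous phi} := PSHk_continuous oO C1phi.
Let mval : R := phi (pt three 0).

Lemma line_const (v : Cplx R -> R) Z W : v = (fun c => phi (disc Z W c)) ->
  (forall c, Omega (disc Z W c)) -> forall p q, v p = v q.
Proof.
move=> -> OZ; apply: (@liouville R _ M) => c; last exact: phiM.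
- apply: (continuous_at_comp (@continuous_disc R n Z W c)); exact: cphi.
- by apply: (slice_lgl1 oO cphi C1phi.2).
Qed.

Lemma disc_line c w : disc (pt 0 w) (pt one 0) c = pt c w.
Proof. by rewrite pt_disc cmul0r addr0 add0r cmulC /cmul /= !mul1r !mul0r subr0 addr0; case: c. Qed.

Lemma disc_line_w c z : disc (pt z 0) (pt 0 one) c = pt z c.
Proof. by rewrite pt_disc cmul0r addr0 add0r cmulC /cmul /= !mul1r !mul0r subr0 addr0; case: c. Qed.

Lemma phi_wpt k : phi (pt 0 (wpt R k)) = mval.
Proof.
have e1 : phi (pt 0 (wpt R k)) = phi (pt three (wpt R k)).
  apply: (@line_const (fun c => phi (pt c (wpt R k))) (pt 0 (wpt R k)) (pt one 0)).
  - by apply/funext => c; rewrite disc_line.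
  - by move=> c; rewrite disc_line; exact: Omega_line.
rewrite e1; apply: (@line_const (fun c => phi (pt three c)) (pt three 0) (pt 0 one)).
- by apply/funext => c; rewrite disc_line_w.
- by move=> c; rewrite disc_line_w; exact: Omega_line3.
Qed.

Let v (c : Cplx R) : R := phi (pt 0 c).

Lemma cont_v c : nsq c <= 4 -> {for c, continuous v}.
Proof.
move=> c4; have -> : v = (fun c => phi (disc (pt 0 0) (pt 0 one) c)).
  by apply/funext => x; rewrite disc_line_w.
apply: (continuous_at_comp (@continuous_disc R n (pt 0 0) (pt 0 one) c)); apply: cphi.
by rewrite disc_line_w; exact: Omega_disc.
Qed.

Lemma cont_v1 c : nsq c <= 1 -> {for c, continuous v}.
Proof. by move=> h; apply: cont_v; apply: le_trans h _; rewrite ler1n. Qed.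

Lemma lgl_v c : nsq c <= 4 -> lgl1 v c.
Proof.
move=> c4; have -> : v = (fun c => phi (disc (pt 0 0) (pt 0 one) c)).
  by apply/funext => x; rewrite disc_line_w.
by apply: (slice_lgl1 oO cphi C1phi.2); rewrite disc_line_w; exact: Omega_disc.
Qed.

Lemma v_circle c : nsq c = 1 -> v c = mval.
Proof.
move=> c1; apply: contrapT => /eqP vc.
have cv : {for c, continuous v} by apply: cont_v1; rewrite c1.
have nO : nbhs c [set c | v c != mval].
  by apply: (cv [set x | x != mval]); apply: open_nbhs_nbhs.
by have [k /=] := wpt_dense c1 nO; rewrite /v phi_wpt eqxx.
Qed.

Lemma v_disc c : nsq c <= 1 -> v c <= mval.
Proof.
apply: disc_max; first exact: cont_v1.
- by move=> x x1; apply: lgl_v; apply: le_trans (ltW x1) _; rewrite ler1n.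
- by move=> x /v_circle ->.
Qed.

Lemma nsq_one : nsq one = 1. Proof. by rewrite /nsq /= expr0n expr1n addr0. Qed.

(* [v = mval] also holds at the points [1 + eta k] with [ang k = 0], so the radial
   derivative at 1 vanishes, against the Hopf lemma unless [v] is constant. *)
Lemma v_center : v 0 = mval.
Proof.
have v0 := @v_disc 0; rewrite nsq0 in v0.
apply/eqP; rewrite eq_le v0 ?ler01 //= leNgt; apply/negP => lt0.
have [k k0 [del1 /= del10 Hk]] : exists2 k : R, 0 < k &
    \forall t \near (1 : R)^'-, v ((t, 0) : Cplx R) <= mval - k * (1 - t).
  apply: hopf => //; first exact: cont_v1.
  - by move=> x x1; apply: lgl_v; apply: le_trans (ltW x1) _; rewrite ler1n.
  - by move=> x /v_circle ->.
pose g (t : R) : R := v ((t, 0) : Cplx R).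
have gE t : g t = phi (pt 0 0 + t *: pt 0 one).
  rewrite /g /v; congr phi; rewrite -disc_line_w /disc; congr (_ + _).
  by rewrite /cvscale /= !scale0r subr0 addr0.
have g1 : g 1 = mval by rewrite /g v_circle // nsq_one.
have dphi : differentiable phi (pt 0 0 + 1 *: pt 0 one).
  apply: C1phi.1.1; have -> : pt 0 0 + 1 *: pt 0 one = pt 0 one.
    by rewrite pt00 add0r scale1r.
  by apply: Omega_disc; rewrite nsq_one ler1n.
have [dg _] := is_derive_line dphi.
rewrite (_ : (fun t : R => phi (pt 0 0 + t *: pt 0 one)) = g) in dg; last by apply/funext => t; rewrite gE.
have k2 : 0 < k / 2 by rewrite divr_gt0.
have /cvg_ex[D /cvgrPdist_lt/(_ _ k2)[del /= del0 Hdel]] := dg.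
have Q h : h != 0 -> `|h| < del -> `|D - h^-1 * (g (h + 1) - mval)| < k / 2.
  move=> h0 hd; have := Hdel h; rewrite /= sub0r normrN => /(_ hd h0).
  by rewrite g1 -[h%:A]/(h * 1) mulr1.
have [N HN] := @eta_small R del del0.
have [j Nj aj] := exists_ang 0 N.
have e0 := eta_gt0 R j.
have Q1 : `|D| < k / 2.
  have := Q (eta R j) (lt0r_neq0 e0).
  rewrite gtr0_norm // => /(_ (HN j Nj)).
  have -> : g (eta R j + 1) = mval.
    rewrite -(phi_wpt j) /g /v /wpt aj rmorph0 /cis cos0 sin0; congr (phi (pt 0 _)).
    by rewrite addrC; congr pair; rewrite /= ?[_%:A]mulr1 ?scaler0.
  by rewrite subrr mulr0 subr0.
pose h : R := Num.min del del1 / 2.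
have h0 : 0 < h by rewrite divr_gt0 // lt_min del0.
have : h < Num.min del del1 by rewrite /h ltr_pdivrMr // ltr_pMr ?ltr1n // lt_min del0.
rewrite lt_min => /andP[hd hd1].
have Q2 : `|D - (- h)^-1 * (g (- h + 1) - mval)| < k / 2.
  by apply: Q; rewrite ?oppr_eq0 ?lt0r_neq0 // normrN gtr0_norm.
have G : g (- h + 1) <= mval - k * h.
  have e : h = 1 - (- h + 1) by ring.
  rewrite {2}e; apply: Hk; last by rewrite gtrDr oppr_lt0.
  by rewrite /= -e gtr0_norm.
have q : k <= (- h)^-1 * (g (- h + 1) - mval).
  by rewrite invrN mulNr -mulrN opprB mulrC ler_pdivlMr //; lra.
move: Q1 Q2; rewrite !ltr_norml => /andP[_ a] /andP[b _]; lra.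
Qed.

Lemma C1_disc w : nsq w <= 1 -> phi (pt 0 w) <= phi 0.
Proof. by move=> w1; rewrite -[in leRHS]pt00 -/(v 0) v_center; exact: v_disc. Qed.

Lemma C1_circle : phi (pt 0 one) = phi 0.
Proof. by rewrite -[in RHS]pt00 -/(v 0) v_center; exact: v_circle nsq_one. Qed.
End C1Functions.

Theorem mainTheorem3 (R : realType) (n : nat) (hn : (2 <= n)%N) :
  exists Omega : set (Cn R n),
    [/\ domain Omega,
        pseudoconvex Omega,
        core 0 Omega `<` core 1 Omega
      & exists u : Cn R n -> R,
          [/\ PSHk 0 Omega u,
              [bounded u z | z in Omega]
            & ~ exists f : nat -> Cn R n -> R,
                  (forall j, PSHk 1 Omega (f j) /\
                             [bounded f j z | z in Omega]) /\
                  (forall z, Omega z -> f j z @[j --> \oo] --> u z)]].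
Proof.
case: n hn => [//|[//|m]] _.
have oO := @open_Omega R m.
exists (@Omega R m); split.
- exact: domain_Omega.
- exact: pseudoconvex_Omega.
- split.
    move=> Z [OZ H]; split => // phi hphi; apply: H; exact: PSHk10.
  move=> /(_ 0)[].
    split; first exact: Omega_0.
    move=> phi hphi [M ubM]; apply: (not_strictly_psh_near0 hphi) => w.
    by apply: (C1_disc hphi (M := M)) => Z OZ; apply: ubM; exists Z.
  move=> _ /(_ (@uu R m) (@PSHk0_uu R m))[]; last exact: strictly_psh_near_uu.
  by exists 20 => _ [Z /Omega_sub/uu_bounds/andP[_ h] <-].
- exists (@uu R m); split; [exact: PSHk0_uu | exact: bounded_uu | move=> [f [Hf fu]]].
  have O1 : Omega (pt m 0 ((1, 0) : Cplx R)) by apply: Omega_disc; rewrite nsq_one ler1n.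
  have e j : f j (pt m 0 ((1, 0) : Cplx R)) = f j 0.
    have [C1f [M [_ HM]]] := Hf j.
    apply: (C1_circle C1f (M := `|M| + 1)) => Z OZ; apply: le_trans (ler_norm _) _.
    by apply: HM => //; apply: le_lt_trans (ler_norm M) _; rewrite ltrDl.
  have := fu _ O1; under eq_fun do rewrite e; rewrite uu_pt01 => l1.
  have := fu _ (@Omega_0 R m); rewrite uu_0 => l2.
  have /eqP : (0 : R) = - 2^-1 by apply: (cvg_unique (@norm_hausdorff _ _) l1 l2).
  by rewrite eq_sym oppr_eq0 invr_eq0 pnatr_eq0.
Qed.
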